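(* Let $(X,Y)=(X^1,\ldots,X^d,Y)$ be an $\mathbb R^{d+1}$-valued random variable with moment-generating function $\mathcal M(\xi,\eta)=\mathbb E\exp(\xi\cdot X+\eta Y)$ defined and non-zero on the open polydisc $D_{(R_X,R_Y)}\subset\mathbb C^{d+1}$, where $R_X\in(0,\infty]^d$ and $R_Y\in(0,\infty]$, and let $\mathcal K=\log\mathcal M$ (with $\mathcal K(0)=0$). Let $\varepsilon>0$ be such that for every $\sigma\in(0,\infty)^d$ with $\sigma<R_X$ there is a constant $A_\sigma$ with $$\sup_{\xi\in D_\sigma}\bigl|\partial_\eta\mathcal K(\xi,\eta)|_{\eta=0}\bigr|\le A_\sigma\,\varepsilon.$$ Let $f\colon\mathbb C^d\to\mathbb C$ be entire with $|f(z)|\le C\exp(r\cdot|z|)$ for all $z\in\mathbb C^d$, for some $C>0$ and $r\in[0,\infty)^d$ with $r<R_X$, and let $y$ denote the $(d+1)$-th coordinate function on $\mathbb R^{d+1}$. Then the Wick product $f\diamond y$ is defined, and $$f(x)\diamond y=f(x)\,y-\sum_{I\ne\varnothing}\frac{\partial_If(x)}{I!}\,\kappa[X^I,Y],$$ where the series converges absolutely, both locally uniformly and in $L^1$. More specifically, for any $\rho,\sigma$ with $r<\rho<\sigma<R_X$ there exists a constant $C_{\rho,\sigma}$ (not depending on $I$ or $\varepsilon$) such that for all $I\neq\varnothing$ $$\Bigl\|\frac{\partial_If(X)}{I!}\kappa[X^I,Y]\Bigr\|_{L^1}\le C_{\rho,\sigma}\Bigl(\frac\rho\sigma\Bigr)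^I\varepsilon.$$
   Context: For $R\in(0,\infty]^n$, $D_R=\{\theta\in\mathbb C^n:|\theta_i|<R_i\ \forall i\}$; the moment-generating function of a random vector $Z$ is defined on $D_R$ if $\mathbb E\exp(q\cdot|Z|)<\infty$ for all $q\in[0,\infty)^n$ with $q<R$. Inequalities between vectors are entrywise and $|z|=(|z_1|,\ldots,|z_n|)$ in expressions such as $r\cdot|z|$. $I$ ranges over multiindices in $\mathbb N_0^d$, identified with finite multisets of elements of $\{1,\ldots,d\}$ ($I\ne\varnothing$ means $I\ne0$); $I!=\prod I_k!$, $(\rho/\sigma)^I=\prod_k(\rho_k/\sigma_k)^{I_k}$, $\partial_I=\prod\partial_k^{I_k}$, and $\kappa[X^I,Y]=\kappa[X^{i_1},\ldots,X^{i_n},Y]$ is the joint cumulant when $I$ corresponds to $\{i_1,\ldots,i_n\}$. Appell polynomials of a random vector $Z$ in $\mathbb R^n$ with moment-generating function $\mathcal M$ are defined by $\exp(\theta\cdot z)/\mathcal M(\theta)=\sum_Kz^{\diamond K}\theta^K/K!$ for $\theta\in\mathbb C^n$ near $0$. If $\mathcal M$ is defined and non-zero on $D_R$, and $f,g$ are entire on $\mathbb C^n$ with $|f(z)|\le Ce^{r_f\cdot|z|}$, $|g(z)|\le Ce^{r_g\cdot|z|}$, $r_f+r_g<R$, then $f$ and $g$ have absolutely convergent Appell expansions $f=\sum_Ia_Iz^{\diamond I}/I!$, $g=\sum_Jb_Jz^{\diamond J}/J!$, with $a_I=\mathbb E\,\partial_If(Z)$ and $b_J=\mathbb E\,\partial_Jg(Z)$,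 and their Wick product is $f\diamond g=\sum_{I,J}a_Ib_J\,z^{\diamond(I+J)}/(I!J!)$, ''defined'' meaning absolutely convergent locally uniformly and in $L^1$ of the law of $Z$. Here this is applied with $Z=(X,Y)$, $n=d+1$, with $f$ viewed as a function of $(x,y)$ not depending on $y$. *)

(* Defs.v *)
From HB Require Import structures.
From mathcomp Require Import all_boot all_order all_algebra finmap.
From mathcomp Require Import complex.
From mathcomp Require Import all_classical all_reals all_analysis summability.
Set Implicit Arguments.
Unset Strict Implicit.
Unset Printing Implicit Defensive.
Import Order.TTheory GRing.Theory Num.Theory.
Import numFieldNormedType.Exports.
Local Open Scope classical_set_scope.
Local Open Scope ring_scope.

(* The topology of R[i] is the one MathComp-Analysis puts on every
   numFieldType; it is only declared by default on the alias R[i]^o. *)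
HB.instance Definition _ (R : realType) := NormedModule.copy R[i] R[i]^o.

(* Vectors are row vectors; a point (x, y) of C^(d+1) is the row vector
   row_mx x (const_mx y) of 'rV_(d + 1), and likewise for radii and
   multiindices. *)

Definition vlt (disp : Order.disp_t) (T : porderType disp) (n : nat)
    (u v : 'rV[T]_n) : Prop :=
  forall k, (u ord0 k < v ord0 k)%O.

Definition vle (disp : Order.disp_t) (T : porderType disp) (n : nat)
    (u v : 'rV[T]_n) : Prop :=
  forall k, (u ord0 k <= v ord0 k)%O.

Definition dot (K : comNzRingType) (n : nat) (u v : 'rV[K]_n) : K :=
  \sum_k u ord0 k * v ord0 k.

Definition mindex (n : nat) := 'rV[nat]_n.

Definition mfact (n : nat) (I : mindex n) : nat := (\prod_k (I ord0 k)`!)%N.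

Definition mpow (K : comNzRingType) (n : nat) (u : 'rV[K]_n) (I : mindex n) : K :=
  \prod_k u ord0 k ^+ I ord0 k.

(* The norm `|z| of R[i] has values in R[i]; cabs is the R-valued modulus. *)
Definition cabs (R : realType) (z : R[i]) : R := Normc.normc z.

Definition vabs (R : realType) (n : nat) (z : 'rV[R[i]]_n) : 'rV[R]_n :=
  map_mx (@cabs R) z.

Definition cvec (R : realType) (n : nat) (x : 'rV[R]_n) : 'rV[R[i]]_n :=
  map_mx (real_complex R) x.

Definition cexp (R : realType) (z : R[i]) : R[i] :=
  Complex (expR (complex.Re z) * cos (complex.Im z))
          (expR (complex.Re z) * sin (complex.Im z)).

Definition polydisc (R : realType) (n : nat) (rad : 'rV[\bar R]_n) :
    set 'rV[R[i]]_n :=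
  [set theta | vlt (map_mx EFin (vabs theta)) rad].

(* Here the base field of [differentiable] is R[i], so that differentiability
   is complex differentiability. *)
Definition holomorphic_on (R : realType) (n : nat) (D : set 'rV[R[i]]_n)
    (f : 'rV[R[i]]_n -> R[i]) : Prop :=
  forall z, D z -> differentiable f z.

Definition entire (R : realType) (n : nat) (f : 'rV[R[i]]_n -> R[i]) : Prop :=
  holomorphic_on setT f.

Definition partial (R : realType) (n : nat) (k : 'I_n)
    (f : 'rV[R[i]]_n -> R[i]) : 'rV[R[i]]_n -> R[i] :=
  fun z => 'D_(delta_mx ord0 k) f z.

Definition mpartial (R : realType) (n : nat) (I : mindex n)
    (f : 'rV[R[i]]_n -> R[i]) : 'rV[R[i]]_n -> R[i] :=
  foldr (fun k g => iter (I ord0 k) (partial k) g) f (enum 'I_n).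

Definition cintegrable (d : measure_display) (T : measurableType d)
    (R : realType) (P : probability T R) (g : T -> R[i]) : Prop :=
  P.-integrable setT (fun w => (complex.Re (g w))%:E) /\
  P.-integrable setT (fun w => (complex.Im (g w))%:E).

Definition cexpectation (d : measure_display) (T : measurableType d)
    (R : realType) (P : probability T R) (g : T -> R[i]) : R[i] :=
  Complex (fine 'E_P[fun w => complex.Re (g w)])
          (fine 'E_P[fun w => complex.Im (g w)]).

Definition random_vector (d : measure_display) (T : measurableType d)
    (R : realType) (P : probability T R) (n : nat) (X : 'I_n -> {RV P >-> R}) :
    T -> 'rV[R]_n :=
  fun w => \row_k X k w.

Definition adjoin_rv (d : measure_display) (T : measurableType d)
    (R : realType) (P : probability T R) (n : nat) (X : 'I_n -> {RV P >-> R})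
    (Y : {RV P >-> R}) : T -> 'rV[R]_(n + 1) :=
  fun w => row_mx (random_vector X w) (const_mx (Y w)).

Definition mgf (d : measure_display) (T : measurableType d)
    (R : realType) (P : probability T R) (n : nat) (Z : T -> 'rV[R]_n)
    (theta : 'rV[R[i]]_n) : R[i] :=
  cexpectation P (fun w => cexp (dot theta (cvec (Z w)))).

Definition mgf_defined (d : measure_display) (T : measurableType d)
    (R : realType) (P : probability T R) (n : nat) (Z : T -> 'rV[R]_n)
    (rad : 'rV[\bar R]_n) : Prop :=
  forall q : 'rV[R]_n, vle 0 q -> vlt (map_mx EFin q) rad ->
    ('E_P[fun w => expR (dot q (map_mx Num.norm (Z w)))] < +oo)%E.

(* The holomorphic branch of log M on the polydisc (where M has no zero)
   that vanishes at 0. *)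
Definition is_cgf (d : measure_display) (T : measurableType d)
    (R : realType) (P : probability T R) (n : nat) (Z : T -> 'rV[R]_n)
    (rad : 'rV[\bar R]_n) (K : 'rV[R[i]]_n -> R[i]) : Prop :=
  [/\ holomorphic_on (polydisc rad) K,
      K 0 = 0 &
      forall theta, polydisc rad theta -> cexp (K theta) = mgf P Z theta].

(* The joint cumulant in which the k-th component is repeated L_k times, as a
   derivative of the cumulant-generating function K. *)
Definition joint_cumulant (R : realType) (n : nat) (K : 'rV[R[i]]_n -> R[i])
    (L : mindex n) : R[i] :=
  mpartial L K 0.

(* The terms of the generating series are summed unconditionally, that is
   along the directed set of finite sets of multiindices. *)
Definition is_appell (d : measure_display) (T : measurableType d)
    (R : realType) (P : probability T R) (n : nat) (Z : T -> 'rV[R]_n)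
    (p : mindex n -> 'rV[R[i]]_n -> R[i]) : Prop :=
  forall z, \forall theta \near (0 : 'rV[R[i]]_n),
    partial_sum (fun K : mindex n => p K z * mpow theta K / (mfact K)%:R)
      @ totally --> cexp (dot theta z) / mgf P Z theta.

Definition appell (d : measure_display) (T : measurableType d)
    (R : realType) (P : probability T R) (n : nat) (Z : T -> 'rV[R]_n) :
    mindex n -> 'rV[R[i]]_n -> R[i] :=
  get [set p | is_appell P Z p].

Definition L1norm (d : measure_display) (T : measurableType d)
    (R : realType) (P : probability T R) (n : nat) (Z : T -> 'rV[R]_n)
    (h : 'rV[R[i]]_n -> R[i]) : \bar R :=
  'E_P[fun w => cabs (h (cvec (Z w)))].

(* Absolute convergence with respect to the suprema over a neighbourhood of
   each point (normal convergence). *)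
Definition abs_cvg_locally_uniformly (R : realType) (n : nat) (I : choiceType)
    (u : I -> 'rV[R[i]]_n -> R[i]) : Prop :=
  forall z0 : 'rV[R[i]]_n, exists2 U : set 'rV[R[i]]_n, nbhs z0 U &
    (\esum_(i in setT) ereal_sup [set (cabs (u i z))%:E | z in U] < +oo)%E.

Definition abs_cvg_L1 (d : measure_display) (T : measurableType d)
    (R : realType) (P : probability T R) (n : nat) (Z : T -> 'rV[R]_n)
    (I : choiceType) (u : I -> 'rV[R[i]]_n -> R[i]) : Prop :=
  (forall i, cintegrable P (fun w => u i (cvec (Z w)))) /\
  (\esum_(i in setT) L1norm P Z (u i) < +oo)%E.

Definition appell_coef (d : measure_display) (T : measurableType d)
    (R : realType) (P : probability T R) (n : nat) (Z : T -> 'rV[R]_n)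
    (f : 'rV[R[i]]_n -> R[i]) (I : mindex n) : R[i] :=
  cexpectation P (fun w => mpartial I f (cvec (Z w))).

Definition wick_term (d : measure_display) (T : measurableType d)
    (R : realType) (P : probability T R) (n : nat) (Z : T -> 'rV[R]_n)
    (f g : 'rV[R[i]]_n -> R[i]) (IJ : mindex n * mindex n)
    (z : 'rV[R[i]]_n) : R[i] :=
  appell_coef P Z f IJ.1 * appell_coef P Z g IJ.2 *
  (appell P Z (IJ.1 + IJ.2) z / ((mfact IJ.1)%:R * (mfact IJ.2)%:R)).

(* The first two clauses make the expectations a_I, b_J meaningful:
   [cexpectation] is a junk value on non-integrable functions. *)
Definition wick_defined (d : measure_display) (T : measurableType d)
    (R : realType) (P : probability T R) (n : nat) (Z : T -> 'rV[R]_n)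
    (f g : 'rV[R[i]]_n -> R[i]) : Prop :=
  [/\ forall I, cintegrable P (fun w => mpartial I f (cvec (Z w))),
      forall J, cintegrable P (fun w => mpartial J g (cvec (Z w))),
      abs_cvg_locally_uniformly (wick_term P Z f g) &
      abs_cvg_L1 P Z (wick_term P Z f g)].

Definition wick (d : measure_display) (T : measurableType d)
    (R : realType) (P : probability T R) (n : nat) (Z : T -> 'rV[R]_n)
    (f g : 'rV[R[i]]_n -> R[i]) (z : 'rV[R[i]]_n) : R[i] :=
  summability.sum (fun IJ => wick_term P Z f g IJ z).

Definition lift_fun (R : realType) (n : nat) (f : 'rV[R[i]]_n -> R[i]) :
    'rV[R[i]]_(n + 1) -> R[i] :=
  fun z => f (lsubmx z).

Definition last_coord (R : realType) (n : nat) : 'rV[R[i]]_(n + 1) -> R[i] :=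
  fun z => z ord0 (rshift n ord0).

(* (d_I f / I!) kappa[X^I, Y], with K the cumulant-generating function of
   (X, Y). *)
Definition wick_correction (R : realType) (n : nat) (f : 'rV[R[i]]_n -> R[i])
    (K : 'rV[R[i]]_(n + 1) -> R[i]) (I : mindex n) (x : 'rV[R[i]]_n) : R[i] :=
  mpartial I f x / (mfact I)%:R * joint_cumulant K (row_mx I (const_mx 1%N)).

(* Main.v *)
Require Import Defs.
From HB Require Import structures.
From mathcomp Require Import all_boot all_order all_algebra finmap.
From mathcomp Require Import complex.
From mathcomp Require Import all_classical all_reals all_analysis summability.
From mathcomp Require Import ring lra.
From mathcomp Require Import measurable_realfun.
Set Implicit Arguments.
Unset Strict Implicit.
Unset Printing Implicit Defensive.
Import Order.TTheory GRing.Theory Num.Theory.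
Import numFieldNormedType.Exports.
Local Open Scope classical_set_scope.
Local Open Scope ring_scope.

(** The proof rests on writing functions as superpositions of exponentials.
    As [f] has exponential type [r], its derivatives at the origin satisfy
    [|a_I| <= C' r'^I] for any [r' > r], and for [rho > r'] it is the mean over
    the torus [|xi_k| = rho_k]
    [f(x) = mean of beta(xi) exp(xi . x)],  [beta(xi) = sum_I a_I / xi^I],
    so that [d_I f(x)] is the mean of [xi^I beta(xi) exp(xi . x)] and
    [E d_I f(X)] the mean of [xi^I beta(xi) M(xi, 0)].  The Appell polynomials
    are the derivatives at the origin of
    [exp(theta . z - K theta) = exp(theta . z) / M theta].

    All derivatives of [y] of order two or more vanish and [f] does not depend
    on [y], hence their Wick product only involves the Appell polynomials of indices [(I, 0)] and
    [(I, 1)], which are generated, at [eta = 0], by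
    [exp(xi . x - K(xi, 0))] and [(y - k(xi)) exp(xi . x - K(xi, 0))] with
    [k(xi) = d_eta K(xi, 0) = sum_I kappa[X^I, Y] xi^I / I!].
    Pairing these power series with [beta M] on the torus term by term, the
    factor [M(xi, 0)] cancels [exp(- K(xi, 0))].  The indices [(I, 0)] give the
    mean of [beta(xi) exp(xi . x)], that is [f(x)], to be multiplied by [E Y];
    the indices [(I, 1)] give the mean of [beta(xi) exp(xi . x) (y - k(xi))],
    that is [f(x) y - sum_I d_I f(x) kappa[X^I, Y] / I!].  As [E Y] is the
    cumulant with [I = 0], the sum over [I != 0] remains ([hsum_wick],
    [wick_last]).

    The estimates come from the same formulas: [|d_I f(x)|] is at most a
    constant times [rho^I exp(rho . |x|)] ([cabs_mpartial_le]), while Cauchy's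
    inequality for [k] bounds [|kappa[X^I, Y]| / I!] by a constant times
    [eps / sigma^I]; the expectation of [exp(rho . |X|)] is finite
    ([wick_correction_le], [L1norm_wick_correction_le]).

    A mean over a torus is taken to be the limit of the means over finer and
    finer grids of roots of unity ([tmean]).  Expectations commute with these
    finite means and dominated convergence covers the limit
    ([superposition_expectation]), and orthogonality of the characters of a
    cyclic group makes the means extract the coefficients of a power series
    ([coef_tmean]).  The one analytic input is that a function that is complex
    differentiable on a polydisc is the sum of its Taylor series there
    ([polydisc_series], [holomorphic_egf]).  In one variable, Goursat's
    bisection argument leads to Cauchy's formula for a difference quotient
    ([cauchy_diff_quotient]) and then to a geometric estimate of the error of
    interpolation at roots of unity ([interp_close]); interpolating in each
    variable in turn yields the series in several variables. *)

(** * Modulus and convergence of complex numbers *)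

Arguments cabs : simpl never.
Arguments cexp : simpl never.

Section ComplexModulus.
Variable R : realType.
Implicit Types z w : R[i].

Lemma normCE z : `|z| = (cabs z)%:C%C.
Proof. by case: z. Qed.

Lemma cabs_ge0 z : 0 <= cabs z.
Proof. by rewrite -lecR -normCE normr_ge0. Qed.

Lemma cabs0 : cabs (0 : R[i]) = 0. Proof. exact: Normc.normc0. Qed.
Lemma cabs1 : cabs (1 : R[i]) = 1. Proof. exact: Normc.normc1. Qed.
Lemma cabsM z w : cabs (z * w) = cabs z * cabs w. Proof. exact: Normc.normcM. Qed.
Lemma cabsV z : cabs z^-1 = (cabs z)^-1. Proof. exact: Normc.normcV. Qed.
Lemma cabsN z : cabs (- z) = cabs z. Proof. exact: normcN. Qed.
Lemma cabsD z w : cabs (z + w) <= cabs z + cabs w. Proof. exact: le_normcD. Qed.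

Lemma cabsB z w : cabs (z - w) <= cabs z + cabs w.
Proof. by rewrite -(cabsN w) cabsD. Qed.

Lemma cabsC z w : cabs (z - w) = cabs (w - z).
Proof. by rewrite -cabsN opprB. Qed.

Lemma cabs_eq0 z : (cabs z == 0) = (z == 0).
Proof.
apply/eqP/eqP => [|->]; last exact: cabs0.
exact: Normc.eq0_normc.
Qed.

Lemma cabs_gt0 z : (0 < cabs z) = (z != 0).
Proof. by rewrite lt_neqAle eq_sym cabs_ge0 andbT cabs_eq0. Qed.

Lemma cabsX z n : cabs (z ^+ n) = cabs z ^+ n.
Proof. by elim: n => [|n IH]; rewrite ?expr0 ?cabs1 // !exprS cabsM IH. Qed.

Lemma cabs_real (x : R) : cabs x%:C%C = `|x|.
Proof. by rewrite /cabs /= expr0n /= addr0 sqrtr_sqr. Qed.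

Lemma cabs_nat n : cabs (n%:R : R[i]) = n%:R.
Proof.
by rewrite -(rmorph_nat (real_complex R)) cabs_real ger0_norm ?ler0n.
Qed.

Lemma cabs_prod (J : Type) (s : seq J) (Q : pred J) (u : J -> R[i]) :
  cabs (\prod_(i <- s | Q i) u i) = \prod_(i <- s | Q i) cabs (u i).
Proof. exact: (big_morph (@cabs R) cabsM cabs1). Qed.

Lemma cabs_sum (J : Type) (s : seq J) (Q : pred J) (u : J -> R[i]) :
  cabs (\sum_(i <- s | Q i) u i) <= \sum_(i <- s | Q i) cabs (u i).
Proof.
elim/big_rec2: _ => [|i y z _ H]; first by rewrite cabs0.
by apply: le_trans (cabsD _ _) _; rewrite lerD2l.
Qed.

Lemma Re_le_cabs z : `|complex.Re z| <= cabs z.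
Proof.
case: z => a b; rewrite /cabs /= -sqrtr_sqr ler_wsqrtr // lerDl; exact: sqr_ge0.
Qed.

Lemma Im_le_cabs z : `|complex.Im z| <= cabs z.
Proof.
case: z => a b; rewrite /cabs /= -sqrtr_sqr ler_wsqrtr // lerDr; exact: sqr_ge0.
Qed.

Lemma cabs_le_ReIm z : cabs z <= `|complex.Re z| + `|complex.Im z|.
Proof.
rewrite [X in cabs X]complexE; apply: le_trans (cabsD _ _) _; rewrite cabsM !cabs_real.
by rewrite {1}/cabs /= expr0n expr1n add0r sqrtr1 mul1r.
Qed.

Lemma ReD z w : complex.Re (z + w) = complex.Re z + complex.Re w.
Proof. by case: z; case: w. Qed.
Lemma ImD z w : complex.Im (z + w) = complex.Im z + complex.Im w.
Proof. by case: z; case: w. Qed.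
Lemma ReN z : complex.Re (- z) = - complex.Re z. Proof. by case: z. Qed.
Lemma ImN z : complex.Im (- z) = - complex.Im z. Proof. by case: z. Qed.
Lemma ReM z w : complex.Re (z * w) = complex.Re z * complex.Re w - complex.Im z * complex.Im w.
Proof. by case: z; case: w. Qed.
Lemma ImM z w : complex.Im (z * w) = complex.Re z * complex.Im w + complex.Im z * complex.Re w.
Proof. by case: z => a b; case: w => c e. Qed.

Lemma complex_eta z : Complex (complex.Re z) (complex.Im z) = z.
Proof. by case: z. Qed.

Lemma complex_ext z w : complex.Re z = complex.Re w -> complex.Im z = complex.Im w -> z = w.
Proof. by case: z; case: w => /= ? ? ? ? -> ->. Qed.

(** Convergence in [R[i]] measured with the real-valued modulus; the norm of
    [R[i]] itself takes complex values. *)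
Lemma cvg_cabsP (T : Type) (F : set_system T) {FF : Filter F} (u : T -> R[i]) l :
  u @ F --> l <-> (forall e : R, 0 < e -> \forall t \near F, cabs (u t - l) < e).
Proof.
split => [/cvgrPdist_lt H e e0|H].
  have e0' : 0 < e%:C%C by rewrite ltcR.
  by apply: filterS (H _ e0') => t; rewrite normCE ltcR cabsC.
apply/cvgrPdist_lt => -[e e'] /=; rewrite ltcE /= => /andP[/eqP -> e0].
apply: filterS (H _ e0) => t Ht; rewrite normCE cabsC.
by change ((cabs (u t - l))%:C%C < e%:C%C); rewrite ltcR.
Qed.

Lemma cvg_cabs0P (T : Type) (F : set_system T) {FF : Filter F} (u : T -> R[i]) l :
  u @ F --> l <-> (fun t => cabs (u t - l)) @ F --> (0 : R).
Proof.
split => [/cvg_cabsP H|/cvgrPdist_lt H].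
  by apply/cvgrPdist_lt => e /H; apply: filterS => t; rewrite sub0r normrN ger0_norm ?cabs_ge0.
apply/cvg_cabsP => e /H; apply: filterS => t.
by rewrite sub0r normrN ger0_norm ?cabs_ge0.
Qed.

Lemma cvg_cabs_le (T : Type) (F : set_system T) {FF : Filter F} (u : T -> R[i]) l
    (b : T -> R) : (\forall t \near F, cabs (u t - l) <= b t) ->
  b @ F --> (0 : R) -> u @ F --> l.
Proof.
move=> H b0; apply/cvg_cabs0P; apply: squeeze_cvgr b0; last exact: cvg_cst.
by apply: filterS H => t ->; rewrite cabs_ge0.
Qed.

Lemma cvg_cabs (T : Type) (F : set_system T) {FF : Filter F} (u : T -> R[i]) l :
  u @ F --> l -> (fun t => cabs (u t)) @ F --> cabs l.
Proof.
move=> /cvg_cabsP H; apply/cvgrPdist_lt => e /H; apply: filterS => t.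
apply: le_lt_trans; rewrite ler_norml lerBrDr lerBlDr.
have := cabsD (l - u t) (u t); have := cabsD (u t - l) l; rewrite !subrK.
by rewrite (cabsC l) => h1 h2; apply/andP; split; lra.
Qed.

Lemma cvg_Re (T : Type) (F : set_system T) {FF : Filter F} (u : T -> R[i]) l :
  u @ F --> l -> (fun t => complex.Re (u t)) @ F --> complex.Re l.
Proof.
move=> /cvg_cabsP H; apply/cvgrPdist_lt => e /H; apply: filterS => t.
by apply: le_lt_trans; rewrite -ReN -ReD cabsC; exact: Re_le_cabs.
Qed.

Lemma cvg_Im (T : Type) (F : set_system T) {FF : Filter F} (u : T -> R[i]) l :
  u @ F --> l -> (fun t => complex.Im (u t)) @ F --> complex.Im l.
Proof.
move=> /cvg_cabsP H; apply/cvgrPdist_lt => e /H; apply: filterS => t.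
by apply: le_lt_trans; rewrite -ImN -ImD cabsC; exact: Im_le_cabs.
Qed.

Lemma cvg_Complex (T : Type) (F : set_system T) {FF : Filter F} (u v : T -> R) a b :
  u @ F --> a -> v @ F --> b -> (fun t => Complex (u t) (v t)) @ F --> Complex a b.
Proof.
move=> ua vb; apply: (@cvg_cabs_le _ _ _ _ _ (fun t => `|u t - a| + `|v t - b|)).
  by apply: nearW => t; apply: le_trans (cabs_le_ReIm _) _.
have H (w : T -> R) c : w @ F --> c -> (fun t => `|w t - c|) @ F --> (0 : R).
  move=> /cvgrPdist_lt wc; apply/cvgrPdist_lt => e /wc.
  by apply: filterS => t; rewrite sub0r normrN normr_id distrC.
by rewrite -[0](addr0 0); apply: cvgD; exact: H.
Qed.

Lemma cvg_cabs_lim_le (T : Type) (F : set_system T) {FF : ProperFilter F}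
  (u : T -> R[i]) l (B : R) :
  u @ F --> l -> (\forall t \near F, cabs (u t) <= B) -> cabs l <= B.
Proof. by move=> /cvg_cabs H HB; apply: (cvgr_to_le H). Qed.

Lemma cvg_uniqueC (u : nat -> R[i]) (l l' : R[i]) : u N @[N --> \oo] --> l ->
  u N @[N --> \oo] --> l' -> l = l'.
Proof. by move=> h h'; apply: (cvg_unique _ h h'); exact: norm_hausdorff. Qed.

Lemma cvg_scale (u : nat -> R[i]) l c : u N @[N --> \oo] --> l -> c * u N @[N --> \oo] --> c * l.
Proof. by move=> h; exact: (cvgM (cvg_cst c) h). Qed.

Lemma cvg_scaleB (u v : nat -> R[i]) l m c : u N @[N --> \oo] --> l ->
  v N @[N --> \oo] --> m -> c * u N - v N @[N --> \oo] --> c * l - m.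
Proof. by move=> hu hv; exact: (cvgB (cvgM (cvg_cst c) hu) hv). Qed.

End ComplexModulus.

(** * The complex exponential *)

Section ComplexExp.
Variable R : realType.
Implicit Types z w : R[i].

Lemma is_derive_lin (K : numFieldType) (f : K -> K) (x D : K) :
  is_derive x 1 f D -> forall e, 0 < e ->
  \forall h \near (0 : K), `|f (h + x) - f x - D * h| <= e * `|h|.
Proof.
move=> [df <-] e e0; move: df => /cvgrPdist_le /(_ e e0).
move=> H; have {}H : \forall h \near (0 : K), h != 0 ->
  `|'D_1 f x - h^-1 *: (f (h *: 1 + x) - f x)| <= e by exact: H.
near=> h; have [->|h0] := eqVneq h 0; first by rewrite add0r subrr mulr0 subrr !normr0 mulr0.
have : h != 0 -> `|'D_1 f x - h^-1 *: (f (h *: 1 + x) - f x)| <= e by near: h.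
move=> /(_ h0); rewrite /GRing.scale /= mulr1 => Hh.
rewrite -ler_pdivrMr ?normr_gt0 // -normfV -normrM mulrBl mulfK // distrC.
by rewrite mulrC [_ * h^-1]mulrC in Hh *.
Unshelve. all: by end_near.
Qed.

Lemma cexp0 : cexp (0 : R[i]) = 1.
Proof. by rewrite /cexp /= expR0 cos0 sin0 mulr0 mulr1. Qed.

Lemma cexpD z w : cexp (z + w) = cexp z * cexp w.
Proof.
case: z => a b; case: w => c d; rewrite /cexp /= expRD cosD sinD.
by apply: complex_ext => /=; ring.
Qed.

Lemma cexpM_N z : cexp z * cexp (- z) = 1.
Proof. by rewrite -cexpD subrr cexp0. Qed.

Lemma cexp_neq0 z : cexp z != 0.
Proof.
by apply/eqP => H; have := cexpM_N z; rewrite H mul0r => /eqP; rewrite eq_sym oner_eq0.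
Qed.

Lemma cexpN z : cexp (- z) = (cexp z)^-1.
Proof. by apply: (mulfI (cexp_neq0 z)); rewrite cexpM_N divff // cexp_neq0. Qed.

Lemma cabs_cexp z : cabs (cexp z) = expR (complex.Re z).
Proof.
rewrite /cabs /cexp /= !exprMn -mulrDr cos2Dsin2 mulr1 sqrtr_sqr.
by rewrite ger0_norm // expR_ge0.
Qed.

Lemma cabs_cexp_le z : cabs (cexp z) <= expR (cabs z).
Proof. by rewrite cabs_cexp ler_expR; apply: le_trans (ler_norm _) (Re_le_cabs _). Qed.

Lemma near0_Re (Q : R -> Prop) : (\forall a \near (0 : R), Q a) ->
  \forall h \near (0 : R[i]), Q (complex.Re h).
Proof.
have H : (fun h : R[i] => complex.Re h) @ (0 : R[i]) --> (0 : R).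
  by apply: (@cvg_Re R R[i] (nbhs (0 : R[i])) _ (fun h => h) (0 : R[i])); exact: cvg_id.
by move=> /H.
Qed.

Lemma near0_Im (Q : R -> Prop) : (\forall a \near (0 : R), Q a) ->
  \forall h \near (0 : R[i]), Q (complex.Im h).
Proof.
have H : (fun h : R[i] => complex.Im h) @ (0 : R[i]) --> (0 : R).
  by apply: (@cvg_Im R R[i] (nbhs (0 : R[i])) _ (fun h => h) (0 : R[i])); exact: cvg_id.
by move=> /H.
Qed.

Lemma near0_cabs (e : R) : 0 < e -> \forall h \near (0 : R[i]), cabs h < e.
Proof.
move=> e0; have /cvg_cabsP/(_ e e0) : (id : R[i] -> R[i]) @ (0 : R[i]) --> (0 : R[i]) by exact: cvg_id.
by apply: filterS => t; rewrite subr0.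
Qed.

(** Read off from the real derivatives of [expR], [cos] and [sin] at the origin. *)
Lemma cexp_lin (e : R) : 0 < e ->
  \forall h \near (0 : R[i]), cabs (cexp h - 1 - h) <= e * cabs h.
Proof.
move=> e0; pose d : R := Num.min (e / 9) 1.
have d0 : 0 < d by rewrite lt_min ltr01 divr_gt0.
have dd := is_derive_lin.
have He := dd _ _ _ _ (@is_derive_expR R 0) d d0.
have Hc := dd _ _ _ _ (@is_derive_cos R 0) d d0.
have Hs := dd _ _ _ _ (@is_derive_sin R 0) d d0.
have {}He := near0_Re He; have {}Hc := near0_Im Hc; have {}Hs := near0_Im Hs.
near=> h.
have h1 : cabs h <= d by apply: ltW; near: h; exact: near0_cabs.
have : `|expR (complex.Re h + 0) - expR 0 - expR 0 * complex.Re h| <= d * `|complex.Re h| by near: h.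
have : `|cos (complex.Im h + 0) - cos 0 - - sin 0 * complex.Im h| <= d * `|complex.Im h| by near: h.
have : `|sin (complex.Im h + 0) - sin 0 - cos 0 * complex.Im h| <= d * `|complex.Im h| by near: h.
rewrite !addr0 expR0 cos0 sin0 oppr0 mul0r !mul1r !(subr0, addr0).
have := Re_le_cabs h; have := Im_le_cabs h; move: h1.
set r := cabs h; case: (h) => a b /=.
set E := expR a; set S := sin b; set Co := cos b => r1 br ar s1 c1 e1.
have r0 : 0 <= r := cabs_ge0 _.
have d1 : d <= 1 by rewrite ge_min lexx orbT.
have d8 : d * 9 <= e by rewrite -ler_pdivlMr // ge_min lexx.
have dr : d * `|a| <= d * r by rewrite ler_wpM2l // ltW.
have dr' : d * `|b| <= d * r by rewrite ler_wpM2l // ltW.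
have E3 : `|E| <= 3.
  have -> : E = (E - 1 - a) + 1 + a by ring.
  have := ler_normD (E - 1 - a + 1) a; have := ler_normD (E - 1 - a) 1; rewrite normr1.
  have : d * r <= 1 * 1 by apply: ler_pM => //; lra.
  lra.
apply: le_trans (cabs_le_ReIm _) _ => /=.
have -> : E * Co - 1 - a = (E - 1 - a) + E * (Co - 1) by ring.
have -> : E * S - 0 - b = E * (S - b) + (E - 1 - a) * b + a * b by ring.
have k1 : `|E * (Co - 1)| <= 3 * (d * r).
  by rewrite normrM; apply: ler_pM => //; lra.
have k2 : `|E * (S - b)| <= 3 * (d * r).
  by rewrite normrM; apply: ler_pM => //; lra.
have k3 : `|(E - 1 - a) * b| <= d * r * 1.
  by rewrite normrM; apply: ler_pM => //; lra.
have k4 : `|a * b| <= d * r.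
  by rewrite normrM; apply: ler_pM => //; lra.
have := ler_normD (E - 1 - a) (E * (Co - 1)).
have := ler_normD (E * (S - b)) ((E - 1 - a) * b).
have := ler_normD (E * (S - b) + (E - 1 - a) * b) (a * b).
have : d * 9 * r <= e * r by rewrite ler_wpM2r //; lra.
lra.
Unshelve. all: by end_near.
Qed.

Lemma is_derive_cexp z : is_derive z 1 (@cexp R) (cexp z).
Proof.
have H : (fun h => h^-1 *: ((@cexp R \o shift z) (h *: 1) - cexp z)) @ (0 : R[i])^' --> cexp z.
  apply/cvg_cabsP => e e0.
  pose d := e / (cabs (cexp z) + 1) / 2.
  have z1 : 0 < cabs (cexp z) + 1 by rewrite ltr_wpDl ?cabs_ge0.
  have d0 : 0 < d by rewrite !divr_gt0.
  have := @cexp_lin d d0 => /nbhs_dnbhs H.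
  near=> h.
  have h0 : h != 0 by near: h; exact: nbhs_dnbhs_neq.
  have : cabs (cexp h - 1 - h) <= d * cabs h by near: h.
  have -> : h^-1 *: ((@cexp R \o shift z) (h *: 1) - cexp z) - cexp z =
     cexp z * ((cexp h - 1 - h) / h).
    rewrite /= /GRing.scale /= mulr1 cexpD; field; exact: h0.
  rewrite !cabsM cabsV -ler_pdivrMr ?cabs_gt0 // => Hh.
  apply: (@le_lt_trans _ _ (cabs (cexp z) * d)); first by rewrite ler_wpM2l ?cabs_ge0.
  apply: (@le_lt_trans _ _ ((cabs (cexp z) + 1) * d)).
    by rewrite ler_wpM2r ?lerDl // ltW.
  have -> : (cabs (cexp z) + 1) * d = e / 2 by rewrite /d; field; rewrite gt_eqF.
  lra.
split; first by apply/cvg_ex; exists (cexp z).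
exact: cvg_lim.
Unshelve. all: by end_near.
Qed.

End ComplexExp.

(** * Integrals of complex functions of a real variable *)

Section RealIntegral.
Variable R : realType.
Implicit Types (f g : R -> R) (a b c : R).

Definition cont_itv (V : topologicalType) a b (f : R -> V) :=
  forall x, a <= x <= b -> f y @[y --> x] --> f x.

Definition rint a b f : R := (\int[lebesgue_measure]_(x in `[a, b]) f x)%R.

Lemma cont_within a b f : cont_itv a b f -> {within `[a, b], continuous f}.
Proof.
move=> H; apply: continuous_in_subspaceT => x; rewrite inE /= in_itv /= => ab.
exact: H.
Qed.

Lemma rint_integrable a b f : cont_itv a b f ->
  lebesgue_measure.-integrable `[a, b] (EFin \o f).
Proof.
move=> H; apply: continuous_compact_integrable; first exact: segment_compact.
exact: cont_within.
Qed.

Lemma rintD a b f g : cont_itv a b f -> cont_itv a b g ->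
  rint a b (fun x => f x + g x) = rint a b f + rint a b g.
Proof. by move=> hf hg; rewrite /rint RintegralD //; exact: rint_integrable. Qed.

Lemma rintB a b f g : cont_itv a b f -> cont_itv a b g ->
  rint a b (fun x => f x - g x) = rint a b f - rint a b g.
Proof. by move=> hf hg; rewrite /rint RintegralB //; exact: rint_integrable. Qed.

Lemma rintZ a b (k : R) f : cont_itv a b f ->
  rint a b (fun x => k * f x) = k * rint a b f.
Proof. by move=> hf; rewrite /rint RintegralZl //; exact: rint_integrable. Qed.

Lemma rint_ext a b f g : (forall x, a <= x <= b -> f x = g x) -> rint a b f = rint a b g.
Proof. by move=> H; apply: eq_Rintegral => x; rewrite inE /= in_itv /= => /H. Qed.

Lemma rint_split a b c f : a <= c -> c <= b -> cont_itv a b f ->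
  rint a b f = rint a c f + rint c b f.
Proof.
move=> ac cb H; rewrite /rint.
have H' := rint_integrable H.
have := @Rintegral_itvB _ f (BLeft a) (BRight b) c H'.
rewrite !bnd_simp => /(_ ac cb) /(canRL (subrK _)) ->.
rewrite addrC; congr (_ + _); apply: (@Rintegral_itv_obnd_cbnd _ c (BRight b) f).
apply: (integrableS _ _ _ H') => //.
by move=> x /=; rewrite !in_itv /= => /andP[cx ->]; rewrite (le_trans ac) // ltW.
Qed.

Lemma rint_cst a b (k : R) : a <= b -> rint a b (fun=> k) = k * (b - a).
Proof.
move=> ab; rewrite /rint Rintegral_cst // /= lebesgue_measure_itv /= lte_fin.
by move: ab; rewrite le_eqVlt => /predU1P[->|->]; rewrite ?ltxx ?subrr.
Qed.

Lemma cont_cst (V : topologicalType) a b (k : V) : cont_itv a b (fun=> k).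
Proof. by move=> x _; exact: cvg_cst. Qed.

Lemma rint_norm a b f (M : R) : a <= b -> cont_itv a b f ->
  (forall x, a <= x <= b -> `|f x| <= M) -> `|rint a b f| <= M * (b - a).
Proof.
move=> ab H HM; rewrite -rint_cst //.
apply: le_trans (le_normr_Rintegral _ _) _ => //; first exact: rint_integrable.
have Hn : cont_itv a b (fun x => `|f x|) by move=> x /H hx; exact: cvg_norm.
apply: le_Rintegral => //; first exact: rint_integrable.
by apply: rint_integrable; exact: cont_cst.
Qed.

Lemma rint_FTC a b (F f : R -> R) : a <= b -> cont_itv a b f ->
  (forall x, a <= x <= b -> is_derive x 1 F (f x)) -> rint a b f = F b - F a.
Proof.
rewrite le_eqVlt => /predU1P[<- _ _|ab H D].
  by rewrite subrr /rint set_itv1 Rintegral_set1.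
have cF : cont_itv a b F.
  by move=> x /D [dF _]; apply: differentiable_continuous; apply/derivable1_diffP.
rewrite /rint /Rintegral (@continuous_FTC2 _ f F) //.
- exact: cont_within.
- split.
  + move=> x; rewrite in_itv /= => /andP[ax xb].
    by have [] := D x _; rewrite ?ltW.
  + apply: cvg_at_right_filter; apply: cF; by rewrite lexx ltW.
  + apply: cvg_at_left_filter; apply: cF; by rewrite lexx ltW.
- move=> x; rewrite in_itv /= => /andP[ax xb].
  by rewrite derive1E; have [] := D x _; rewrite ?ltW.
Qed.

End RealIntegral.

Section ComplexIntegral.
Variable R : realType.
Implicit Types (g h : R -> R[i]) (a b c t : R).

Definition cint a b g : R[i] :=
  Complex (rint a b (fun x => complex.Re (g x))) (rint a b (fun x => complex.Im (g x))).

Lemma cont_Re a b g : cont_itv a b g -> cont_itv a b (fun x => complex.Re (g x)).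
Proof. by move=> H x /H hx; exact: cvg_Re. Qed.

Lemma cont_Im a b g : cont_itv a b g -> cont_itv a b (fun x => complex.Im (g x)).
Proof. by move=> H x /H hx; exact: cvg_Im. Qed.

Lemma contD a b g h : cont_itv a b g -> cont_itv a b h -> cont_itv a b (fun x => g x + h x).
Proof. by move=> H H' x xab; apply: cvgD; [exact: H|exact: H']. Qed.

Lemma cont_cstc a b (k : R[i]) : cont_itv a b (fun=> k).
Proof. exact: cont_cst. Qed.

Lemma contN a b g : cont_itv a b g -> cont_itv a b (fun x => - g x).
Proof. by move=> H x xab; apply: cvgN; exact: H. Qed.

Lemma contM a b g h : cont_itv a b g -> cont_itv a b h -> cont_itv a b (fun x => g x * h x).
Proof. by move=> H H' x xab; apply: cvgM; [exact: H|exact: H']. Qed.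

Lemma cintD a b g h : cont_itv a b g -> cont_itv a b h ->
  cint a b (fun x => g x + h x) = cint a b g + cint a b h.
Proof.
move=> Hg Hh; apply: complex_ext; rewrite ?(ReD, ImD) /= -rintD;
  try (exact: cont_Re); try (exact: cont_Im); apply: rint_ext => x _;
  by rewrite ?(ReD, ImD).
Qed.

Lemma cintZ a b (k : R[i]) g : cont_itv a b g ->
  cint a b (fun x => k * g x) = k * cint a b g.
Proof.
move=> Hg; have Hr := cont_Re Hg; have Hi := cont_Im Hg.
have HZ (l : R) f : cont_itv a b f -> cont_itv a b (fun x => l * f x).
  by move=> H x /H; apply: cvgM; exact: cvg_cst.
apply: complex_ext; rewrite ?(ReM, ImM) /= -!rintZ // -1?rintB -1?rintD //;
  try exact: HZ; apply: rint_ext => x _; by rewrite ?(ReM, ImM).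
Qed.

Lemma cintN a b g : cont_itv a b g -> cint a b (fun x => - g x) = - cint a b g.
Proof.
move=> Hg; rewrite -mulN1r -cintZ //; congr (cint a b _).
by apply/funext => x; rewrite mulN1r.
Qed.

Lemma cintB a b g h : cont_itv a b g -> cont_itv a b h ->
  cint a b (fun x => g x - h x) = cint a b g - cint a b h.
Proof. by move=> Hg Hh; rewrite (cintD Hg (contN Hh)) (cintN Hh). Qed.

Lemma cint_ext a b g h : (forall x, a <= x <= b -> g x = h x) -> cint a b g = cint a b h.
Proof. by move=> H; rewrite /cint; congr Complex; apply: rint_ext => x /H ->. Qed.

Lemma cint_split a b c g : a <= c -> c <= b -> cont_itv a b g ->
  cint a b g = cint a c g + cint c b g.
Proof.
move=> ac cb H; apply: complex_ext; rewrite ?(ReD, ImD) /=; apply: rint_split => //.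
  exact: cont_Re.
exact: cont_Im.
Qed.

(** The factor [2] comes from estimating the real and imaginary parts
    separately; it is harmless in what follows. *)
Lemma cint_norm a b g (M : R) : a <= b -> cont_itv a b g ->
  (forall x, a <= x <= b -> cabs (g x) <= M) -> cabs (cint a b g) <= 2 * M * (b - a).
Proof.
move=> ab H HM; apply: le_trans (cabs_le_ReIm _) _ => /=.
rewrite [2 * M]mulr_natl mulr2n mulrDl; apply: lerD; apply: rint_norm => //.
- exact: cont_Re.
- by move=> x /HM; apply: le_trans (Re_le_cabs _).
- exact: cont_Im.
- by move=> x /HM; apply: le_trans (Im_le_cabs _).
Qed.

(** Stated componentwise, so that the fundamental theorem of calculus for real
    functions applies to each component. *)
Definition has_cderiv g t (D : R[i]) :=
  is_derive t 1 (fun x => complex.Re (g x)) (complex.Re D) /\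
  is_derive t 1 (fun x => complex.Im (g x)) (complex.Im D).

Lemma is_derive_eq_fun (f f' : R -> R) t (D D' : R) :
  is_derive t 1 f D -> f = f' -> D = D' -> is_derive t 1 f' D'.
Proof. by move=> H <- <-. Qed.

Lemma has_cderiv_cst (k : R[i]) t : has_cderiv (fun=> k) t 0.
Proof. by split; exact: is_derive_cst. Qed.

Lemma has_cderivD g h t D E : has_cderiv g t D -> has_cderiv h t E ->
  has_cderiv (fun x => g x + h x) t (D + E).
Proof.
move=> [g1 g2] [h1 h2]; split.
  apply: is_derive_eq_fun (is_deriveD g1 h1) _ _; last by rewrite ReD.
  by apply/funext => x /=; rewrite ReD.
apply: is_derive_eq_fun (is_deriveD g2 h2) _ _; last by rewrite ImD.
by apply/funext => x /=; rewrite ImD.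
Qed.

Lemma has_cderivM g h t D E : has_cderiv g t D -> has_cderiv h t E ->
  has_cderiv (fun x => g x * h x) t (D * h t + g t * E).
Proof.
move=> [g1 g2] [h1 h2]; split.
  apply: is_derive_eq_fun (is_deriveB (is_deriveM g1 h1) (is_deriveM g2 h2)) _ _.
    by apply/funext => x /=; rewrite ReM.
  rewrite /GRing.scale /= ReD !ReM; ring.
apply: is_derive_eq_fun (is_deriveD (is_deriveM g1 h2) (is_deriveM g2 h1)) _ _.
  by apply/funext => x /=; rewrite ImM; congr (_ + _).
rewrite /GRing.scale /= ImD !ImM; ring.
Qed.

Lemma has_cderiv_id t : has_cderiv (fun x => x%:C%C) t 1.
Proof. by split; [exact: is_derive_id|exact: is_derive_cst]. Qed.

Lemma has_cderiv_cont g t D : has_cderiv g t D -> g x @[x --> t] --> g t.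
Proof.
move=> [[g1 _] [g2 _]].
have -> : g = fun x => Complex (complex.Re (g x)) (complex.Im (g x)).
  by apply/funext => x; rewrite complex_eta.
by apply: cvg_Complex; apply: differentiable_continuous; apply/derivable1_diffP.
Qed.

Lemma has_cderiv_eq g h t D E : has_cderiv g t D -> g =1 h -> D = E -> has_cderiv h t E.
Proof. by move=> H /funext <- <-. Qed.

Lemma cint_FTC a b g D : a <= b -> cont_itv a b D ->
  (forall x, a <= x <= b -> has_cderiv g x (D x)) -> cint a b D = g b - g a.
Proof.
move=> ab cD H; apply: complex_ext; rewrite ?(ReD, ImD, ReN, ImN) /=;
  apply: (@rint_FTC _ _ _ (fun x => _)) => //.
- exact: cont_Re.
- by move=> x /H [].
- exact: cont_Im.
- by move=> x /H [].
Qed.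

(** The point [exp (i t)] of the unit circle. *)
Definition cis t : R[i] := Complex (cos t) (sin t).

Lemma cabs_cis t : cabs (cis t) = 1.
Proof. by rewrite /cabs /= cos2Dsin2 sqrtr1. Qed.

Lemma has_cderiv_cis t : has_cderiv cis t (Complex 0 1 * cis t).
Proof.
split => /=.
  by apply: is_derive_eq_fun (is_derive_cos t) _ _; rewrite //= mul0r mul1r sub0r.
by apply: is_derive_eq_fun (is_derive_sin t) _ _; rewrite //= mul0r mul1r add0r.
Qed.

Lemma cis0 : cis 0 = 1.
Proof. by rewrite /cis cos0 sin0. Qed.

Lemma cis2pi : cis (2 * pi) = 1.
Proof. by rewrite /cis mulr_natl cos2pi sin2pi. Qed.

Lemma cisD s t : cis (s + t) = cis s * cis t.
Proof. by rewrite /cis cosD sinD; apply: complex_ext => //=; rewrite addrC [sin s * _]mulrC mulrC. Qed.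

Lemma cis_neq0 t : cis t != 0.
Proof. by rewrite -cabs_eq0 cabs_cis oner_eq0. Qed.

End ComplexIntegral.
Arguments cont_cstc {R} a b k.

(** * Goursat's theorem and Cauchy's formula on a disc *)

Section RectangleBisection.
Variable R : realType.
Variables (mu : R -> R -> R -> R -> R[i]) (a0 b0 c0 d0 : R).
Hypothesis ab0 : a0 <= b0.
Hypothesis cd0 : c0 <= d0.
Hypothesis mu_splitl : forall a m b c d, a0 <= a -> a <= m -> m <= b -> b <= b0 ->
  c0 <= c -> c <= d -> d <= d0 -> mu a b c d = mu a m c d + mu m b c d.
Hypothesis mu_splitr : forall a b c m d, a0 <= a -> a <= b -> b <= b0 ->
  c0 <= c -> c <= m -> m <= d -> d <= d0 -> mu a b c d = mu a b c m + mu a b m d.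
Hypothesis mu_small : forall p q, a0 <= p <= b0 -> c0 <= q <= d0 -> forall e, 0 < e ->
  exists2 del : R, 0 < del & forall a b c d, a0 <= a -> a <= p <= b -> b <= b0 ->
    c0 <= c -> c <= q <= d -> d <= d0 -> b - a < del -> d - c < del ->
    cabs (mu a b c d) <= e * ((b - a) + (d - c)) ^+ 2.

Let rect : Type := (R * R * R * R)%type.
Let M (Q : rect) := cabs (mu Q.1.1.1 Q.1.1.2 Q.1.2 Q.2).
Let mid (x y : R) := (x + y) / 2.

(** A quarter on which [mu] keeps at least a quarter of its modulus; additivity
    ensures that the last one qualifies when the first three do not. *)
Let quarter (Q : rect) : rect :=
  let: (a, b, c, d) := Q in
  let Q1 := (a, mid a b, c, mid c d) in
  let Q2 := (a, mid a b, mid c d, d) in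
  let Q3 := (mid a b, b, c, mid c d) in
  let Q4 := (mid a b, b, mid c d, d) in
  if M Q <= 4 * M Q1 then Q1 else if M Q <= 4 * M Q2 then Q2
  else if M Q <= 4 * M Q3 then Q3 else Q4.

Let inside (Q : rect) := [/\ a0 <= Q.1.1.1, Q.1.1.1 <= Q.1.1.2, Q.1.1.2 <= b0 &
  [/\ c0 <= Q.1.2, Q.1.2 <= Q.2 & Q.2 <= d0]].

Let quarterP Q : inside Q -> let Q' := quarter Q in
  [/\ inside Q', M Q <= 4 * M Q',
      Q.1.1.1 <= Q'.1.1.1 /\ Q'.1.1.2 <= Q.1.1.2,
      Q.1.2 <= Q'.1.2 /\ Q'.2 <= Q.2 &
      Q'.1.1.2 - Q'.1.1.1 = (Q.1.1.2 - Q.1.1.1) / 2 /\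
      Q'.2 - Q'.1.2 = (Q.2 - Q.1.2) / 2].
Proof.
case: Q => [[[a b] c] d] [/= ha hab hb [hc hcd hd]].
have m1 : a <= mid a b by rewrite /mid; lra.
have m2 : mid a b <= b by rewrite /mid; lra.
have m3 : c <= mid c d by rewrite /mid; lra.
have m4 : mid c d <= d by rewrite /mid; lra.
have q1 : b - mid a b = (b - a) / 2 by rewrite /mid; lra.
have q2 : mid a b - a = (b - a) / 2 by rewrite /mid; lra.
have q3 : d - mid c d = (d - c) / 2 by rewrite /mid; lra.
have q4 : mid c d - c = (d - c) / 2 by rewrite /mid; lra.
have n1 : a0 <= mid a b by lra.
have n2 : mid a b <= b0 by lra.
have n3 : c0 <= mid c d by lra.
have n4 : mid c d <= d0 by lra.
have split4 : M (a, b, c, d) <= M (a, mid a b, c, mid c d) + M (a, mid a b, mid c d, d)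
   + M (mid a b, b, c, mid c d) + M (mid a b, b, mid c d, d).
  rewrite /M /= (mu_splitl ha m1 m2 hb hc hcd hd).
  rewrite (mu_splitr ha m1 n2 hc m3 m4 hd) (mu_splitr n1 m2 hb hc m3 m4 hd).
  apply: le_trans (cabsD _ _) _; rewrite -addrA.
  by apply: lerD; exact: cabsD.
rewrite /quarter; case: ifPn => [h1|]; first by split.
rewrite -ltNge => h1; case: ifPn => [h2|]; first by split.
rewrite -ltNge => h2; case: ifPn => [h3|]; first by split.
rewrite -ltNge => h3; split => //.
by move: h1 h2 h3 split4; rewrite /=; lra.
Qed.

Let Q n : rect := iter n quarter (a0, b0, c0, d0).

Let Q_inside n : inside (Q n).
Proof.
elim: n => [|n IH]; first by split => //=; split.
by have [] := quarterP IH.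
Qed.

Let Q_size n : (Q n).1.1.2 - (Q n).1.1.1 = (b0 - a0) / 2 ^+ n /\
   (Q n).2 - (Q n).1.2 = (d0 - c0) / 2 ^+ n /\ M (Q 0) <= 4 ^+ n * M (Q n).
Proof.
elim: n => [|n [h1 [h2 h3]]]; first by rewrite /= !expr0 !divr1 mul1r.
have [_ h4 _ _ [-> ->]] := quarterP (Q_inside n).
rewrite h1 h2 !exprSr !invfM !mulrA; split => //; split => //.
apply: le_trans h3 _; rewrite -mulrA ler_pM2l ?exprn_gt0 //; exact: h4.
Qed.

Let Q_nested m n : (Q m).1.1.1 <= (Q (m + n)%N).1.1.1 /\ (Q (m + n)%N).1.1.2 <= (Q m).1.1.2 /\
  (Q m).1.2 <= (Q (m + n)%N).1.2 /\ (Q (m + n)%N).2 <= (Q m).2.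
Proof.
elim: n => [|n [h1 [h2 [h3 h4]]]]; first by rewrite addn0.
rewrite addnS; have [_ _ [k1 k2] [k3 k4] _] := quarterP (Q_inside (m + n)).
by rewrite (le_trans h1 k1) (le_trans k2 h2) (le_trans h3 k3) (le_trans k4 h4).
Qed.

(** Goursat's bisection: if [mu] did not vanish, some quarter would keep at
    least a quarter of its modulus, and so on down to a point, near which [mu]
    is too small. *)
Lemma rect_additive_eq0 : mu a0 b0 c0 d0 = 0.
Proof.
have cross m n : (Q m).1.1.1 <= (Q n).1.1.2 /\ (Q m).1.2 <= (Q n).2.
  have [k1 [_ [k3 _]]] := Q_nested m n.
  have [_ [k2 [_ k4]]] := Q_nested n m.
  rewrite addnC in k2 k4.
  have [_ k5 _ [_ k6 _]] := Q_inside (m + n).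
  by split; [apply: le_trans k1 (le_trans k5 k2)|apply: le_trans k3 (le_trans k6 k4)].
pose A := range (fun n => (Q n).1.1.1); pose C := range (fun n => (Q n).1.2).
have An m : (Q m).1.1.1 <= sup A <= (Q m).1.1.2.
  apply/andP; split.
    apply: ub_le_sup; last by exists m.
    by exists ((Q 0).1.1.2) => _ [k _ <-]; have [] := cross k 0.
  apply: ge_sup; first by exists ((Q 0).1.1.1); exists 0.
  by move=> _ [k _ <-]; have [] := cross k m.
have Cn m : (Q m).1.2 <= sup C <= (Q m).2.
  apply/andP; split.
    apply: ub_le_sup; last by exists m.
    by exists ((Q 0).2) => _ [k _ <-]; have [] := cross k 0.
  apply: ge_sup; first by exists ((Q 0).1.2); exists 0.
  by move=> _ [k _ <-]; have [] := cross k m.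
apply/eqP; rewrite -cabs_eq0 eq_le cabs_ge0 andbT leNgt; apply/negP => M0.
pose S := (b0 - a0) + (d0 - c0).
have S0 : 0 <= S by rewrite addr_ge0 // subr_ge0.
pose e := cabs (mu a0 b0 c0 d0) / (S ^+ 2 + 1) / 2.
have S1 : 0 < S ^+ 2 + 1 by rewrite ltr_wpDl // sqr_ge0.
have e0 : 0 < e by rewrite !divr_gt0.
have [del del0 H] := mu_small (An 0) (Cn 0) e0.
have [n Hn] : exists n, S / 2 ^+ n < del.
  exists (Num.bound (S / del)); rewrite ltr_pdivrMr ?exprn_gt0 // mulrC -ltr_pdivrMr //.
  apply: lt_trans (archi_boundP _) _; first by rewrite divr_ge0 // ltW.
  by rewrite -natrX ltr_nat ltn_expl.
have [s1 [s2 s3]] := Q_size n.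
have [i1 i2 i3 [i4 i5 i6]] := Q_inside n.
have p2 : 0 < (2 ^+ n : R) by rewrite exprn_gt0.
have := H _ _ _ _ i1 (An n) i3 i4 (Cn n) i6.
rewrite s1 s2 -/(M _) -mulrDl -/S.
have l1 : (b0 - a0) / 2 ^+ n < del.
  by apply: le_lt_trans Hn; rewrite ler_pM2r ?invr_gt0 // lerDl subr_ge0.
have l2 : (d0 - c0) / 2 ^+ n < del.
  by apply: le_lt_trans Hn; rewrite ler_pM2r ?invr_gt0 // lerDr subr_ge0.
move=> /(_ l1 l2); rewrite expr_div_n -exprM mulnC exprM -natrX (_ : 2 ^ 2 = 4)%N //.
rewrite mulrA ler_pdivlMr ?exprn_gt0 // mulrC => /(le_trans s3).
rewrite /M /= => h.
have eS : e * (S ^+ 2 + 1) = cabs (mu a0 b0 c0 d0) / 2.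
  by rewrite /e; field; rewrite gt_eqF.
have : e * S ^+ 2 <= cabs (mu a0 b0 c0 d0) / 2 by rewrite -eS ler_wpM2l ?lerDl // ltW.
by move=> h'; have := le_trans h h'; apply/negP; rewrite -ltNge; lra.
Qed.
End RectangleBisection.

Section CauchyDisc.
Variable R : realType.
Implicit Types (z w : R[i]) (a b c d e l t x y : R).

Definition tangent_primitive (w0 al be w : R[i]) : R[i] :=
  al * (w - w0) + be / 2 * ((w - w0) * (w - w0)).

(** A linear function has a primitive, so only the deviation of [G] from its
    tangent contributes to the integral of [G] along a short path. *)
Lemma edge_estimate (gam dgam : R -> R[i]) (G : R[i] -> R[i]) x y (w0 al be : R[i]) (eta L : R) :
  x <= y ->
  (forall t, x <= t <= y -> has_cderiv gam t (dgam t)) ->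
  cont_itv x y dgam ->
  cont_itv x y (fun t => G (gam t)) ->
  (forall t, x <= t <= y -> cabs (dgam t) <= L) ->
  (forall t, x <= t <= y -> cabs (G (gam t) - (al + be * (gam t - w0))) <= eta) ->
  cabs (cint x y (fun t => G (gam t) * dgam t) - (tangent_primitive w0 al be (gam y) - tangent_primitive w0 al be (gam x)))
    <= 2 * (eta * L) * (y - x).
Proof.
move=> xy hg cdg cG hL heta; set Pr := tangent_primitive w0 al be.
have cgam : cont_itv x y gam by move=> t /hg; exact: has_cderiv_cont.
pose lin t := (al + be * (gam t - w0)) * dgam t.
have clin : cont_itv x y lin.
  have c1 := contD cgam (cont_cstc x y (- w0)).
  have c2 := contM (cont_cstc x y be) c1.
  have c3 := contD (cont_cstc x y al) c2.
  exact (contM c3 cdg).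
have <- : cint x y lin = Pr (gam y) - Pr (gam x).
  apply: (@cint_FTC _ _ _ (fun t => Pr (gam t))) => // t /hg h.
  have h1 : has_cderiv (fun t => gam t - w0) t (dgam t + 0).
    by apply: has_cderivD => //; exact: has_cderiv_cst.
  apply: has_cderiv_eq; first apply: has_cderivD.
  - by apply: (has_cderivM (has_cderiv_cst al t)); exact: h1.
  - apply: (has_cderivM (has_cderiv_cst (be / 2) t)).
    apply: (has_cderivM h1 h1).
  - by move=> u.
  - by rewrite /lin /=; field.
have cGd : cont_itv x y (fun t => G (gam t) * dgam t) := contM cG cdg.
rewrite -(cintB cGd clin); apply: (cint_norm xy).
  exact: contD cGd (contN clin).
move=> t ht; rewrite /lin -mulrBl cabsM.
by apply: ler_pM; rewrite ?cabs_ge0 //; [exact: heta|exact: hL].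
Qed.

Lemma cis_lip s t : cabs (cis s - cis t) <= 2 * `|s - t|.
Proof.
wlog st : s t / t <= s.
  move=> H; have [|/ltW] := leP t s; first exact: H.
  by rewrite cabsC distrC; exact: H.
have cc : cont_itv t s (fun u => Complex 0 1 * cis u).
  refine (contM (cont_cstc t s _) _).
  by move=> u _; exact: has_cderiv_cont (has_cderiv_cis u).
rewrite -(cint_FTC st cc); last by move=> u _; exact: has_cderiv_cis.
rewrite ger0_norm ?subr_ge0 // -[2]mulr1; apply: (cint_norm st cc) => u _.
by rewrite cabsM cabs_cis mulr1 /cabs /= expr0n add0r expr1n sqrtr1.
Qed.

Lemma derivable_lin (G : R[i] -> R[i]) w : derivable G w 1 ->
  exists D, forall e, 0 < e -> exists2 del : R, 0 < del &
    forall w', cabs (w' - w) < del -> cabs (G w' - (G w + D * (w' - w))) <= e * cabs (w' - w).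
Proof.
move=> dG; exists ('D_1 G w) => e e0.
have e0' : 0 < e%:C%C by rewrite ltcR.
have := is_derive_lin (DeriveDef dG erefl) e0'.
move=> /nbhs_ballP[[d d'] /=]; rewrite ltcE /= => /andP[/eqP -> d0] H.
exists d => // w' hw'.
have := H (w' - w); rewrite subrK !normCE -rmorphM lecR opprD addrA; apply.
rewrite /ball /= sub0r normrN normCE.
by change ((cabs (w' - w))%:C%C < d%:C%C); rewrite ltcR.
Qed.

Variables (F : R[i] -> R[i]) (r s : R) (z : R[i]).
Hypothesis dF : forall w, cabs w < r -> derivable F w 1.
Hypothesis s0 : 0 < s.
Hypothesis sr : s < r.
Hypothesis zs : cabs z < s.

(** The homotopy from the circle of radius [s], at [l = 1], to the point [z], at
    [l = 0]. *)
Let W l t := z + l%:C%C * (s%:C%C * cis t - z).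
Let Wl t := s%:C%C * cis t - z.
Let Wt l t := l%:C%C * (s%:C%C * (Complex 0 1 * cis t)).
Let G w := (F w - F z) * (w - z)^-1.

Let cabsI : cabs (Complex (0 : R) 1) = 1.
Proof. by rewrite /cabs /= expr0n add0r expr1n sqrtr1. Qed.

Let Wl_neq0 t : Wl t != 0.
Proof.
rewrite -cabs_gt0 /Wl; have := cabsD (s%:C%C * cis t - z) z.
rewrite subrK cabsM cabs_cis mulr1 cabs_real gtr0_norm // => h.
by rewrite -(ltrD2r (cabs z)) add0r (lt_le_trans zs).
Qed.

Let Wl_le t : cabs (Wl t) <= 2 * s.
Proof.
apply: le_trans (cabsB _ _) _; rewrite cabsM cabs_cis mulr1 cabs_real gtr0_norm //.
by have := ltW zs; have := s0; lra.
Qed.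

Let Wt_le l t : 0 <= l <= 1 -> cabs (Wt l t) <= 2 * s.
Proof.
move=> /andP[l0 l1]; rewrite /Wt !cabsM cabs_cis cabsI !cabs_real !mulr1.
rewrite ger0_norm // gtr0_norm //; apply: (@le_trans _ _ (1 * s)); last by have := s0; lra.
by rewrite ler_wpM2r // ltW.
Qed.

Let W_lt l t : 0 <= l <= 1 -> cabs (W l t) < r.
Proof.
move=> /andP[l0 l1]; apply: le_lt_trans sr.
have -> : W l t = (1 - l)%:C%C * z + l%:C%C * (s%:C%C * cis t).
  by rewrite /W rmorphB rmorph1; ring.
apply: le_trans (cabsD _ _) _.
rewrite !cabsM cabs_cis mulr1 !cabs_real (gtr0_norm s0) !ger0_norm // ?subr_ge0 //.
have : (1 - l) * cabs z <= (1 - l) * s by rewrite ler_wpM2l ?subr_ge0 // ltW.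
lra.
Qed.

Let W_neq l t : 0 < l -> W l t - z != 0.
Proof.
move=> l0; rewrite /W [z + _]addrC addrK mulf_neq0 ?Wl_neq0 //.
by rewrite -cabs_eq0 cabs_real normr_eq0 gt_eqF.
Qed.

Let dG l t : 0 < l <= 1 -> derivable G (W l t) 1.
Proof.
move=> /andP[l0 l1].
apply: derivableM.
  apply: derivableB; last exact: derivable_cst.
  by apply: dF; apply: W_lt; rewrite ltW.
apply: derivableV; first exact: W_neq.
by apply: derivableB; [exact: derivable_id|exact: derivable_cst].
Qed.

Let cvgG l t : 0 < l <= 1 -> G w @[w --> W l t] --> G (W l t).
Proof.
by move=> hl; apply: differentiable_continuous; apply/derivable1_diffP; exact: dG.
Qed.

Let W_derivl l t : has_cderiv (fun l => W l t) l (Wl t).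
Proof.
apply: has_cderiv_eq.
- apply: (has_cderivD (has_cderiv_cst z l)).
  exact: (has_cderivM (has_cderiv_id l) (has_cderiv_cst (Wl t) l)).
- by [].
- by rewrite /= mulr0 addr0 add0r mul1r.
Qed.

Let W_derivt l t : has_cderiv (fun t => W l t) t (Wt l t).
Proof.
apply: has_cderiv_eq.
- apply: (has_cderivD (has_cderiv_cst z t)).
  apply: (has_cderivM (has_cderiv_cst l%:C%C t)).
  apply: (has_cderivD _ (has_cderiv_cst (- z) t)).
  exact: (has_cderivM (has_cderiv_cst s%:C%C t) (has_cderiv_cis t)).
- by [].
- by rewrite /Wt /=; ring.
Qed.

Let cis_cont t : cis u @[u --> t] --> cis t.
Proof. exact: has_cderiv_cont (has_cderiv_cis t). Qed.

Let cont_Wt a b l : cont_itv a b (Wt l).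
Proof.
by move=> t _; rewrite /Wt; do 3! (apply: cvgM; first exact: cvg_cst); exact: cis_cont.
Qed.

Let cont_GWt a b l : 0 < l <= 1 -> cont_itv a b (fun t => G (W l t)).
Proof.
move=> hl t _; apply: (cvg_comp (fun t => W l t) G); last exact: cvgG.
exact: has_cderiv_cont (W_derivt l t).
Qed.

Let cont_GWl a b t : 0 < a -> b <= 1 -> cont_itv a b (fun l => G (W l t)).
Proof.
move=> a0 b1 l /andP[al lb]; apply: (cvg_comp (fun l => W l t) G).
  exact: has_cderiv_cont (W_derivl l t).
by apply: cvgG; rewrite (lt_le_trans a0 al) (le_trans lb b1).
Qed.

Let J l c d := cint c d (fun t => G (W l t) * Wt l t).
Let V t a b := cint a b (fun l => G (W l t) * Wl t).
(** The integral of [G] along the boundary of the image of a rectangle under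
    [W]. *)
Let mu a b c d := J b c d - J a c d - (V d a b - V c a b).

Let W_dist l t p q : 0 <= p <= 1 -> cabs (W l t - W p q) <= 2 * s * (`|l - p| + `|t - q|).
Proof.
move=> /andP[p0 p1].
have -> : W l t - W p q = (l - p)%:C%C * Wl t + p%:C%C * (s%:C%C * (cis t - cis q)).
  by rewrite /W /Wl rmorphB; ring.
apply: le_trans (cabsD _ _) _; rewrite !cabsM !cabs_real (ger0_norm p0) (gtr0_norm s0).
rewrite mulrDr; apply: lerD.
  by rewrite mulrC ler_wpM2r.
apply: (@le_trans _ _ (1 * (s * (2 * `|t - q|)))); last by rewrite mul1r mulrCA mulrA.
apply: ler_pM => //; first by rewrite mulr_ge0 ?cabs_ge0 // ltW.
by rewrite ler_wpM2l ?cis_lip // ltW.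
Qed.

Let mu_small a0 : 0 < a0 -> forall p q, a0 <= p <= 1 -> 0 <= q <= 2 * pi -> forall e, 0 < e ->
  exists2 del : R, 0 < del & forall a b c d, a0 <= a -> a <= p <= b -> b <= 1 ->
    0 <= c -> c <= q <= d -> d <= 2 * pi -> b - a < del -> d - c < del ->
    cabs (mu a b c d) <= e * ((b - a) + (d - c)) ^+ 2.
Proof.
move=> a00 p q /andP[ap p1] hq e e0.
have p0 : 0 < p by apply: lt_le_trans ap.
have hp : 0 < p <= 1 by rewrite p0 p1.
have hp' : 0 <= p <= 1 by rewrite ltW.
have [D HD] := derivable_lin (@dG p q hp).
(* The edges contribute at most [k (d - c)] or [k (b - a)] each, with
   [k = 2 * (e' * (2 * s * Dl) * (2 * s))] and [Dl = (b - a) + (d - c)], in all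
   [2 k Dl = 16 s^2 e' Dl^2]. *)
pose e' := e / (16 * s ^+ 2).
have s2 : 0 < 16 * s ^+ 2 by rewrite mulr_gt0 // exprn_gt0.
have e'0 : 0 < e' by rewrite divr_gt0.
have [del del0 Hdel] := HD e' e'0.
exists (del / (8 * s)); first by rewrite divr_gt0 // mulr_gt0.
move=> a b c d a0a /andP[ap' pb] b1 c0 /andP[cq qd] d2 ba dc.
have hs8 : 0 < 8 * s by rewrite mulr_gt0.
rewrite ltr_pdivlMr // in ba; rewrite ltr_pdivlMr // in dc.
pose Dl := (b - a) + (d - c).
have Dl0 : 0 <= Dl by rewrite addr_ge0 // subr_ge0; [exact: le_trans pb|exact: le_trans qd].
have ab : a <= b by exact: le_trans pb.
have cd : c <= d by exact: le_trans qd.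
have a0' : 0 < a by exact: lt_le_trans a0a.
have b0' : 0 < b by exact: lt_le_trans ab.
have close l t : a <= l <= b -> c <= t <= d ->
    cabs (G (W l t) - (G (W p q) + D * (W l t - W p q))) <= e' * (2 * s * Dl).
  move=> /andP[al lb] /andP[ct td].
  have hle : `|l - p| + `|t - q| <= Dl.
    by apply: lerD; rewrite ler_norml; apply/andP; split; lra.
  have hd := W_dist l t q hp'.
  have hd' : cabs (W l t - W p q) <= 2 * s * Dl.
    by apply: le_trans hd _; rewrite ler_wpM2l // mulr_ge0 // ltW.
  apply: le_trans (Hdel _ _) _.
    apply: le_lt_trans hd' _; rewrite /Dl; lra.
  by rewrite ler_wpM2l // ltW.
pose Pr := tangent_primitive (W p q) (G (W p q)) D.
have ls : 0 <= 2 * s by rewrite mulr_ge0 // ltW.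
have Ht l : a <= l <= b ->
    cabs (J l c d - (Pr (W l d) - Pr (W l c))) <= 2 * (e' * (2 * s * Dl) * (2 * s)) * (d - c).
  move=> hl; have hl' : 0 < l <= 1.
    by move/andP: hl => [h1 h2]; rewrite (lt_le_trans a0' h1) (le_trans h2 b1).
  have hl2 : 0 <= l <= 1 by move/andP: hl' => [/ltW -> ->].
  apply: (edge_estimate (gam := W l) cd).
  - by move=> t _; exact: W_derivt.
  - exact: cont_Wt.
  - exact: cont_GWt.
  - by move=> t _; exact: Wt_le.
  - by move=> t ht; exact: close.
have Hl t : c <= t <= d ->
    cabs (V t a b - (Pr (W b t) - Pr (W a t))) <= 2 * (e' * (2 * s * Dl) * (2 * s)) * (b - a).
  move=> ht.
  apply: (edge_estimate (gam := fun l => W l t) (dgam := fun=> Wl t) ab).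
  - by move=> l _; exact: W_derivl.
  - exact: cont_cstc.
  - exact: cont_GWl.
  - by move=> l _; exact: Wl_le.
  - by move=> l hl; exact: close.
have -> : mu a b c d = (J b c d - (Pr (W b d) - Pr (W b c)))
    - (J a c d - (Pr (W a d) - Pr (W a c)))
    - (V d a b - (Pr (W b d) - Pr (W a d))) + (V c a b - (Pr (W b c) - Pr (W a c))).
  by rewrite /mu; ring.
have h1 := Ht b; have h2 := Ht a; have h3 := Hl c; have h4 := Hl d.
rewrite !lexx ab in h1 h2; rewrite !lexx cd in h3 h4.
apply: le_trans (cabsD _ _) _; apply: le_trans (lerD (cabsB _ _) (lexx _)) _.
apply: le_trans (lerD (lerD (cabsB _ _) (lexx _)) (lexx _)) _.
have -> : e * (b - a + (d - c)) ^+ 2 = 2 * (e' * (2 * s * Dl) * (2 * s)) * (2 * Dl).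
  by rewrite /e' /Dl; field; rewrite gt_eqF.
have {}h1 := h1 isT; have {}h2 := h2 isT; have {}h3 := h3 isT; have {}h4 := h4 isT.
set k := 2 * (e' * _ * _) in h1 h2 h3 h4 *.
have -> : k * (2 * Dl) = k * (d - c) + k * (d - c) + k * (b - a) + k * (b - a).
  by rewrite /Dl; ring.
by rewrite !lerD.
Qed.

Let mu_eq0 a : 0 < a -> a <= 1 -> mu a 1 0 (2 * pi) = 0.
Proof.
move=> a0 a1; apply: rect_additive_eq0 => //.
- by rewrite mulr_ge0 // pi_ge0.
- move=> x m y c d ax xm my y1 c0 cd d2; rewrite /mu /V.
  have x0 : 0 < x by exact: lt_le_trans ax.
  have cc t : cont_itv x y (fun l => G (W l t) * Wl t).
    by refine (contM _ (cont_cstc _ _ _)); exact: cont_GWl.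
  by rewrite (cint_split xm my (cc d)) (cint_split xm my (cc c)); ring.
- move=> x y c m d ax xy y1 c0 cm md d2; rewrite /mu /J.
  have x0 : 0 < x by exact: lt_le_trans ax.
  have cc l : 0 < l <= 1 -> cont_itv c d (fun t => G (W l t) * Wt l t).
    by move=> hl; apply: contM; [exact: cont_GWt|exact: cont_Wt].
  rewrite (cint_split cm md (cc y _)) ?(lt_le_trans x0) //.
  by rewrite (cint_split cm md (cc x _)) ?x0 ?(le_trans xy) //; ring.
- exact: mu_small.
Qed.

Let J_const a : 0 < a -> a <= 1 -> J 1 0 (2 * pi) = J a 0 (2 * pi).
Proof.
move=> a0 a1; have := mu_eq0 a0 a1.
have -> : mu a 1 0 (2 * pi) = J 1 0 (2 * pi) - J a 0 (2 * pi).
  rewrite /mu; have -> : V (2 * pi) a 1 = V 0 a 1; last by ring.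
  by apply: cint_ext => l _; rewrite /W /Wl cis2pi cis0.
by move/eqP; rewrite subr_eq0 => /eqP.
Qed.

(** The circles [z + l (s e^(it) - z)], [0 < l <= 1], join the circle of radius
    [s] to the point [z], and the integral of the difference quotient [G] is the
    same along all of them; it tends to [0] with [l] since [G] is bounded. *)
Lemma cauchy_diff_quotient :
  cint 0 (2 * pi) (fun t => (F (s%:C%C * cis t) - F z) / (s%:C%C * cis t - z)
                            * (s%:C%C * cis t)) = 0.
Proof.
have W1 t : W 1 t = s%:C%C * cis t by rewrite /W rmorph1; ring.
have h11 : 0 < (1 : R) <= 1 by rewrite ltr01 lexx.
have J1 : J 1 0 (2 * pi) = 0.
  have [D HD] := derivable_lin (dF (lt_trans zs sr)).
  have [del del0 Hdel] := HD 1 ltr01.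
  pose B := cabs D + 1.
  have B0 : 0 <= B by rewrite addr_ge0 // cabs_ge0.
  apply/eqP; rewrite -cabs_eq0 eq_le cabs_ge0 andbT leNgt; apply/negP => J0.
  pose K := 2 * (B * s) * (2 * pi - 0).
  have p0 : 0 <= 2 * pi - 0 :> R by rewrite subr0 mulr_ge0 // pi_ge0.
  have K0 : 0 <= K by rewrite !mulr_ge0 // ltW.
  pose a := Num.min (Num.min 1 (del / (4 * s))) (cabs (J 1 0 (2 * pi)) / (K + 1) / 2).
  have K1 : 0 < K + 1 by rewrite ltr_wpDl.
  have a0 : 0 < a by rewrite !lt_min ltr01 !divr_gt0 // mulr_gt0.
  have a1 : a <= 1 by rewrite !ge_min lexx.
  have ad : a <= del / (4 * s) by rewrite !ge_min lexx orbT.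
  have aJ : a <= cabs (J 1 0 (2 * pi)) / (K + 1) / 2 by rewrite ge_min lexx orbT.
  have ha : 0 < a <= 1 by rewrite a0.
  have : cabs (J a 0 (2 * pi)) <= 2 * (B * (a * s)) * (2 * pi - 0).
    apply: cint_norm; first by rewrite mulr_ge0 // pi_ge0.
      by refine (contM _ _); [exact: cont_GWt|exact: cont_Wt].
    move=> t _; rewrite cabsM; apply: ler_pM; rewrite ?cabs_ge0 //; last first.
      by rewrite /Wt !cabsM cabs_cis cabsI !cabs_real !mulr1 !gtr0_norm.
    rewrite /G cabsM cabsV ler_pdivrMr ?cabs_gt0 ?W_neq //.
    have := Hdel (W a t); rewrite mul1r => H.
    have : cabs (W a t - z) < del.
      rewrite /W [z + _]addrC addrK cabsM cabs_real gtr0_norm //.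
      apply: (@le_lt_trans _ _ (del / (4 * s) * (2 * s))).
        by apply: ler_pM; rewrite ?cabs_ge0 //; [exact: ltW|exact: Wl_le].
      have -> : del / (4 * s) * (2 * s) = del / 2 by field; rewrite gt_eqF.
      lra.
    move=> /H h.
    have -> : F (W a t) - F z = (F (W a t) - (F z + D * (W a t - z))) + D * (W a t - z) by ring.
    apply: le_trans (cabsD _ _) _; rewrite /B mulrDl mul1r addrC cabsM.
    by apply: lerD.
  rewrite -(J_const a0 a1).
  have -> : 2 * (B * (a * s)) * (2 * pi - 0) = a * K by rewrite /K; ring.
  apply/negP; rewrite -ltNge; apply: (@le_lt_trans _ _ (a * (K + 1))).
    by rewrite ler_wpM2l ?lerDl // ltW.
  rewrite -ltr_pdivlMr //; apply: le_lt_trans aJ _.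
  set x := _ / (K + 1); have : 0 < x by rewrite divr_gt0.
  lra.
have cc : cont_itv 0 (2 * pi) (fun t => G (W 1 t) * Wt 1 t).
  by refine (contM _ _); [exact: cont_GWt|exact: cont_Wt].
rewrite -[RHS](mulr0 (- Complex 0 1)) -J1 -cintZ //; apply: cint_ext => t _.
rewrite W1 /Wt /G rmorph1 mul1r.
have -> : - Complex 0 1 * ((F (s%:C%C * cis t) - F z) / (s%:C%C * cis t - z) * (s%:C%C * (Complex 0 1 * cis t)))
   = - (Complex 0 1 * Complex 0 1) * ((F (s%:C%C * cis t) - F z) / (s%:C%C * cis t - z) * (s%:C%C * cis t)) by ring.
by rewrite -expr2 sqr_i opprK mul1r.
Qed.

End CauchyDisc.

(** * Taylor expansion and interpolation at roots of unity *)

Section RootsOfUnity.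
Variable R : realType.

Definition rootu (n : nat) : R[i] := cis (2 * pi / n.+1%:R).

Lemma rootuX n k : rootu n ^+ k = cis (k%:R * (2 * pi / n.+1%:R)).
Proof.
elim: k => [|k IH]; first by rewrite mul0r cis0.
rewrite exprS IH /rootu -cisD; congr cis; rewrite -[k.+1%:R]natr1; ring.
Qed.

Lemma cis_neq1 (x : R) : 0 < x -> x < 2 * pi -> cis x != 1.
Proof.
move=> x0 x2; apply/eqP => h.
have s0 : 0 < sin (x / 2) by apply: sin_gt0_pi; rewrite divr_gt0 //= ltr_pdivrMr // mulrC.
have : cis (x / 2) ^+ 2 = 1 by rewrite expr2 -cisD -splitr.
move=> /eqP; rewrite sqrf_eq1 => /orP[] /eqP -[_ h2].
  by rewrite h2 ltxx in s0.
by rewrite h2 oppr0 ltxx in s0.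
Qed.

Lemma rootuP n : n.+1.-primitive_root (rootu n).
Proof.
have p0 : 0 < 2 * pi / n.+1%:R :> R by rewrite divr_gt0 // mulr_gt0 // pi_gt0.
apply/andP; split=> //; apply/forallP => -[i /= hi]; apply/eqP.
rewrite unity_rootE rootuX.
have [->|in1] := eqVneq i.+1 n.+1.
  by rewrite mulrC divfK ?pnatr_eq0 // cis2pi eqxx.
apply/negbTE/cis_neq1; first by rewrite mulr_gt0.
rewrite mulrCA -ltr_pdivlMl ?mulr_gt0 ?pi_gt0 // mulVf; last by rewrite mulf_neq0 // gt_eqF // pi_gt0.
by rewrite ltr_pdivrMr // mul1r ltr_nat ltn_neqAle in1.
Qed.

Lemma cabs_rootu n : cabs (rootu n) = 1.
Proof. exact: cabs_cis. Qed.

Lemma rootu_neq0 n : rootu n != 0.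
Proof. by rewrite -cabs_eq0 cabs_rootu oner_eq0. Qed.

Lemma sum_geom_root n (w : R[i]) : w ^+ n.+1 = 1 -> w != 1 -> \sum_(m < n.+1) w ^+ m = 0.
Proof.
move=> wn w1; have := subrX1 w n.+1; rewrite wn subrr => /esym/eqP.
by rewrite mulf_eq0 subr_eq0 (negbTE w1) => /eqP.
Qed.

(** Orthogonality of the characters of the cyclic group. *)
Lemma sum_rootu n i j : (n.+1%:R)^-1 * \sum_(m < n.+1) (rootu n ^+ m) ^+ i / (rootu n ^+ m) ^+ j
  = (i == j %[mod n.+1])%:R.
Proof.
pose w := rootu n ^+ i / rootu n ^+ j.
have -> : \sum_(m < n.+1) (rootu n ^+ m) ^+ i / (rootu n ^+ m) ^+ j = \sum_(m < n.+1) w ^+ m.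
  by apply: eq_bigr => m _; rewrite /w expr_div_n -!exprM ![(m * _)%N]mulnC.
have w1 : (w == 1) = (i == j %[mod n.+1]).
  rewrite -(eq_prim_root_expr (rootuP n)) /w.
  have j0 : rootu n ^+ j != 0 by rewrite expf_neq0 // rootu_neq0.
  by rewrite -[in LHS](divff j0) (inj_eq (mulIf (invr_neq0 j0))).
case: eqP w1 => [-> <-|/eqP w1 <-].
  under eq_bigr do rewrite expr1n.
  by rewrite sumr_const card_ord mulVf // pnatr_eq0.
rewrite sum_geom_root ?mulr0 //.
by rewrite /w expr_div_n -!exprM ![(_ * n.+1)%N]mulnC !exprM (prim_expr_order (rootuP n)) !expr1n divr1.
Qed.

End RootsOfUnity.

Section Interpolation.
Variable R : realType.
Implicit Types (z w q : R[i]) (s t x y : R).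

Definition geosum (N : nat) (q : R[i]) : R[i] := \sum_(j < N) q ^+ j.

Lemma geosumE N q : q != 1 -> (1 - q)^-1 = geosum N q + q ^+ N / (1 - q).
Proof.
move=> q1; have q1' : 1 - q != 0 by rewrite subr_eq0 eq_sym.
have h : 1 - q ^+ N = (1 - q) * geosum N q by rewrite -[1 - q ^+ N]opprB subrX1 -mulNr opprB.
apply: (mulfI q1'); rewrite mulrDr -h mulrCA !divff // mulr1; ring.
Qed.

Lemma geom_sum_le (q : R) N : 0 <= q -> q < 1 -> \sum_(j < N) q ^+ j <= (1 - q)^-1.
Proof.
move=> q0 q1; rewrite -[leRHS]mul1r ler_pdivlMr ?subr_gt0 // mulrC -opprB mulNr -subrX1 opprB.
by rewrite lerBlDr lerDl exprn_ge0.
Qed.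

Lemma cabs_geosum_le N q x : cabs q <= x -> x < 1 -> cabs (geosum N q) <= (1 - x)^-1.
Proof.
move=> qx x1; have x0 : 0 <= x by apply: le_trans qx; exact: cabs_ge0.
apply: le_trans (cabs_sum _ _ _) _; apply: (@le_trans _ _ (\sum_(j < N) x ^+ j)).
  by apply: ler_sum => j _; rewrite cabsX lerXn2r // ?nnegrE ?cabs_ge0.
exact: geom_sum_le.
Qed.

(** The inverse of [cis], in a form that the real derivatives apply to. *)
Let cisV t : R[i] := Complex (cos t) (- sin t).

Let cisVE t : cisV t = (cis t)^-1.
Proof.
apply: (mulfI (cis_neq0 t)); rewrite divff ?cis_neq0 //.
apply: complex_ext => /=; last by ring.
by rewrite mulrN opprK -!expr2 cos2Dsin2.
Qed.

Let has_cderiv_cisVX n t : has_cderiv (fun t => cisV t ^+ n.+1) t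
   (- (n.+1%:R * Complex 0 1) * cisV t ^+ n.+1).
Proof.
have h : has_cderiv cisV t (- Complex 0 1 * cisV t).
  split => /=.
    by apply: is_derive_eq_fun (is_derive_cos t) _ _ => //=; ring.
  by apply: is_derive_eq_fun (is_deriveN (is_derive_sin t)) _ _ => //=; ring.
elim: n => [|n IH]; first by rewrite mul1r.
apply: has_cderiv_eq (has_cderivM h IH) _ _; first by move=> u /=; rewrite -exprS.
by rewrite [in RHS]exprS -[in RHS]natr1; ring.
Qed.

Let cont_cisVX n x y : cont_itv x y (fun t => cisV t ^+ n).
Proof.
case: n => [|n]; first by rewrite (_ : (fun _ => _) = fun=> 1) //; exact: cont_cstc.
by move=> t _; exact: has_cderiv_cont (has_cderiv_cisVX n t).
Qed.

Let pi2_ge0 : 0 <= 2 * pi :> R. Proof. by rewrite mulr_ge0 // pi_ge0. Qed.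

Let cint_cisVX n : cint 0 (2 * pi) (fun t => cisV t ^+ n) = if n == 0 then (2 * pi)%:C%C else 0.
Proof.
case: n => [|n] /=.
  rewrite /cint; apply: complex_ext => /=.
    by rewrite rint_cst // mul1r subr0.
  by rewrite rint_cst // mul0r.
pose k : R[i] := - (n.+1%:R * Complex 0 1).
have k0 : k != 0.
  rewrite oppr_eq0 mulf_neq0 ?pnatr_eq0 //.
  by apply/eqP => -[/eqP]; rewrite oner_eq0.
apply: (mulfI k0); rewrite mulr0 -cintZ; last exact: cont_cisVX.
rewrite (@cint_FTC _ _ _ (fun t => cisV t ^+ n.+1)) //.
  by rewrite !cisVE cis2pi cis0 subrr.
refine (contM (cont_cstc _ _ _) _); exact: cont_cisVX.
Qed.

Variables (F : R[i] -> R[i]) (r s B : R).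
Hypothesis dF : forall w, cabs w < r -> derivable F w 1.
Hypothesis s0 : 0 < s.
Hypothesis sr : s < r.
Hypothesis FB : forall w, cabs w <= s -> cabs (F w) <= B.

Let om t := s%:C%C * cis t.

Let cont_Fom x y : cont_itv x y (fun t => F (om t)).
Proof.
move=> t _; apply: (cvg_comp om F).
  by apply: cvgM; [exact: cvg_cst|exact: has_cderiv_cont (has_cderiv_cis t)].
apply: differentiable_continuous; apply/derivable1_diffP; apply: dF.
by rewrite cabsM cabs_cis mulr1 cabs_real gtr0_norm.
Qed.

(** Cauchy's integral for the coefficient of index [j]. *)
Let taylor_coef j : R[i] := (2 * pi)%:C%C^-1 * (s%:C%C ^- j * cint 0 (2 * pi) (fun t => F (om t) * cisV t ^+ j)).

(** Expanding the Cauchy kernel [1 / (1 - z / w)], [|w| = s], into a geometric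
    sum of [J.+1] terms leaves a remainder of order [(|z| / s) ^ J.+1]. *)
Lemma taylor_remainder : exists c : nat -> R[i], forall z J, cabs z < s ->
  cabs (F z - \sum_(j < J.+1) c j * z ^+ j) <= 4 * B * (cabs z / s) ^+ J.+1 / (1 - cabs z / s).
Proof.
exists taylor_coef => z J zs.
have sC0 : s%:C%C != 0 by rewrite -cabs_eq0 cabs_real normr_eq0 gt_eqF.
have om0 t : om t != 0 by rewrite mulf_neq0 ?cis_neq0.
have om_s t : cabs (om t) = s by rewrite cabsM cabs_cis mulr1 cabs_real gtr0_norm.
pose q t := z / om t.
have cq t : cabs (q t) = cabs z / s by rewrite cabsM cabsV om_s.
have rho1 : cabs z / s < 1 by rewrite ltr_pdivrMr // mul1r.
have q1 t : q t != 1.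
  by apply/eqP => /(congr1 (@cabs R)); rewrite cq cabs1 => h; rewrite h ltxx in rho1.
have qE t j : q t ^+ j = (z / s%:C%C) ^+ j * cisV t ^+ j.
  by rewrite -exprMn cisVE /q invfM mulrA.
have pi20 : (2 * pi)%:C%C != 0 :> R[i].
  by rewrite -cabs_eq0 cabs_real normr_eq0 mulf_neq0 ?gt_eqF // pi_gt0.
pose D t := F (om t) - F z.
have cD : cont_itv 0 (2 * pi) D by refine (contD (@cont_Fom _ _) (cont_cstc _ _ _)).
have cqj j : cont_itv 0 (2 * pi) (fun t => q t ^+ j).
  rewrite (_ : (fun t => q t ^+ j) = fun t => (z / s%:C%C) ^+ j * cisV t ^+ j).
    by refine (contM (cont_cstc _ _ _) _); exact: cont_cisVX.
  by apply/funext => t; rewrite qE.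
have cgs N : cont_itv 0 (2 * pi) (fun t => geosum N (q t)).
  rewrite /geosum; elim: N => [|N IH].
    rewrite (_ : (fun t => _) = fun=> 0); first exact: cont_cstc.
    by apply/funext => t; rewrite big_ord0.
  rewrite (_ : (fun t => _) = fun t => (\sum_(j < N) q t ^+ j) + q t ^+ N).
    exact (contD IH (cqj N)).
  by apply/funext => t; rewrite big_ord_recr.
have cV : cont_itv 0 (2 * pi) (fun t => (1 - q t)^-1).
  move=> t ht; apply: cvgV; first by rewrite subr_eq0 eq_sym.
  by apply: cvgB; [exact: cvg_cst|exact: (cqj 1%N)].
pose rem t := D t * (q t ^+ J.+1 * (1 - q t)^-1).
have crem : cont_itv 0 (2 * pi) rem := contM cD (contM (cqj J.+1) cV).
have H0 : cint 0 (2 * pi) (fun t => D t * geosum J.+1 (q t)) + cint 0 (2 * pi) rem = 0.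
  rewrite -(cintD (contM cD (cgs J.+1)) crem).
  rewrite -[RHS](cauchy_diff_quotient dF s0 sr zs); apply: cint_ext => t _.
  rewrite /rem -mulrDr -geosumE // -/(om t) -mulrA; congr (_ * _).
  have h1 : 1 - q t != 0 by rewrite subr_eq0 eq_sym.
  have h2 : om t - z != 0.
    rewrite subr_eq0; apply/eqP => h; move/eqP: (q1 t); apply; rewrite /q h divff //.
    by rewrite -h.
  by rewrite /q; field; rewrite om0 h2.
have H1 N : cint 0 (2 * pi) (fun t => D t * geosum N.+1 (q t)) =
    (2 * pi)%:C%C * (\sum_(j < N.+1) taylor_coef j * z ^+ j - F z).
  have step j : cint 0 (2 * pi) (fun t => D t * q t ^+ j) =
      (2 * pi)%:C%C * (taylor_coef j * z ^+ j - (if j == 0 then F z else 0)).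
    have c1 : cont_itv 0 (2 * pi) (fun t => F (om t) * cisV t ^+ j).
      by refine (contM _ _); [exact: cont_Fom|exact: cont_cisVX].
    have c2 : cont_itv 0 (2 * pi) (fun t => F z * cisV t ^+ j).
      by refine (contM (cont_cstc _ _ _) _); exact: cont_cisVX.
    transitivity ((z / s%:C%C) ^+ j * (cint 0 (2 * pi) (fun t => F (om t) * cisV t ^+ j)
        - F z * cint 0 (2 * pi) (fun t => cisV t ^+ j))).
      rewrite -(@cintZ _ _ _ (F z) _ (@cont_cisVX _ _ _)).
      rewrite -(cintB c1 c2) -(cintZ _ (contD c1 (contN c2))).
      by apply: cint_ext => t _; rewrite qE /D; ring.
    rewrite cint_cisVX /taylor_coef expr_div_n.
    have alg0 (p a b : R[i]) : p != 0 -> a - b * p = p * (p^-1 * a - b) by move=> ?; field.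
    have alg1 (p u v a : R[i]) : p != 0 -> v / u * a = p * (p^-1 * (u^-1 * a) * v).
      by move=> p0; rewrite -[p^-1 * _ * v]mulrA mulVKf //; ring.
    case: (j) => [|i] /=; last by rewrite mulr0 !subr0; exact: alg1.
    by rewrite !expr0 divr1 invr1 !mul1r mulr1; exact: alg0.
  elim: N => [|N IH].
    rewrite big_ord1 -[in RHS](step 0%N); apply: cint_ext => t _.
    by rewrite /geosum big_ord1.
  have -> : \sum_(j < N.+2) taylor_coef j * z ^+ j - F z =
      (\sum_(j < N.+1) taylor_coef j * z ^+ j - F z) + taylor_coef N.+1 * z ^+ N.+1.
    by rewrite big_ord_recr /= addrAC.
  rewrite [RHS]mulrDr -IH.
  have := step N.+1; rewrite /= subr0 => <-.
  rewrite -(cintD (contM cD (cgs _)) (contM cD (cqj _))).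
  by apply: cint_ext => t _; rewrite /geosum big_ord_recr mulrDr.
have -> : F z - \sum_(j < J.+1) taylor_coef j * z ^+ j = (2 * pi)%:C%C^-1 * cint 0 (2 * pi) rem.
  move: H0; rewrite H1 addrC => /eqP; rewrite addr_eq0 => /eqP ->.
  by rewrite -mulrN opprB mulrA mulVf // mul1r.
have B0 : 0 <= B by apply: le_trans (FB (w := 0) _); rewrite ?cabs_ge0 ?cabs0 // ltW.
rewrite cabsM cabsV cabs_real ger0_norm //.
have pi2 : 0 < 2 * pi :> R by rewrite mulr_gt0 // pi_gt0.
rewrite ler_pdivrMl //.
set M := (cabs z / s) ^+ J.+1 / (1 - cabs z / s).
have -> : 2 * pi * (4 * B * (cabs z / s) ^+ J.+1 / (1 - cabs z / s)) = 2 * (2 * B * M) * (2 * pi - 0).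
  by rewrite /M; ring.
apply: cint_norm => // t _; rewrite /rem cabsM; apply: ler_pM; rewrite ?cabs_ge0 //.
  apply: le_trans (cabsB _ _) _; rewrite mulr_natl mulr2n.
  by apply: lerD; apply: FB; rewrite ?om_s // ltW.
rewrite cabsM cabsX cq /M cabsV ler_wpM2l ?exprn_ge0 ?divr_ge0 ?cabs_ge0 ?(ltW s0) //.
have h1 : 0 < 1 - cabs z / s by rewrite subr_gt0.
have h2 : 1 - cabs z / s <= cabs (1 - q t).
  by have := cabsD (1 - q t) (q t); rewrite subrK cabs1 cq lerBlDr.
by rewrite lef_pV2 // posrE // (lt_le_trans h1).
Qed.

End Interpolation.

Section RootInterpolation.
Variable R : realType.

(** A discrete form of the mean over the circle of radius [s]. *)
Definition cmean (N : nat) (s : R) (H : R[i] -> R[i]) : R[i] :=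
  (N.+1%:R)^-1 * \sum_(m < N.+1) H (s%:C%C * rootu R N ^+ m).

Lemma cabs_node N (s : R) m : 0 <= s -> cabs (s%:C%C * rootu R N ^+ m) = s.
Proof. by move=> s0; rewrite cabsM cabsX cabs_rootu expr1n mulr1 cabs_real ger0_norm. Qed.

Lemma cabs_cmean_le N s H (B : R) : 0 <= s ->
  (forall x, cabs x = s -> cabs (H x) <= B) -> cabs (cmean N s H) <= B.
Proof.
move=> s0 HB; rewrite /cmean cabsM cabsV cabs_nat ler_pdivrMl ?ltr0n //.
apply: le_trans (cabs_sum _ _ _) _.
apply: (@le_trans _ _ (\sum_(m < N.+1) B)).
  by apply: ler_sum => m _; apply: HB; exact: cabs_node.
by rewrite sumr_const card_ord mulr_natl.
Qed.

Lemma cmeanD N s H K : cmean N s (fun x => H x + K x) = cmean N s H + cmean N s K.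
Proof. by rewrite /cmean big_split mulrDr. Qed.

Lemma cmeanZ N s k H : cmean N s (fun x => k * H x) = k * cmean N s H.
Proof. by rewrite /cmean -mulr_sumr mulrCA. Qed.

Lemma cmeanB N s H K : cmean N s (fun x => H x - K x) = cmean N s H - cmean N s K.
Proof.
rewrite cmeanD; congr (_ + _); rewrite -mulN1r -cmeanZ.
by congr cmean; apply/funext => x; rewrite mulN1r.
Qed.

Lemma cmean_sum N s (J : Type) (l : seq J) (Q : pred J) (H : J -> R[i] -> R[i]) :
  cmean N s (fun x => \sum_(j <- l | Q j) H j x) = \sum_(j <- l | Q j) cmean N s (H j).
Proof. by rewrite /cmean exchange_big /= mulr_sumr. Qed.

Lemma cmean_ext N s H K : 0 <= s -> (forall x, cabs x = s -> H x = K x) -> cmean N s H = cmean N s K.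
Proof.
by move=> s0 HK; congr (_ * _); apply: eq_bigr => m _; apply: HK; exact: cabs_node.
Qed.

(** Aliasing: on the nodes, exponents only matter modulo [N.+1]. *)
Lemma cmean_expr N s i j : 0 < s ->
  cmean N s (fun x => x ^+ i / x ^+ j) = s%:C%C ^+ i / s%:C%C ^+ j * (i == j %[mod N.+1])%:R.
Proof.
move=> s0; rewrite -sum_rootu /cmean mulrCA; congr (_ * _); rewrite mulr_sumr.
apply: eq_bigr => m _; rewrite !exprMn invfM; ring.
Qed.

(** The interpolation polynomial of [F] at the [N.+1] nodes, evaluated at [z]. *)
Definition interp N s (F : R[i] -> R[i]) z : R[i] :=
  cmean N s (fun x => F x * geosum N.+1 (z / x)).

Lemma interp_expr N (s : R) j z : 0 < s -> (j < N.+1)%N -> interp N s (fun w => w ^+ j) z = z ^+ j.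
Proof.
move=> s0 jN; rewrite /interp.
have -> : cmean N s (fun x => x ^+ j * geosum N.+1 (z / x)) =
    \sum_(i < N.+1) z ^+ i * cmean N s (fun x => x ^+ j / x ^+ i).
  under [RHS]eq_bigr do rewrite -cmeanZ.
  rewrite -cmean_sum; congr cmean; apply/funext => x.
  rewrite /geosum mulr_sumr; apply: eq_bigr => i _.
  by rewrite expr_div_n mulrCA.
rewrite (bigD1 (Ordinal jN)) //= big1 ?addr0.
  rewrite cmean_expr // eqxx mulr1 divff ?mulr1 // expf_neq0 //.
  by rewrite -cabs_eq0 cabs_real normr_eq0 gt_eqF.
move=> i; rewrite -val_eqE /= => ij; rewrite cmean_expr // !modn_small //.
by rewrite eq_sym (negbTE ij) !mulr0.
Qed.

Variables (F : R[i] -> R[i]) (r s s1 sg B : R).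
Hypothesis dF : forall w, cabs w < r -> derivable F w 1.
Hypothesis s10 : 0 < s1.
Hypothesis s1s : s1 < s.
Hypothesis sr : s < r.
Hypothesis sgs1 : sg < s1.
Hypothesis FB : forall w, cabs w <= s -> cabs (F w) <= B.

Definition interp_err (N : nat) : R :=
  4 * (s1 / s) ^+ N.+1 / (1 - s1 / s) * (1 + (1 - sg / s1)^-1).

(** Interpolation reproduces the Taylor polynomial of degree [N] exactly and
    the remainder is geometrically small. *)
Lemma interp_close N z : cabs z <= sg -> cabs (F z - interp N s1 F z) <= B * interp_err N.
Proof.
move=> zsg; have s0 : 0 < s by apply: lt_trans s1s.
have [c Hc] := taylor_remainder dF s0 sr FB.
pose p w := \sum_(j < N.+1) c j * w ^+ j.
pose rem w := F w - p w.
have B0 : 0 <= B by apply: le_trans (FB (w := 0) _); rewrite ?cabs_ge0 ?cabs0 // ltW.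
pose M := 4 * B * (s1 / s) ^+ N.+1 / (1 - s1 / s).
have q1 : 0 < 1 - s1 / s by rewrite subr_gt0 ltr_pdivrMr // mul1r.
have q2 : 0 < 1 - sg / s1 by rewrite subr_gt0 ltr_pdivrMr // mul1r.
have M0 : 0 <= M.
  rewrite /M !mulr_ge0 ?invr_ge0 ?exprn_ge0 //; try (by rewrite ltW).
  by rewrite divr_ge0 // ltW.
have Hrem w : cabs w <= s1 -> cabs (rem w) <= M.
  move=> ws1; apply: le_trans (Hc w N (le_lt_trans ws1 s1s)) _.
  have h : cabs w / s <= s1 / s by rewrite ler_pM2r // invr_gt0.
  have h0 : 0 <= cabs w / s by rewrite divr_ge0 ?cabs_ge0 // ltW.
  rewrite /M; apply: ler_pM; rewrite ?invr_ge0.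
  - by rewrite !mulr_ge0 ?exprn_ge0.
  - by apply: ltW; apply: lt_le_trans q1 _; rewrite lerB.
  - by rewrite ler_wpM2l ?mulr_ge0 // lerXn2r // nnegrE // (le_trans h0).
  - by rewrite lef_pV2 ?posrE //; [rewrite lerB|apply: lt_le_trans q1 _; rewrite lerB].
have -> : F z - interp N s1 F z = rem z - interp N s1 rem z.
  have -> : interp N s1 F z = interp N s1 rem z + p z.
    have -> : p z = interp N s1 p z.
      rewrite /interp /p.
      transitivity (\sum_(j < N.+1) c j * interp N s1 (fun w => w ^+ j) z).
        by apply: eq_bigr => j _; rewrite interp_expr.
      rewrite /interp; under eq_bigr do rewrite -cmeanZ.
      rewrite -cmean_sum; congr cmean; apply/funext => x; rewrite mulr_suml.
      by apply: eq_bigr => j _; rewrite mulrA.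
    rewrite /interp -cmeanD; congr cmean; apply/funext => x.
    by rewrite -mulrDl /rem subrK.
  by rewrite /rem; ring.
apply: le_trans (cabsB _ _) _.
have -> : B * interp_err N = M + M * (1 - sg / s1)^-1 by rewrite /interp_err /M; ring.
apply: lerD; first by apply: Hrem; apply: le_trans zsg (ltW sgs1).
apply: cabs_cmean_le; first exact: ltW.
move=> x xs1; rewrite cabsM; apply: ler_pM; rewrite ?cabs_ge0 //.
  by apply: Hrem; rewrite xs1.
apply: cabs_geosum_le; last by rewrite ltr_pdivrMr // mul1r.
by rewrite cabsM cabsV xs1 ler_pM2r // invr_gt0.
Qed.

Lemma interp_err_cvg : interp_err N @[N --> \oo] --> (0 : R).
Proof.
have s0 : 0 < s by apply: lt_trans s1s.
pose k := 4 / (1 - s1 / s) * (1 + (1 - sg / s1)^-1).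
have -> : interp_err = fun N => k * ((s1 / s) ^+ N.+1).
  by apply/funext => N; rewrite /interp_err /k; ring.
rewrite -(mulr0 k); apply: cvgM; first exact: cvg_cst.
rewrite (cvg_shiftS (fun n => (s1 / s) ^+ n)).
apply: cvg_expr; rewrite ger0_norm ?divr_ge0 ?ltW //.
by rewrite ltr_pdivrMr // mul1r.
Qed.

End RootInterpolation.

(** * Means over tori *)

Section VectorCons.
Variables (K : Type) (n : nat).

Definition vcons (w : K) (z : 'rV[K]_n) : 'rV[K]_n.+1 :=
  \row_i oapp (z ord0) w (unlift ord0 i).
Definition vtail (z : 'rV[K]_n.+1) : 'rV[K]_n := \row_i z ord0 (lift ord0 i).

Lemma vcons0 w z : vcons w z ord0 ord0 = w.
Proof. by rewrite mxE unlift_none. Qed.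

Lemma vconsS w z k : vcons w z ord0 (lift ord0 k) = z ord0 k.
Proof. by rewrite mxE liftK. Qed.

Lemma vcons_eta (z : 'rV[K]_n.+1) : vcons (z ord0 ord0) (vtail z) = z.
Proof.
apply/rowP => i; case: (unliftP ord0 i) => [j ->|->]; last by rewrite vcons0.
by rewrite vconsS mxE.
Qed.

Definition upd m (z : 'rV[K]_m) (k : 'I_m) (w : K) : 'rV[K]_m :=
  \row_i (if i == k then w else z ord0 i).

Lemma upd_vcons0 w z x : upd (vcons w z) ord0 x = vcons x z.
Proof.
apply/rowP => i; rewrite mxE; case: (unliftP ord0 i) => [j ->|->].
  by rewrite !vconsS.
by rewrite !vcons0.
Qed.

Lemma upd_vconsS w z k x : upd (vcons w z) (lift ord0 k) x = vcons w (upd z k x).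
Proof.
apply/rowP => i; rewrite mxE; case: (unliftP ord0 i) => [j ->|->].
  by rewrite !vconsS mxE (inj_eq lift_inj).
by rewrite !vcons0.
Qed.

End VectorCons.

Section TorusMean.
Variable R : realType.

(** A discrete form of the mean over the torus [|z_k| = s_k], [N.+1] points in
    each variable. *)
Fixpoint tmean (n N : nat) : 'rV[R]_n -> ('rV[R[i]]_n -> R[i]) -> R[i] :=
  match n with
  | 0 => fun _ H => H 0
  | n'.+1 => fun s H => cmean N (s ord0 ord0)
      (fun w => tmean N (vtail s) (fun z => H (vcons w z)))
  end.

Definition on_torus n (s : 'rV[R]_n) (z : 'rV[R[i]]_n) := forall k, cabs (z ord0 k) = s ord0 k.

Lemma on_torus_vcons n (s : 'rV[R]_n.+1) w z :
  cabs w = s ord0 ord0 -> on_torus (vtail s) z -> on_torus s (vcons w z).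
Proof.
move=> hw hz k; case: (unliftP ord0 k) => [j ->|->]; last by rewrite vcons0.
by rewrite vconsS hz mxE.
Qed.

Lemma vtail_ge0 n (s : 'rV[R]_n.+1) : vle 0 s -> vle 0 (vtail s).
Proof. by move=> s0 k; have := s0 (lift ord0 k); rewrite !mxE. Qed.

Lemma vtail_gt0 n (s : 'rV[R]_n.+1) : vlt 0 s -> vlt 0 (vtail s).
Proof. by move=> s0 k; have := s0 (lift ord0 k); rewrite !mxE. Qed.

Lemma vle_ord0 n (s : 'rV[R]_n.+1) : vle 0 s -> 0 <= s ord0 ord0.
Proof. by move=> /(_ ord0); rewrite mxE. Qed.

Lemma vlt_ord0 n (s : 'rV[R]_n.+1) : vlt 0 s -> 0 < s ord0 ord0.
Proof. by move=> /(_ ord0); rewrite mxE. Qed.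

Lemma tmean_ext n N (s : 'rV[R]_n) H K : vle 0 s ->
  (forall z, on_torus s z -> H z = K z) -> tmean N s H = tmean N s K.
Proof.
elim: n s H K => [|n IH] s H K s0 HK /=; first by apply: HK => -[].
apply: cmean_ext => [|w hw]; first exact: vle_ord0.
by apply: IH => [|z hz]; [exact: vtail_ge0|apply: HK; exact: on_torus_vcons].
Qed.

Lemma cabs_tmean_le n N (s : 'rV[R]_n) H (B : R) : vle 0 s ->
  (forall z, on_torus s z -> cabs (H z) <= B) -> cabs (tmean N s H) <= B.
Proof.
elim: n s H => [|n IH] s H s0 HB /=; first by apply: HB => -[].
apply: cabs_cmean_le => [|w hw]; first exact: vle_ord0.
by apply: IH => [|z hz]; [exact: vtail_ge0|apply: HB; exact: on_torus_vcons].
Qed.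

Lemma tmean_cvg_ext n (s : 'rV[R]_n) H K (l : R[i]) : vle 0 s ->
  (forall z, on_torus s z -> K z = H z) ->
  tmean N s H @[N --> \oo] --> l -> tmean N s K @[N --> \oo] --> l.
Proof.
move=> s0 KH h; rewrite (_ : (fun N => tmean N s K) = fun N => tmean N s H); first exact: h.
by apply/funext => N; exact: tmean_ext.
Qed.

Lemma tmeanD n N (s : 'rV[R]_n) H K :
  tmean N s (fun z => H z + K z) = tmean N s H + tmean N s K.
Proof.
elim: n s H K => [|n IH] s H K //=.
by rewrite -cmeanD; congr cmean; apply/funext => w; rewrite -IH.
Qed.

Lemma tmeanZ n N (s : 'rV[R]_n) k H : tmean N s (fun z => k * H z) = k * tmean N s H.
Proof.
elim: n s H => [|n IH] s H //=.
by rewrite -cmeanZ; congr cmean; apply/funext => w; rewrite -IH.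
Qed.

Lemma tmeanB n N (s : 'rV[R]_n) H K :
  tmean N s (fun z => H z - K z) = tmean N s H - tmean N s K.
Proof.
rewrite tmeanD; congr (_ + _); rewrite -mulN1r -tmeanZ.
by congr tmean; apply/funext => x; rewrite mulN1r.
Qed.

Lemma tmean_sum n N (s : 'rV[R]_n) (J : Type) (l : seq J) (Q : pred J) (H : J -> 'rV[R[i]]_n -> R[i]) :
  tmean N s (fun x => \sum_(j <- l | Q j) H j x) = \sum_(j <- l | Q j) tmean N s (H j).
Proof.
elim: n s H => [|n IH] s H //=.
by rewrite -cmean_sum; congr cmean; apply/funext => w; rewrite -IH.
Qed.

Lemma tmean_prod n N (s : 'rV[R]_n) (h : 'I_n -> R[i] -> R[i]) :
  tmean N s (fun z => \prod_k h k (z ord0 k)) = \prod_k cmean N (s ord0 k) (h k).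
Proof.
elim: n s h => [|n IH] s h /=; first by rewrite !big_ord0.
rewrite big_ord_recl mulrC -cmeanZ; congr cmean; apply/funext => w.
transitivity (h ord0 w * tmean N (vtail s) (fun z => \prod_k h (lift ord0 k) (z ord0 k))).
  rewrite -tmeanZ; congr tmean; apply/funext => z; rewrite big_ord_recl vcons0.
  by congr (_ * _); apply: eq_bigr => k _; rewrite vconsS.
rewrite (IH _ (fun k => h (lift ord0 k))) mulrC; congr (_ * _).
by apply: eq_bigr => k _; rewrite mxE.
Qed.

Lemma tmean_mpow n N (s : 'rV[R]_n) (I J : mindex n) : vlt 0 s ->
  tmean N s (fun z => mpow z I / mpow z J) =
  mpow (cvec s) I / mpow (cvec s) J * (\prod_k (I ord0 k == J ord0 k %[mod N.+1]))%:R.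
Proof.
move=> s0; rewrite /mpow.
transitivity (tmean N s (fun z => \prod_k (z ord0 k ^+ I ord0 k / z ord0 k ^+ J ord0 k))).
  by congr tmean; apply/funext => z; rewrite -prodfV -big_split.
rewrite (tmean_prod N s (fun k w => w ^+ I ord0 k / w ^+ J ord0 k)).
rewrite -prodfV -big_split natr_prod -big_split; apply: eq_bigr => k _.
by rewrite cmean_expr ?mxE //; have := s0 k; rewrite mxE.
Qed.

(** Interpolation in all the variables at once; it is close to [F] as soon as
    interpolation in each single variable is. *)
Definition tinterp n N (s : 'rV[R]_n) F (z : 'rV[R[i]]_n) : R[i] :=
  tmean N s (fun x => F x * \prod_k geosum N.+1 (z ord0 k / x ord0 k)).

(** Induction on the number of variables: interpolation in the first variable
    commutes with interpolation in the others and has norm at most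
    [(1 - x)^-1] on the smaller polydisc. *)
Lemma tinterp_close n N (s sg : 'rV[R]_n) (x e : R) (F : 'rV[R[i]]_n -> R[i]) : 0 <= e ->
  vlt 0 s -> 0 <= x -> x < 1 -> (forall k, sg ord0 k <= x * s ord0 k) ->
  (forall k (z : 'rV[R[i]]_n), (forall i, cabs (z ord0 i) <= s ord0 i) -> cabs (z ord0 k) <= sg ord0 k ->
     cabs (F z - interp N (s ord0 k) (fun w => F (upd z k w)) (z ord0 k)) <= e) ->
  forall z : 'rV[R[i]]_n, (forall k, cabs (z ord0 k) <= sg ord0 k) ->
  cabs (F z - tinterp N s F z) <= n%:R * (1 - x)^-1 ^+ n * e.
Proof.
move=> e0; elim: n s sg F => [|n IH] s sg F s0 x0 x1 sgx HF z zsg.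
  by rewrite /tinterp /= big_ord0 mulr1 (thinmx0 z) subrr cabs0 !mul0r.
set W := (1 - x)^-1.
have x1' : 0 < 1 - x by rewrite subr_gt0.
have W1 : 1 <= W by rewrite /W invf_ge1 // lerBlDr lerDl.
have W0 : 0 <= W by apply: le_trans W1.
have s00 := vlt_ord0 s0.
rewrite -(vcons_eta z); set w := z ord0 ord0; set z' := vtail z.
have h1 : cabs (F (vcons w z') - interp N (s ord0 ord0) (fun y => F (vcons y z')) w) <= e.
  have := HF ord0 z; rewrite -(vcons_eta z) -/w -/z' vcons0.
  have -> : (fun y => F (upd (vcons w z') ord0 y)) = (fun y => F (vcons y z')).
    by apply/funext => y; rewrite upd_vcons0.
  apply; last by apply: zsg.
  move=> i; rewrite vcons_eta; apply: le_trans (zsg i) _; apply: le_trans (sgx i) _.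
  rewrite -[leRHS]mul1r ler_wpM2r //; last exact: ltW.
  by have := s0 i; rewrite mxE => /ltW.
have zx : cabs w <= x * s ord0 ord0 by apply: le_trans (zsg ord0) (sgx ord0).
have h2 : cabs (interp N (s ord0 ord0) (fun y => F (vcons y z')) w - tinterp N s F (vcons w z')) <=
    n%:R * W ^+ n * e * W.
  rewrite /tinterp /= /interp -cmeanB; apply: cabs_cmean_le => [|y hy]; first exact: ltW.
  have -> : tmean N (vtail s) (fun z0 => F (vcons y z0) *
        \prod_k geosum N.+1 (vcons w z' ord0 k / vcons y z0 ord0 k)) =
      geosum N.+1 (w / y) * tinterp N (vtail s) (fun z0 => F (vcons y z0)) z'.
    rewrite /tinterp -tmeanZ; congr tmean; apply/funext => z0.
    rewrite big_ord_recl !vcons0 mulrCA; do 2 congr (_ * _).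
    by apply: eq_bigr => k _; rewrite !vconsS.
  rewrite mulrC -mulrBr cabsM mulrC; apply: ler_pM; rewrite ?cabs_ge0 //; last first.
    apply: cabs_geosum_le => //; rewrite cabsM cabsV hy ler_pdivrMr //.
  apply: (IH (vtail s) (vtail sg)) => //.
  - exact: vtail_gt0.
  - by move=> k; rewrite !mxE; exact: sgx.
  - move=> k z0 hz0 hk; have := HF (lift ord0 k) (vcons y z0).
    rewrite vconsS.
    have -> : (fun w0 => F (upd (vcons y z0) (lift ord0 k) w0)) = (fun w0 => F (vcons y (upd z0 k w0))).
      by apply/funext => w0; rewrite upd_vconsS.
    have -> : vtail s ord0 k = s ord0 (lift ord0 k) by rewrite mxE.
    apply; last by move: hk; rewrite mxE.
    move=> i; case: (unliftP ord0 i) => [j ->|->]; last by rewrite vcons0 hy.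
    by rewrite vconsS; have := hz0 j; rewrite mxE.
  - by move=> k; rewrite !mxE; exact: zsg.
have -> : F (vcons w z') - tinterp N s F (vcons w z') =
   (F (vcons w z') - interp N (s ord0 ord0) (fun y => F (vcons y z')) w) +
   (interp N (s ord0 ord0) (fun y => F (vcons y z')) w - tinterp N s F (vcons w z')) by ring.
apply: le_trans (cabsD _ _) _; apply: le_trans (lerD h1 h2) _.
rewrite -[n.+1%:R]natr1 mulrDl mul1r mulrDl addrC exprSr.
have -> : n%:R * W ^+ n * e * W = n%:R * (W ^+ n * W) * e by ring.
by rewrite lerD2l -exprSr -[leLHS]mul1r ler_wpM2r // exprn_ege1.
Qed.

Definition mind n N (I : {ffun 'I_n -> 'I_N}) : mindex n := \row_k (I k : nat).

Lemma tinterp_poly n N (s : 'rV[R]_n) F (z : 'rV[R[i]]_n) :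
  tinterp N s F z = \sum_(I : {ffun 'I_n -> 'I_N.+1})
     tmean N s (fun x => F x / mpow x (mind I)) * mpow z (mind I).
Proof.
rewrite /tinterp /geosum.
transitivity (tmean N s (fun x => \sum_(I : {ffun 'I_n -> 'I_N.+1})
   mpow z (mind I) * (F x / mpow x (mind I)))).
  congr tmean; apply/funext => x; rewrite bigA_distr_bigA /= mulr_sumr.
  apply: eq_bigr => I _; rewrite mulrCA; congr (_ * _).
  rewrite /mpow -prodfV -big_split; apply: eq_bigr => k _ /=.
  by rewrite !mxE expr_div_n.
by rewrite tmean_sum; apply: eq_bigr => I _; rewrite tmeanZ mulrC.
Qed.

End TorusMean.

(** * Unconditional sums *)

#[local] Existing Instance summability.totally_filter.

Section UnconditionalSums.
Variables (R : realType) (I : choiceType).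
Implicit Types (u v : I -> R[i]) (g : I -> R) (A B : {fset I}).

(** Unconditional summability to [l], with uniqueness of [l] as a lemma
    ([hsum_unique]) instead of a choice. *)
Definition hsum u (l : R[i]) := partial_sum u @ totally --> l.

(** For nonnegative families, bounded partial sums amount to summability. *)
Definition summ g := exists M : R, forall A, \sum_(i <- A) g i <= M.

Lemma partial_sumE (V : zmodType) (u : I -> V) A : partial_sum u A = \sum_(i <- A) u i.
Proof. by rewrite /partial_sum big_seq_fsetE. Qed.

Lemma fset_sumD (V : zmodType) (u : I -> V) A B : (A `<=` B)%fset ->
  \sum_(i <- B) u i = \sum_(i <- A) u i + \sum_(i <- (B `\` A)%fset) u i.
Proof.
move=> AB; rewrite (big_fsetID _ (fun i => i \in A) B) /=; congr (_ + _).
  congr (\sum_(i <- enum_fset _) _); apply/fsetP => i; rewrite !inE /=.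
  by case: (boolP (i \in A)) => iA; rewrite ?andbF // (fsubsetP AB).
by congr (\sum_(i <- enum_fset _) _); apply/fsetP => i; rewrite !inE /= andbC.
Qed.

Lemma fset_sum_disjointU (V : zmodType) (u : I -> V) A B : [disjoint A & B]%fset ->
  \sum_(i <- (A `|` B)%fset) u i = \sum_(i <- A) u i + \sum_(i <- B) u i.
Proof.
move=> dAB; rewrite (fset_sumD u (fsubsetUl A B)); congr (_ + _).
congr (\sum_(i <- enum_fset _) _); apply/fsetP => i; rewrite !inE.
by case: (boolP (i \in A)) => //= iA; apply/esym/negbTE/(fdisjointP dAB).
Qed.

Lemma nearT_superset (Q : {fset I} -> Prop) A : (forall B, (A `<=` B)%fset -> Q B) ->
  \forall B \near totally, Q B.
Proof. by move=> H; exists A => // B /= AB; exact: H. Qed.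

Lemma nearTE (Q : {fset I} -> Prop) : (\forall B \near totally, Q B) ->
  exists A, forall B, (A `<=` B)%fset -> Q B.
Proof. by move=> [A _ H]; exists A => B AB; exact: H. Qed.

Lemma summ_le g h : (forall i, g i <= h i) -> summ h -> summ g.
Proof.
by move=> gh [M HM]; exists M => A; apply: le_trans (HM A); apply: ler_sum.
Qed.

Lemma summZ g (k : R) : 0 <= k -> summ g -> summ (fun i => k * g i).
Proof.
by move=> k0 [M HM]; exists (k * M) => A; rewrite -mulr_sumr ler_wpM2l.
Qed.

(** A partial sum close to the supremum leaves little for the remaining
    indices. *)
Lemma summ_tail g e : (forall i, 0 <= g i) -> summ g -> 0 < e ->
  exists A, forall B, [disjoint A & B]%fset -> \sum_(i <- B) g i <= e.
Proof.
move=> g0 [M HM] e0.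
pose E := range (fun A => \sum_(i <- A) g i).
have supE : has_sup E.
  by split; [exists (\sum_(i <- fset0) g i); exists fset0|exists M => _ [A _ <-]].
have [_ [A _ <-] HA] := sup_adherent e0 supE.
exists A => B dAB.
have : \sum_(i <- (A `|` B)%fset) g i <= sup E.
  by apply: ub_le_sup; [exact: (proj2 supE)|exists (A `|` B)%fset].
by rewrite fset_sum_disjointU //; move: HA; lra.
Qed.

Lemma esum_fin (g : I -> R) : (forall i, 0 <= g i) -> summ g ->
  (\esum_(i in setT) (g i)%:E < +oo)%E.
Proof.
move=> g0 [M HM]; apply: (@le_lt_trans _ _ M%:E); last exact: ltry.
apply: ge_ereal_sup => _ [F [finF _] <-].
by rewrite fsbig_finite // sumEFin lee_fin.
Qed.

Lemma hsum_exists u g : (forall i, cabs (u i) <= g i) -> summ g ->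
  exists l, hsum u l.
Proof.
move=> ug sg.
have g0 i : 0 <= g i by apply: le_trans (cabs_ge0 _) (ug i).
have real_case (w : I -> R) : (forall i, `|w i| <= g i) ->
    exists l : R, (fun A => \sum_(i <- A) w i) @ totally --> l.
  move=> wg.
  apply/cvg_ex.
  apply: cauchy_cvg; apply/cauchyP => e e0.
  have e2 : 0 < e / 2 by rewrite divr_gt0.
  have [A HA] := summ_tail g0 sg e2.
  exists (\sum_(i <- A) w i); apply: (nearT_superset (A := A)) => B AB.
  rewrite /ball /= (fset_sumD w AB) opprD addrA subrr sub0r normrN.
  apply: (@le_lt_trans _ _ (\sum_(i <- (B `\` A)%fset) g i)).
    by apply: le_trans (ler_norm_sum _ _ _) _; apply: ler_sum.
  apply: (@le_lt_trans _ _ (e / 2)); last lra.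
  by apply: HA; rewrite fdisjoint_sym; apply/fdisjointP => i; rewrite inE => /andP[].
have [a Ha] := real_case (fun i => complex.Re (u i)) (fun i => le_trans (Re_le_cabs _) (ug i)).
have [b Hb] := real_case (fun i => complex.Im (u i)) (fun i => le_trans (Im_le_cabs _) (ug i)).
exists (Complex a b); rewrite /hsum.
rewrite (_ : partial_sum u = fun A => Complex (\sum_(i <- A) complex.Re (u i)) (\sum_(i <- A) complex.Im (u i))).
  exact: cvg_Complex.
apply/funext => A; rewrite partial_sumE.
elim/big_rec3: _ => // i x y z _ ->.
by apply: complex_ext; rewrite ?(ReD, ImD).
Qed.

Lemma hsum_unique u l l' : hsum u l -> hsum u l' -> l = l'.
Proof. by move=> h h'; apply: (cvg_unique _ h h'); exact: norm_hausdorff. Qed.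

Lemma hsum_sum u l : hsum u l -> summability.sum u = l.
Proof. by move=> h; apply: cvg_lim => //; exact: norm_hausdorff. Qed.

Lemma hsum_tail u l g e A : hsum u l -> (forall i, cabs (u i) <= g i) ->
  (forall B, [disjoint A & B]%fset -> \sum_(i <- B) g i <= e) ->
  cabs (l - \sum_(i <- A) u i) <= e.
Proof.
move=> h ug HA.
have h' : (fun B => partial_sum u B - \sum_(i <- A) u i) @ totally --> l - \sum_(i <- A) u i.
  by apply: cvgB; [exact: h|exact: cvg_cst].
apply: (cvg_cabs_lim_le h'); apply: (nearT_superset (A := A)) => B AB.
rewrite partial_sumE (fset_sumD u AB) addrAC subrr add0r.
apply: le_trans (cabs_sum _ _ _) _; apply: (@le_trans _ _ (\sum_(i <- (B `\` A)%fset) g i)).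
  exact: ler_sum.
by apply: HA; rewrite fdisjoint_sym; apply/fdisjointP => i; rewrite inE => /andP[].
Qed.

Lemma hsum_ext u v l : hsum u l -> u =1 v -> hsum v l.
Proof. by move=> h /funext <-. Qed.

Lemma hsumD u v l l' : hsum u l -> hsum v l' -> hsum (fun i => u i + v i) (l + l').
Proof.
move=> h h'; rewrite /hsum.
rewrite (_ : partial_sum _ = fun A => partial_sum u A + partial_sum v A).
  by apply: cvgD; [exact: h|exact: h'].
by apply/funext => A; rewrite !partial_sumE big_split.
Qed.

Lemma hsumZ u l k : hsum u l -> hsum (fun i => k * u i) (k * l).
Proof.
move=> h; rewrite /hsum.
rewrite (_ : partial_sum _ = fun A => k * partial_sum u A).
  by apply: cvgM; [exact: cvg_cst|exact: h].
by apply/funext => A; rewrite !partial_sumE mulr_sumr.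
Qed.

Lemma hsum0 : hsum (fun=> 0) 0.
Proof.
rewrite /hsum (_ : partial_sum _ = fun=> 0); first exact: cvg_cst.
by apply/funext => A; rewrite partial_sumE big1.
Qed.

Lemma hsum_finite_sum (J : Type) (s : seq J) (u : J -> I -> R[i]) (l : J -> R[i]) :
  (forall j, hsum (u j) (l j)) -> hsum (fun i => \sum_(j <- s) u j i) (\sum_(j <- s) l j).
Proof.
move=> H; elim: s => [|j s IH].
  rewrite big_nil; apply: hsum_ext hsum0 _ => i; by rewrite big_nil.
rewrite big_cons; apply: hsum_ext (hsumD (H j) IH) _ => i; by rewrite big_cons.
Qed.

Lemma hsum_fset A u : (forall i, i \notin A -> u i = 0) -> hsum u (\sum_(i <- A) u i).
Proof.
move=> H; apply: cvg_near_cst; apply: (nearT_superset (A := A)) => B AB.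
by rewrite partial_sumE; apply/esym/big_fset_incl => // i _ /H.
Qed.

(** Dominated convergence for sums, along an arbitrary filter (Tannery). *)
Lemma tannery (T : Type) (F : set_system T) {FF : ProperFilter F}
    (u : T -> I -> R[i]) (v : I -> R[i]) (a : T -> R[i]) (l : R[i]) g :
  (\forall t \near F, forall i, cabs (u t i) <= g i) -> summ g ->
  (forall i, u t i @[t --> F] --> v i) ->
  (\forall t \near F, hsum (u t) (a t)) -> hsum v l -> a @ F --> l.
Proof.
move=> ug sg uv ha hl.
have vg i : cabs (v i) <= g i.
  by apply: (cvg_cabs_lim_le (uv i)); apply: filterS ug => t.
have g0 i : 0 <= g i by apply: le_trans (cabs_ge0 _) (vg i).
apply/cvg_cabsP => e e0.
have e4 : 0 < e / 4 by rewrite divr_gt0.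
have [A HA] := summ_tail g0 sg e4.
have uA : (\sum_(i <- A) u t i) @[t --> F] --> \sum_(i <- A) v i.
  elim: (enum_fset A) => [|i s IH].
    rewrite big_nil (_ : (fun t => _) = fun=> 0); first exact: cvg_cst.
    by apply/funext => t; rewrite big_nil.
  rewrite big_cons (_ : (fun t => _) = fun t => u t i + \sum_(j <- s) u t j).
    by apply: cvgD; [exact: uv|exact: IH].
  by apply/funext => t; rewrite big_cons.
have h4 := hsum_tail hl vg HA.
move/cvg_cabsP/(_ _ e4): uA => uA.
near=> t.
have h1 : forall i, cabs (u t i) <= g i by near: t.
have h2 : hsum (u t) (a t) by near: t.
have h3 : cabs (\sum_(i <- A) u t i - \sum_(i <- A) v i) < e / 4 by near: t.
have h5 := hsum_tail h2 h1 HA.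
have -> : a t - l = (a t - \sum_(i <- A) u t i) + (\sum_(i <- A) u t i - \sum_(i <- A) v i)
   - (l - \sum_(i <- A) v i) by ring.
apply: le_lt_trans (cabsB _ _) _; apply: le_lt_trans (lerD (cabsD _ _) (lexx _)) _.
lra.
Unshelve. all: by end_near.
Qed.

(** Variant in which the limit of the sums is known and the limit series is
    shown to have it as its sum. *)
Lemma tannery_exists (T : Type) (F : set_system T) {FF : ProperFilter F}
    (u : T -> I -> R[i]) (v : I -> R[i]) (a : T -> R[i]) (l : R[i]) g :
  (\forall t \near F, forall i, cabs (u t i) <= g i) -> summ g ->
  (forall i, u t i @[t --> F] --> v i) ->
  (\forall t \near F, hsum (u t) (a t)) -> a @ F --> l -> hsum v l.
Proof.
move=> ug sg uv ha al.
have vg i : cabs (v i) <= g i.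
  by apply: (cvg_cabs_lim_le (uv i)); apply: filterS ug => t.
have [l' hl'] := hsum_exists vg sg.
have al' := tannery ug sg uv ha hl'.
by rewrite (cvg_unique (@norm_hausdorff _ _) al (al' FF)).
Qed.

Lemma hsum_le u l g (M : R) : hsum u l -> (forall i, cabs (u i) <= g i) ->
  (forall A, \sum_(i <- A) g i <= M) -> cabs l <= M.
Proof.
move=> h ug HM; apply: (cvg_cabs_lim_le h); apply: nearW => A.
rewrite partial_sumE; apply: le_trans (cabs_sum _ _ _) _.
by apply: le_trans (HM A); apply: ler_sum.
Qed.

End UnconditionalSums.

Section SumsInjection.
Variables (R : realType) (I J : choiceType) (phi : J -> I).
Hypothesis phi_inj : injective phi.

(** A finite set of indices and its preimage under [phi] have the same partial
    sums, since the terms outside the image vanish; hence the two directed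
    limits agree. *)
Lemma hsum_inj (u : I -> R[i]) l :
  (forall i, (forall j, i <> phi j) -> u i = 0) ->
  hsum (u \o phi) l <-> hsum u l.
Proof.
move=> u0.
have key (B : {fset J}) (A : {fset I}) : ([fset phi j | j in B] `<=` A)%fset ->
    (forall j, phi j \in A -> j \in B) ->
    \sum_(i <- A) u i = \sum_(j <- B) u (phi j).
  move=> BA AB; transitivity (\sum_(i <- [fset phi j | j in B]%fset) u i); last first.
    by rewrite big_imfset //= => x y _ _ /phi_inj.
  apply/esym/big_fset_incl => // i iA iB; apply: u0 => j ij; subst i.
  by move/negP: iB; apply; apply/imfsetP; exists j => //; exact: AB.
have pre (A : {fset I}) : exists B : {fset J}, forall j, (j \in B) = (phi j \in A).
  suff H (s : seq I) : exists B : {fset J}, forall j, (j \in B) = (phi j \in s) by exact: (H A).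
  elim: s => [|i s [B HB]]; first by exists fset0 => j; rewrite !inE.
  have [[j ij]|ni] := pselect (exists j, i = phi j).
    exists (j |` B)%fset => j'; rewrite !inE HB; congr (_ || _).
    by rewrite ij (inj_eq phi_inj).
  exists B => j; rewrite !inE HB; case: eqP => // ij.
  by case: ni; exists j.
split => h.
- apply/cvg_cabsP => e e0; move/cvg_cabsP/(_ e e0)/nearTE: h => [B0 HB0].
  apply: (nearT_superset (A := [fset phi j | j in B0]%fset)) => A BA.
  have [B HB] := pre A.
  have -> : partial_sum u A = \sum_(j <- (B `|` B0)%fset) u (phi j).
    rewrite partial_sumE; apply: key.
      apply/fsubsetP => i /imfsetP[j /= ]; rewrite inE => /orP[jB|jB] ->; first by rewrite -HB.
      by apply: (fsubsetP BA); apply/imfsetP; exists j.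
    by move=> j; rewrite !inE -HB => ->.
  by rewrite -partial_sumE; apply: HB0; exact: fsubsetUr.
- apply/cvg_cabsP => e e0; move/cvg_cabsP/(_ e e0)/nearTE: h => [A0 HA0].
  have [B0 HB0] := pre A0.
  apply: (nearT_superset (A := B0)) => B BB.
  have -> : partial_sum (u \o phi) B = \sum_(i <- (A0 `|` [fset phi j | j in B])%fset) u i.
    rewrite partial_sumE; apply/esym/key; first exact: fsubsetUr.
    move=> j; rewrite !inE -HB0 => /orP[/(fsubsetP BB) //|/imfsetP[j' /= j'B /phi_inj ->] //].
  by rewrite -partial_sumE; apply: HA0; exact: fsubsetUl.
Qed.

Lemma summ_inj (g : I -> R) : (forall i, 0 <= g i) -> summ g -> summ (g \o phi).
Proof.
move=> g0 [M HM]; exists M => A; apply: le_trans (HM [fset phi j | j in A]%fset).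
by rewrite big_imfset //= => x y _ _ /phi_inj.
Qed.

End SumsInjection.

(** * Coefficients of power series as torus means *)

Section GeometricSums.
Variable R : realType.

Lemma mpow0 (K : comNzRingType) n (z : 'rV[K]_n) : mpow z 0 = 1.
Proof. by rewrite /mpow big1 // => k _; rewrite mxE expr0. Qed.

Lemma mpowD (K : comNzRingType) n (z : 'rV[K]_n) I J : mpow z (I + J) = mpow z I * mpow z J.
Proof. by rewrite /mpow -big_split; apply: eq_bigr => k _; rewrite mxE exprD. Qed.

Lemma mpow_gt0 n (s : 'rV[R]_n) I : vlt 0 s -> 0 < mpow s I.
Proof.
by move=> s0; apply: prodr_gt0 => k _; rewrite exprn_gt0 //; have := s0 k; rewrite mxE.
Qed.

Lemma mpow_ge0 n (s : 'rV[R]_n) I : vle 0 s -> 0 <= mpow s I.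
Proof.
by move=> s0; apply: prodr_ge0 => k _; rewrite exprn_ge0 //; have := s0 k; rewrite mxE.
Qed.

Lemma cabs_mpow n (z : 'rV[R[i]]_n) I : cabs (mpow z I) = mpow (vabs z) I.
Proof. by rewrite cabs_prod; apply: eq_bigr => k _; rewrite cabsX mxE. Qed.

Lemma vltW n (s t : 'rV[R]_n) : vlt s t -> vle s t.
Proof. by move=> st k; rewrite ltW. Qed.

Lemma cabs_mpow_torus n (s : 'rV[R]_n) z I : on_torus s z -> cabs (mpow z I) = mpow s I.
Proof. by move=> h; rewrite cabs_mpow; apply: eq_bigr => k _; rewrite mxE h. Qed.

Lemma mpow_quot n (s t : 'rV[R]_n) I :
  mpow (\row_k (s ord0 k / t ord0 k)) I = mpow s I / mpow t I.
Proof.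
rewrite /mpow -prodfV -big_split; apply: eq_bigr => k _ /=.
by rewrite mxE expr_div_n.
Qed.

(** A finite set of multiindices lies in a box, over which the sum is a product
    of geometric sums. *)
Lemma summ_mpow n (q : 'rV[R]_n) : vle 0 q -> (forall k, q ord0 k < 1) ->
  forall A : {fset mindex n}, \sum_(I <- A) mpow q I <= \prod_k (1 - q ord0 k)^-1.
Proof.
move=> q0 q1 A.
pose N := \max_(I <- enum_fset A) \max_k (I ord0 k : nat).
have HN I k : I \in A -> (I ord0 k <= N)%N.
  move=> IA; apply: (@leq_trans (\max_k' (I ord0 k' : nat))%N).
    exact: (leq_bigmax (F := fun k => I ord0 k)).
  exact: (leq_bigmax_seq (F := fun I : mindex n => (\max_k (I ord0 k : nat))%N)).
pose f (I : mindex n) : {ffun 'I_n -> 'I_N.+1} := [ffun k => inord (I ord0 k)].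
have fK I : I \in A -> mind (f I) = I.
  by move=> IA; apply/rowP => k; rewrite mxE ffunE inordK // ltnS HN.
have -> : \sum_(I <- A) mpow q I = \sum_(J <- map f (enum_fset A)) mpow q (mind J).
  rewrite big_map big_seq [RHS]big_seq; apply: eq_bigr => I IA; by rewrite fK.
have uf : uniq (map f (enum_fset A)).
  rewrite map_inj_in_uniq ?fset_uniq // => I J IA JA /(congr1 (@mind n N.+1)).
  by rewrite !fK.
rewrite big_uniq //=.
apply: (@le_trans _ _ (\sum_(J : {ffun 'I_n -> 'I_N.+1}) mpow q (mind J))).
  rewrite [leRHS](bigID (mem (map f (enum_fset A)))) /= lerDl.
  by apply: sumr_ge0 => J _; exact: mpow_ge0.
have -> : \sum_(J : {ffun 'I_n -> 'I_N.+1}) mpow q (mind J) = \prod_k \sum_(j < N.+1) q ord0 k ^+ j.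
  rewrite bigA_distr_bigA; apply: eq_bigr => J _; apply: eq_bigr => k _; by rewrite mxE.
apply: ler_prod => k _; have := q0 k; rewrite mxE => qk.
rewrite sumr_ge0 /=; last by move=> j _; rewrite exprn_ge0.
exact: geom_sum_le.
Qed.

Lemma summ_mpowW n (q : 'rV[R]_n) : vle 0 q -> (forall k, q ord0 k < 1) ->
  summ (fun I : mindex n => mpow q I).
Proof. by move=> q0 q1; exists (\prod_k (1 - q ord0 k)^-1); exact: summ_mpow. Qed.

Lemma hsum_fin (T : finType) (u : T -> R[i]) : hsum u (\sum_i u i).
Proof.
apply: cvg_near_cst; apply: (nearT_superset (A := [fset x in enum T]%fset)) => B AB.
rewrite partial_sumE big_uniq ?fset_uniq //=; apply: eq_bigl => i.
by rewrite (fsubsetP AB) // !inE mem_enum.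
Qed.

Lemma hsum_cmean (J : choiceType) N (s : R) (u : R[i] -> J -> R[i]) H : 0 <= s ->
  (forall z, cabs z = s -> hsum (u z) (H z)) ->
  hsum (fun j => cmean N s (fun z => u z j)) (cmean N s H).
Proof.
move=> s0 h; apply: hsumZ; apply: hsum_finite_sum => m; apply: h; exact: cabs_node.
Qed.

Lemma hsum_tmean (J : choiceType) n N (s : 'rV[R]_n) (u : 'rV[R[i]]_n -> J -> R[i]) H :
  vle 0 s -> (forall z, on_torus s z -> hsum (u z) (H z)) ->
  hsum (fun j => tmean N s (fun z => u z j)) (tmean N s H).
Proof.
elim: n s u H => [|n IH] s u H s0 h /=; first by apply: h => -[].
apply: (hsum_cmean (u := fun w j => tmean N (vtail s) (fun z => u (vcons w z) j))) => [|w hw].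
  exact: vle_ord0.
apply: (IH _ (fun z => u (vcons w z))) => [|z hz]; first exact: vtail_ge0.
by apply: h; exact: on_torus_vcons.
Qed.

(** Aliasing: sampling at [N.+1] points per variable only confuses exponents
    that agree modulo [N.+1], so the torus means of [F z / z^I] converge to
    the [I]-th coefficient of [F]. *)
Lemma coef_tmean n (s : 'rV[R]_n) (c : mindex n -> R[i]) F (I : mindex n) : vlt 0 s ->
  summ (fun J => cabs (c J) * mpow s J) ->
  (forall z, on_torus s z -> hsum (fun J => c J * mpow z J) (F z)) ->
  tmean N s (fun z => F z / mpow z I) @[N --> \oo] --> c I.
Proof.
move=> s0 sc hF.
pose d (N : nat) (J : mindex n) : R[i] := (\prod_k (J ord0 k == I ord0 k %[mod N.+1]))%:R.
pose al J := mpow (cvec s) J / mpow (cvec s) I.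
pose u N J := c J * al J * d N J.
have cs J : cabs (mpow (cvec s) J) = mpow s J.
  apply: cabs_mpow_torus => k; rewrite mxE cabs_real ger0_norm //.
  by have := s0 k; rewrite mxE => /ltW.
have sI := mpow_gt0 I s0.
have hu N : hsum (u N) (tmean N s (fun z => F z / mpow z I)).
  have := hsum_tmean (s := s) (u := fun z J => c J * mpow z J / mpow z I)
      (H := fun z => F z / mpow z I) (N := N) (vltW s0).
  move=> H; apply: hsum_ext.
    apply: H => z hz; have h := hsumZ (k := (mpow z I)^-1) (hF z hz).
    rewrite [F z / _]mulrC; apply: (hsum_ext h) => J /=; by rewrite mulrC.
  move=> J; rewrite /u /al -mulrA -tmean_mpow // -tmeanZ.
  by congr tmean; apply/funext => z; rewrite mulrA.
pose v J := if J == I then c I else 0.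
have hv : hsum v (c I).
  have := @hsum_fset R (mindex n) [fset I]%fset v.
  rewrite big_seq_fset1 /v eqxx; apply => J; by rewrite inE => /negbTE ->.
have hg : summ (fun J => (mpow s I)^-1 * (cabs (c J) * mpow s J)).
  by apply: summZ => //; rewrite invr_ge0 ltW.
apply: (tannery (u := u) (v := v) _ hg _ _ hv).
- apply: nearW => N J; rewrite /u /al !cabsM cabsV !cs.
  have d1 : cabs (d N J) <= 1.
    rewrite cabs_nat (ler_nat _ _ 1); apply: (big_ind (fun m : nat => (m <= 1)%N)) => //; last by move=> k _; exact: leq_b1.
    by move=> x y x1 y1; rewrite -[1%N]muln1; apply: leq_mul.
  rewrite mulrA mulrC [(mpow s I)^-1 * _]mulrC -[leRHS]mul1r ler_wpM2r //.
  by rewrite !mulr_ge0 ?cabs_ge0 ?invr_ge0 ?(ltW sI) // ltW // mpow_gt0.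
- move=> J; rewrite /v; case: eqP => [->|/eqP JI].
    rewrite (_ : (fun t => _) = fun=> c I); first exact: cvg_cst.
    apply/funext => N; rewrite /u /al /d big1 ?mulr1; last by move=> k _; rewrite eqxx.
    by rewrite divff ?mulr1 // -cabs_eq0 cs gt_eqF.
  apply: cvg_near_cst.
  have [k Jk] : exists k, J ord0 k != I ord0 k.
    apply/existsP; move: JI; apply: contraNT; rewrite negb_exists => /forallP H.
    by apply/eqP/rowP => k; apply/eqP; have := H k; rewrite negbK.
  near=> N; rewrite /u /d (bigD1 k) //=.
  have h1 : (J ord0 k <= N)%N by near: N; exact: nbhs_infty_ge.
  have h2 : (I ord0 k <= N)%N by near: N; exact: nbhs_infty_ge.
  by rewrite !modn_small ?ltnS // (negbTE Jk) mul0n mulr0.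
- apply: nearW => N; exact: hu.
Unshelve. all: by end_near.
Qed.

Lemma coef_cauchy n (s : 'rV[R]_n) (c : mindex n -> R[i]) F (I : mindex n) (B : R) : vlt 0 s ->
  summ (fun J => cabs (c J) * mpow s J) ->
  (forall z, on_torus s z -> hsum (fun J => c J * mpow z J) (F z)) ->
  (forall z, on_torus s z -> cabs (F z) <= B) ->
  cabs (c I) <= B / mpow s I.
Proof.
move=> s0 sc hF HB; apply: (cvg_cabs_lim_le (coef_tmean (I := I) s0 sc hF)).
apply: nearW => N; apply: cabs_tmean_le => [|z hz]; first exact: vltW.
by rewrite cabsM cabsV (cabs_mpow_torus _ hz) ler_wpM2r ?HB // invr_ge0 ltW // mpow_gt0.
Qed.

Lemma ultra_fmap (T V : Type) (U : set_system T) (UU : UltraFilter U) (w : T -> V) :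
  UltraFilter (w @ U).
Proof.
split; first exact: fmap_proper_filter.
move=> G PG UG; apply/seteqP; split => A GA; last exact: UG.
have [//|UnA] := in_ultra_setVsetC (w @^-1` A) UU.
have GnA : G (~` A) by apply: UG.
by have [x [/= ? ?]] := filter_ex (filterI GA GnA).
Qed.

(** Bounded families converge along an ultrafilter by compactness; this avoids
    extracting subsequences. *)
Lemma ultra_cvg (T : Type) (U : set_system T) (UU : UltraFilter U) (u : T -> R[i]) (b : R) :
  (\forall t \near U, cabs (u t) <= b) -> exists l : R[i], u @ U --> l.
Proof.
move=> ub.
have real_case (w : T -> R) : (\forall t \near U, `|w t| <= b) -> exists l : R, w @ U --> l.
  move=> wb; have := @segment_compact R (- b) b; rewrite compact_ultra.
  move=> /(_ (w @ U)) []; first exact: ultra_fmap.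
    by apply: filterS wb => t /=; rewrite in_itv /= -ler_norml.
  by move=> l [_ hl]; exists l.
have [x hx] : exists l : R, (fun t => complex.Re (u t)) @ U --> l.
  by apply: real_case; apply: filterS ub => t; apply: le_trans (Re_le_cabs _).
have [y hy] : exists l : R, (fun t => complex.Im (u t)) @ U --> l.
  by apply: real_case; apply: filterS ub => t; apply: le_trans (Im_le_cabs _).
exists (Complex x y); rewrite (_ : u = fun N => Complex (complex.Re (u N)) (complex.Im (u N))).
  exact: cvg_Complex.
by apply/funext => N; rewrite complex_eta.
Qed.

Lemma closed_polydisc_compact n (s : 'rV[R]_n) :
  compact [set z : 'rV[R[i]]_n | forall k, cabs (z ord0 k) <= s ord0 k].
Proof.
apply: (rV_compact (A := fun k => [set w : R[i] | cabs w <= s ord0 k])) => k.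
rewrite compact_ultra => U UU Us.
have [l hl] := @ultra_cvg _ U UU id (s ord0 k) Us.
exists l; split; last exact: hl.
exact: (cvg_cabs_lim_le hl).
Qed.

Lemma bounded_on_closed_polydisc n (s : 'rV[R]_n) (F : 'rV[R[i]]_n -> R[i]) :
  (forall z : 'rV[R[i]]_n, (forall k, cabs (z ord0 k) <= s ord0 k) -> differentiable F z) ->
  exists2 B : R, 0 <= B & forall z : 'rV[R[i]]_n, (forall k, cabs (z ord0 k) <= s ord0 k) -> cabs (F z) <= B.
Proof.
move=> dF; set A := [set z : 'rV[R[i]]_n | forall k, cabs (z ord0 k) <= s ord0 k].
have cF : {within A, continuous (fun z => cabs (F z))}.
  apply: continuous_in_subspaceT => z; rewrite inE => Az.
  have h : F w @[w --> z] --> F z := differentiable_continuous (dF z Az).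
  exact: (cvg_cabs h).
have := continuous_compact cF (@closed_polydisc_compact n s).
move=> /compact_bounded [M [_ HM]].
exists (`|M| + 1); first by rewrite addr_ge0.
move=> z zs; apply: le_trans (ler_norm _) _; apply: (HM (`|M| + 1)); last by exists z.
by rewrite (le_lt_trans (ler_norm M)) // ltrDl.
Qed.

End GeometricSums.
Arguments hsum_fin {R T} u.

(** * Power series of holomorphic functions of several variables *)

Section PolydiscSeries.
Variable R : realType.

Lemma upd_shift n (z : 'rV[R[i]]_n) k (w h : R[i]) :
  upd z k (h * 1 + w) = h *: delta_mx ord0 k + upd z k w.
Proof.
apply/rowP => i; rewrite !mxE eqxx /=; case: eqP => _; first by [].
by rewrite mulr0 add0r.
Qed.

Lemma derivable_slice n (F : 'rV[R[i]]_n -> R[i]) z k w : differentiable F (upd z k w) ->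
  derivable (fun w => F (upd z k w)) w 1.
Proof.
move=> dF; have := diff_derivable (v := delta_mx ord0 k) dF.
rewrite /derivable.
have -> : (fun h : R[i] => h^-1 *: ((F \o shift (upd z k w)) (h *: delta_mx ord0 k) - F (upd z k w)))
  = (fun h : R[i] => h^-1 *: (((fun w => F (upd z k w)) \o shift w) (h *: 1) - F (upd z k w))).
  by apply/funext => h /=; rewrite [h *: 1]/GRing.scale /= upd_shift.
by [].
Qed.

(** Cauchy's theorem on a single polydisc.  The coefficients of the
    interpolation polynomials are bounded, hence converge along an
    ultrafilter, the polynomials themselves converge to [F], and Tannery's
    theorem identifies the limit series. *)
Lemma polydisc_series_local n (F : 'rV[R[i]]_n -> R[i]) (s s2 : 'rV[R]_n) :
  vlt 0 s -> vlt s s2 ->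
  (forall z : 'rV[R[i]]_n, (forall k, cabs (z ord0 k) < s2 ord0 k) -> differentiable F z) ->
  exists c : mindex n -> R[i], exists2 B : R, (forall I, cabs (c I) <= B / mpow s I) &
    forall z : 'rV[R[i]]_n, (forall k, cabs (z ord0 k) < s ord0 k) ->
      hsum (fun I => c I * mpow z I) (F z).
Proof.
move=> s0 ss2 dF.
have sk0 k : 0 < s ord0 k by have := s0 k; rewrite mxE.
pose s1 : 'rV[R]_n := \row_k ((s ord0 k + s2 ord0 k) / 2).
have ss1 k : s ord0 k < s1 ord0 k by rewrite mxE; have := ss2 k; lra.
have s12 k : s1 ord0 k < s2 ord0 k by rewrite mxE; have := ss2 k; lra.
have dF1 (z : 'rV[R[i]]_n) : (forall k, cabs (z ord0 k) <= s1 ord0 k) -> differentiable F z.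
  by move=> zs; apply: dF => k; apply: le_lt_trans (zs k) (s12 k).
have [B B0 HB] := bounded_on_closed_polydisc dF1.
have FB z : on_torus s z -> cabs (F z) <= B.
  by move=> zs; apply: HB => k; rewrite zs ltW.
have [U [UU Uoo]] := @ultraFilterLemma nat \oo _.
pose cN N (I : mindex n) : R[i] :=
  if [forall k, (I ord0 k < N.+1)%N] then tmean N s (fun x => F x / mpow x I) else 0.
have BsI I : 0 <= B / mpow s I by rewrite divr_ge0 // ltW // mpow_gt0.
have cNB N I : cabs (cN N I) <= B / mpow s I.
  rewrite /cN; case: ifP => _; last by rewrite cabs0.
  apply: cabs_tmean_le => [|z zs]; first exact: vltW.
  by rewrite cabsM cabsV (cabs_mpow_torus _ zs) ler_wpM2r ?FB // invr_ge0 ltW // mpow_gt0.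
have Hex (I : mindex n) : exists l : R[i], cN N I @[N --> U] --> l.
  by apply: (@ultra_cvg R nat U UU (fun N => cN N I) (B / mpow s I)); apply: nearW => N.
have [c Hc] := choice Hex.
exists c; exists B => [I|z zs].
  by apply: (cvg_cabs_lim_le (Hc I)); apply: nearW => N.
pose q : 'rV[R]_n := \row_k (cabs (z ord0 k) / s ord0 k).
have q0 : vle 0 q by move=> k; rewrite !mxE divr_ge0 ?cabs_ge0 // ltW.
have q1 k : q ord0 k < 1 by rewrite mxE ltr_pdivrMr // mul1r.
pose g I := B * mpow q I.
have sg : summ g by apply: summZ => //; exact: summ_mpowW.
have gE I : B / mpow s I * cabs (mpow z I) = g I.
  rewrite cabs_mpow /g mulrAC -mulrA; congr (_ * _); rewrite -mpow_quot.
  by apply: eq_bigr => k _; rewrite !mxE.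
have k1 : \forall N \near U, forall I, cabs (cN N I * mpow z I) <= g I.
  apply: nearW => N I; rewrite cabsM -gE; apply: ler_wpM2r; rewrite ?cabs_ge0 //.
have k2 I : cN N I * mpow z I @[N --> U] --> c I * mpow z I.
  by apply: cvgM; [exact: Hc|exact: cvg_cst].
have k3 : \forall N \near U, hsum (fun I => cN N I * mpow z I) (tinterp N s F z).
  apply: nearW => N.
  have mi : injective (@mind n N.+1).
    move=> I J /rowP h; apply/ffunP => k; apply/val_inj; have := h k; by rewrite !mxE.
  rewrite tinterp_poly; apply/(hsum_inj mi).
    move=> I HI; rewrite /cN; case: ifPn => [/forallP h|_]; last by rewrite mul0r.
    case: (HI [ffun k => Ordinal (h k)]); apply/rowP => k.
    by rewrite mxE ffunE.
  have h := hsum_fin (fun J : {ffun 'I_n -> 'I_N.+1} =>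
    tmean N s (fun x => F x / mpow x (mind J)) * mpow z (mind J)).
  apply: (hsum_ext h) => J /=; rewrite /cN; case: ifPn => // /forallP [].
  by move=> k; rewrite mxE ltn_ord.
have k4 : tinterp N s F z @[N --> U] --> F z.
  suff h : tinterp N s F z @[N --> \oo] --> F z by move=> A /h; exact: Uoo.
  pose x : R := \big[Num.max/0]_k (q ord0 k).
  have x0 : 0 <= x by rewrite /x; apply: bigmax_ge_id.
  have x1 : x < 1 by apply: bigmax_lt.
  have qx k : q ord0 k <= x by exact: le_bigmax.
  pose sg' : 'rV[R]_n := \row_k (x * s ord0 k).
  have sgs k : sg' ord0 k < s ord0 k by rewrite mxE -[ltRHS]mul1r ltr_pM2r.
  have zsg k : cabs (z ord0 k) <= sg' ord0 k.
    by rewrite mxE -ler_pdivrMr //; have := qx k; rewrite mxE.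
  pose err k N := interp_err (s1 ord0 k) (s ord0 k) (sg' ord0 k) N.
  pose e N := \sum_k B * err k N.
  have err0 k N : 0 <= err k N.
    have h1 : 0 < 1 - s ord0 k / s1 ord0 k.
      by rewrite subr_gt0 ltr_pdivrMr ?mul1r // (lt_trans (sk0 k)).
    have h2 : 0 < 1 - sg' ord0 k / s ord0 k by rewrite subr_gt0 ltr_pdivrMr ?mul1r.
    have s1k : 0 < s1 ord0 k by apply: lt_trans (ss1 k).
    have h3 : 0 <= s ord0 k / s1 ord0 k by rewrite divr_ge0 ?(ltW (sk0 k)) ?(ltW s1k).
    apply: mulr_ge0; first by rewrite !mulr_ge0 ?exprn_ge0 ?invr_ge0 ?(ltW h1).
    by rewrite addr_ge0 // invr_ge0 ltW.
  have eB k N : B * err k N <= e N.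
    rewrite /e (bigD1 k) //= lerDl; apply: sumr_ge0 => i _; exact: mulr_ge0.
  have e0 N : 0 <= e N by apply: sumr_ge0 => k _; exact: mulr_ge0.
  apply: (@cvg_cabs_le _ _ _ _ _ _ (fun N => n%:R * (1 - x)^-1 ^+ n * e N)).
    apply: nearW => N; rewrite cabsC.
    apply: (tinterp_close (sg := sg')) => //.
      by move=> k; rewrite mxE.
    move=> k z0 hz0 hk; apply: le_trans (eB k N).
    have -> : F z0 = (fun w => F (upd z0 k w)) (z0 ord0 k).
      congr F; apply/rowP => i; rewrite mxE; by case: eqP => [->|].
    have upd_le w : cabs w <= s1 ord0 k -> forall i, cabs (upd z0 k w ord0 i) <= s1 ord0 i.
      move=> hw i; rewrite mxE; case: eqP => [->//|_]; apply: le_trans (hz0 i) _; exact: ltW.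
    apply: (interp_close (r := s2 ord0 k)) => //.
    - move=> w hw; apply: derivable_slice; apply: dF => i; rewrite mxE.
      by case: eqP => [->//|_]; apply: le_lt_trans (hz0 i) _; apply: lt_trans (ss1 i) _.
    - by move=> w hw; apply: HB; exact: upd_le.
  rewrite -(mulr0 (n%:R * (1 - x)^-1 ^+ n)); apply: cvgM; first exact: cvg_cst.
  have -> : 0 = \sum_(k < n) B * 0 :> R by rewrite big1 // => k _; rewrite mulr0.
  apply: cvg_big => [|k _]; first exact: add_continuous.
  apply: cvgM; first exact: cvg_cst.
  exact: interp_err_cvg.
exact: (tannery_exists k1 sg k2 k3 k4).
Qed.

Lemma radius_between (a : R) (b : \bar R) : (a%:E < b)%E -> exists2 c : R, a < c & (c%:E < b)%E.
Proof.
case: b => [b|_|] //; last by exists (a + 1); rewrite ?ltrDl ?ltry.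
rewrite lte_fin => ab; exists ((a + b) / 2); rewrite ?lte_fin; lra.
Qed.

Lemma vradius_between n (a : 'rV[R]_n) (b : 'rV[\bar R]_n) : vlt (map_mx EFin a) b ->
  exists2 c : 'rV[R]_n, vlt a c & vlt (map_mx EFin c) b.
Proof.
move=> ab.
have Hex k : exists x, a ord0 k < x /\ (x%:E < b ord0 k)%E.
  have := ab k; rewrite mxE => /radius_between [x ? ?]; by exists x.
have [c Hc] := choice Hex.
exists (\row_k c k) => k; rewrite !mxE; by have [] := Hc k.
Qed.

Lemma exists_radius n (rad : 'rV[\bar R]_n) : (forall k, (0 < rad ord0 k)%E) ->
  exists2 s : 'rV[R]_n, vlt 0 s & vlt (map_mx EFin s) rad.
Proof. by move=> r0; apply: vradius_between => k; rewrite !mxE. Qed.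

Lemma polydiscP n (rad : 'rV[\bar R]_n) z :
  polydisc rad z <-> forall k, ((cabs (z ord0 k))%:E < rad ord0 k)%E.
Proof. by split => h k; have := h k; rewrite !mxE. Qed.

(** Absolute convergence is encoded by Cauchy's inequalities for the
    coefficients on every smaller torus. *)
Definition mseries n (rad : 'rV[\bar R]_n) (c : mindex n -> R[i]) (F : 'rV[R[i]]_n -> R[i]) :=
  (forall s, vlt 0 s -> vlt (map_mx EFin s) rad ->
     exists B, forall I, cabs (c I) <= B / mpow s I) /\
  forall z, polydisc rad z -> hsum (fun I => c I * mpow z I) (F z).

Lemma summ_coef n (c : mindex n -> R[i]) (t s : 'rV[R]_n) (B : R) : vle 0 t -> vlt t s ->
  (forall I, cabs (c I) <= B / mpow s I) -> summ (fun I => cabs (c I) * mpow t I).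
Proof.
move=> t0 ts cB.
have s0 k : 0 < s ord0 k by apply: le_lt_trans (ts k); have := t0 k; rewrite mxE.
pose q : 'rV[R]_n := \row_k (t ord0 k / s ord0 k).
apply: (@summ_le _ _ _ (fun I => B * mpow q I)).
  move=> I; rewrite mpow_quot [leRHS](_ : _ = B / mpow s I * mpow t I); last by ring.
  by apply: ler_wpM2r; [exact: mpow_ge0|exact: cB].
have B0 : 0 <= B.
  have := cB 0; rewrite mpow0 divr1; apply: le_trans; exact: cabs_ge0.
apply: summZ => //; apply: summ_mpowW => k; rewrite !mxE.
  by rewrite divr_ge0 ?(ltW (s0 k)) //; have := t0 k; rewrite mxE.
by rewrite ltr_pdivrMr // mul1r ts.
Qed.

(** Each smaller polydisc carries an expansion; the coefficients do not depend
    on it, being torus means of [F] near the origin. *)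
Theorem polydisc_series n (rad : 'rV[\bar R]_n) (F : 'rV[R[i]]_n -> R[i]) :
  (forall k, (0 < rad ord0 k)%E) -> holomorphic_on (polydisc rad) F ->
  exists c, mseries rad c F.
Proof.
move=> rad0 hF.
have loc s : vlt 0 s -> vlt (map_mx EFin s) rad ->
  exists c : mindex n -> R[i], exists2 B : R, (forall I, cabs (c I) <= B / mpow s I) &
    forall z : 'rV[R[i]]_n, (forall k, cabs (z ord0 k) < s ord0 k) ->
      hsum (fun I => c I * mpow z I) (F z).
  move=> s0 srad; have [s2 ss2 s2rad] := vradius_between srad.
  apply: (polydisc_series_local s0 ss2) => z zs2; apply: hF; apply/polydiscP => k.
  by apply: lt_trans (s2rad k); rewrite mxE lte_fin.
have uniq_coef s s' c c' B B' : vlt 0 s -> vlt 0 s' ->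
  (forall I, cabs (c I) <= B / mpow s I) ->
  (forall z : 'rV[R[i]]_n, (forall k, cabs (z ord0 k) < s ord0 k) -> hsum (fun I => c I * mpow z I) (F z)) ->
  (forall I, cabs (c' I) <= B' / mpow s' I) ->
  (forall z : 'rV[R[i]]_n, (forall k, cabs (z ord0 k) < s' ord0 k) -> hsum (fun I => c' I * mpow z I) (F z)) ->
  c =1 c'.
  move=> s0 s'0 cB hc c'B hc' I.
  pose t : 'rV[R]_n := \row_k (Num.min (s ord0 k) (s' ord0 k) / 2).
  have t0 : vlt 0 t.
    move=> k; rewrite !mxE divr_gt0 // lt_min.
    by have := s0 k; have := s'0 k; rewrite !mxE => -> ->.
  have ts : vlt t s.
    move=> k; rewrite mxE; have := s0 k; rewrite mxE; have : Num.min (s ord0 k) (s' ord0 k) <= s ord0 k by rewrite ge_min lexx.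
    lra.
  have ts' : vlt t s'.
    move=> k; rewrite mxE; have := s'0 k; rewrite mxE; have : Num.min (s ord0 k) (s' ord0 k) <= s' ord0 k by rewrite ge_min lexx orbT.
    lra.
  have h1 := coef_tmean (I := I) t0 (summ_coef (vltW t0) ts cB)
    (fun z zt => hc z (fun k => eq_ind_r (fun x => x < s ord0 k) (ts k) (zt k))).
  have h2 := coef_tmean (I := I) t0 (summ_coef (vltW t0) ts' c'B)
    (fun z zt => hc' z (fun k => eq_ind_r (fun x => x < s' ord0 k) (ts' k) (zt k))).
  exact: (cvg_uniqueC h1 h2).
have [s0 s00 s0rad] := exists_radius rad0.
have [c [B cB hc]] := loc s0 s00 s0rad.
exists c; split => [s spos srad|z /polydiscP zrad].
  have [c' [B' cB' hc']] := loc s spos srad.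
  by exists B' => I; rewrite (uniq_coef _ _ _ _ _ _ s00 spos cB hc cB' hc').
have [s spos srad] : exists2 s : 'rV[R]_n, vlt (vabs z) s & vlt (map_mx EFin s) rad.
  by apply: vradius_between => k; rewrite !mxE.
have sp : vlt 0 s.
  by move=> k; apply: le_lt_trans (spos k); rewrite !mxE cabs_ge0.
have [c' [B' cB' hc']] := loc s sp srad.
have zs k : cabs (z ord0 k) < s ord0 k by have := spos k; rewrite mxE.
apply: hsum_ext (hc' z zs) _ => I.
by rewrite (uniq_coef _ _ _ _ _ _ s00 sp cB hc cB' hc').
Qed.

End PolydiscSeries.

(** * Differentiation of power series *)

Section MonomialDerivative.
Variable R : realType.

Definition mone n (k : 'I_n) : mindex n := \row_i (i == k : nat).

Lemma add_moneE n (J : mindex n) k i : (J + mone k) ord0 i = (J ord0 i + (i == k))%N.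
Proof. by rewrite !mxE. Qed.

Lemma add_mindex_inj n (I : mindex n) : injective (fun J : mindex n => J + I).
Proof.
move=> J J' /rowP h; apply/rowP => k; have := h k; rewrite !mxE => /eqP.
by rewrite (eqn_add2r (I ord0 k)) => /eqP.
Qed.

Lemma mpow_mone (K : comNzRingType) n (z : 'rV[K]_n) k : mpow z (mone k) = z ord0 k.
Proof.
rewrite /mpow (bigD1 k) //= mxE eqxx expr1 big1 ?mulr1 // => i ik.
by rewrite mxE (negbTE ik) expr0.
Qed.

Lemma mpow_split (K : comNzRingType) n (z : 'rV[K]_n) k (J : mindex n) :
  mpow z J = z ord0 k ^+ J ord0 k * \prod_(i | i != k) z ord0 i ^+ J ord0 i.
Proof. by rewrite /mpow (bigD1 k). Qed.

(** The difference quotient of the monomial [z^J] in the [k]-th variable. *)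
Definition mquot n (z : 'rV[R[i]]_n) k (h : R[i]) (J : mindex n) : R[i] :=
  (\prod_(i | i != k) z ord0 i ^+ J ord0 i) *
  \sum_(j < J ord0 k) (h + z ord0 k) ^+ (J ord0 k - j.+1) * z ord0 k ^+ j.

Lemma mquotE n (z : 'rV[R[i]]_n) k h (J : mindex n) :
  mpow (h *: delta_mx ord0 k + z) J - mpow z J = h * mquot z k h J.
Proof.
rewrite !(mpow_split _ k) !mxE !eqxx mulr1.
have -> : \prod_(i | i != k) (h *: delta_mx ord0 k + z) ord0 i ^+ J ord0 i =
          \prod_(i | i != k) z ord0 i ^+ J ord0 i.
  by apply: eq_bigr => i ik; rewrite !mxE (negbTE ik) andbF mulr0 add0r.
rewrite -mulrBl subrXX addrK /mquot mulrAC mulrA; congr (_ * _).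
by apply: eq_bigr => j _; rewrite -subn1 -subnDA add1n.
Qed.

Lemma mquot_cvg n (z : 'rV[R[i]]_n) k J :
  mquot z k h J @[h --> (0 : R[i])^'] --> mquot z k 0 J.
Proof.
apply: cvgM; first exact: cvg_cst.
apply: cvg_big => [|j _]; first exact: add_continuous.
apply: cvgM; last exact: cvg_cst.
have H : h + z ord0 k @[h --> (0 : R[i])^'] --> 0 + z ord0 k.
  by apply: cvgD; [exact: nbhs_dnbhs|exact: cvg_cst].
elim: (J ord0 k - j.+1)%N => [|m IH]; first exact: cvg_cst.
rewrite (_ : (fun h => _) = fun h => (h + z ord0 k) * (h + z ord0 k) ^+ m).
  by rewrite exprS; apply: cvgM; [exact: H|exact: IH].
by apply/funext => h; rewrite exprS.
Qed.

Lemma mquot_mone n (z : 'rV[R[i]]_n) k (J : mindex n) :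
  mquot z k 0 (J + mone k) = (J ord0 k).+1%:R * mpow z J.
Proof.
rewrite (mpow_split z k J) /mquot add_moneE eqxx addn1 add0r.
have -> : \prod_(i | i != k) z ord0 i ^+ (J + mone k)%R ord0 i = \prod_(i | i != k) z ord0 i ^+ J ord0 i.
  by apply: eq_bigr => i ik; rewrite add_moneE (negbTE ik) addn0.
rewrite [RHS]mulrA mulrC; congr (_ * _).
rewrite (eq_bigr (fun=> z ord0 k ^+ J ord0 k)); first by rewrite sumr_const card_ord mulr_natl.
by move=> j _; rewrite subSS -exprD subnK // -ltnS.
Qed.

Lemma mquot_eq0 n (z : 'rV[R[i]]_n) k h (J : mindex n) : J ord0 k = 0%N -> mquot z k h J = 0.
Proof. by move=> Jk; rewrite /mquot Jk big_ord0 mulr0. Qed.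

Lemma cabs_mquot_le n (z : 'rV[R[i]]_n) k h (J : mindex n) (s : 'rV[R]_n) : vlt 0 s ->
  (forall i, cabs (z ord0 i) <= s ord0 i) -> cabs (h + z ord0 k) <= s ord0 k ->
  cabs (mquot z k h J) <= (J ord0 k)%:R * mpow s J / s ord0 k.
Proof.
move=> s0 zs hs.
have sk i : 0 < s ord0 i by have := s0 i; rewrite mxE.
rewrite (mpow_split s k) /mquot cabsM cabs_prod.
have h1 : \prod_(i | i != k) cabs (z ord0 i ^+ J ord0 i) <= \prod_(i | i != k) s ord0 i ^+ J ord0 i.
  apply: ler_prod => i _; rewrite cabsX exprn_ge0 ?cabs_ge0 //=.
  by rewrite lerXn2r // ?nnegrE ?cabs_ge0 // ltW.
have h2 : cabs (\sum_(j < J ord0 k) (h + z ord0 k) ^+ (J ord0 k - j.+1) * z ord0 k ^+ j) <=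
    (J ord0 k)%:R * (s ord0 k ^+ J ord0 k / s ord0 k).
  apply: le_trans (cabs_sum _ _ _) _.
  apply: (@le_trans _ _ (\sum_(j < J ord0 k) s ord0 k ^+ J ord0 k / s ord0 k)).
    apply: ler_sum => j _; rewrite cabsM !cabsX.
    have -> : s ord0 k ^+ J ord0 k / s ord0 k = s ord0 k ^+ (J ord0 k - j.+1) * s ord0 k ^+ j.
      have e : J ord0 k = (J ord0 k - j.+1 + j).+1 by rewrite -addnS subnK.
      by apply: (mulIf (lt0r_neq0 (sk k))); rewrite divfK ?gt_eqF // -exprD -exprSr -e.
    apply: ler_pM; rewrite ?exprn_ge0 ?cabs_ge0 //.
      by rewrite lerXn2r // ?nnegrE ?cabs_ge0 // ltW.
    by rewrite lerXn2r // ?nnegrE ?cabs_ge0 // ltW.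
  by rewrite sumr_const card_ord mulr_natl.
rewrite (_ : _ * _ / _ = (\prod_(i | i != k) s ord0 i ^+ J ord0 i) *
   ((J ord0 k)%:R * (s ord0 k ^+ J ord0 k / s ord0 k))); last by ring.
apply: ler_pM => //; last exact: cabs_ge0.
by apply: prodr_ge0 => i _; exact: cabs_ge0.
Qed.

Lemma natr_geom_le (q : R) m : 0 <= q -> q < 1 -> m%:R * q ^+ m <= (1 - q)^-1.
Proof.
move=> q0 q1; apply: (@le_trans _ _ (\sum_(j < m) q ^+ j)).
  apply: (@le_trans _ _ (\sum_(j < m) q ^+ m)).
    by rewrite sumr_const card_ord mulr_natl.
  by apply: ler_sum => j _; rewrite ler_wiXn2l ?(ltW q1) // ltnW.
exact: geom_sum_le.
Qed.

(** Passing to a smaller radius absorbs the factor [J_k] that differentiation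
    brings. *)
Lemma coef_deriv_bound n (c : mindex n -> R[i]) k (s s2 : 'rV[R]_n) (B : R) : vlt 0 s -> vlt s s2 ->
  (forall J, cabs (c J) <= B / mpow s2 J) ->
  exists B', forall J : mindex n, cabs ((J ord0 k)%:R * c J) <= B' / mpow s J.
Proof.
move=> s0 ss2 cB.
have sk i : 0 < s ord0 i by have := s0 i; rewrite mxE.
have s2k i : 0 < s2 ord0 i by apply: lt_trans (ss2 i).
have s20 : vlt 0 s2 by move=> i; rewrite mxE.
have B0 : 0 <= B by have := cB 0; rewrite mpow0 divr1; apply: le_trans; exact: cabs_ge0.
pose q i := s ord0 i / s2 ord0 i.
have q0 i : 0 <= q i by rewrite divr_ge0 // ltW.
have q1 i : q i < 1 by rewrite ltr_pdivrMr // mul1r.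
exists (B * (1 - q k)^-1) => J.
rewrite cabsM cabs_nat ler_pdivlMr ?mpow_gt0 // -mulrA.
apply: (@le_trans _ _ ((J ord0 k)%:R * (B / mpow s2 J * mpow s J))).
  by rewrite ler_wpM2l // ler_wpM2r ?mpow_ge0 //; exact: vltW.
rewrite (_ : _ * _ = B * ((J ord0 k)%:R * (mpow s J / mpow s2 J))); last by ring.
rewrite ler_wpM2l // -mpow_quot (mpow_split _ k) mulrA mxE.
rewrite -[leRHS]mulr1; apply: ler_pM; rewrite ?mulr_ge0 ?exprn_ge0 //.
- exact: (q0 k).
- by apply: prodr_ge0 => i _; rewrite mxE exprn_ge0 ?(q0 i).
- exact: natr_geom_le (q0 k) (q1 k).
- by apply: prodr_ile1 => i _; rewrite mxE exprn_ge0 ?(q0 i) //= exprn_ile1 ?(q0 i) // ltW ?(q1 i).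
Qed.

End MonomialDerivative.

Section PowerSeriesDerivative.
Variable R : realType.

(** Termwise differentiation: the difference quotients of the terms are
    dominated uniformly in the increment, so Tannery's theorem applies. *)
Lemma mseries_partial n (rad : 'rV[\bar R]_n) c F k : mseries rad c F ->
  mseries rad (fun J : mindex n => (J ord0 k).+1%:R * c (J + mone k)) (partial k F).
Proof.
move=> [cB cF].
have dB s : vlt 0 s -> vlt (map_mx EFin s) rad ->
    exists B, forall J : mindex n, cabs ((J ord0 k)%:R * c J) <= B / mpow s J.
  move=> s0 srad; have [s2 ss2 s2rad] := vradius_between srad.
  have s20 : vlt 0 s2 by move=> i; exact: lt_trans (s0 i) (ss2 i).
  have [B HB] := cB s2 s20 s2rad.
  exact: coef_deriv_bound s0 ss2 HB.
split => [s s0 srad|z /polydiscP zrad].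
  have [B HB] := dB s s0 srad; exists (B / s ord0 k) => J.
  have := HB (J + mone k); rewrite add_moneE eqxx addn1 mpowD mpow_mone.
  by rewrite -mulrA -invfM [s ord0 k * _]mulrC.
have [s zs srad] : exists2 s : 'rV[R]_n, vlt (vabs z) s & vlt (map_mx EFin s) rad.
  by apply: vradius_between => i; rewrite !mxE.
have [s2 ss2 s2rad] := vradius_between srad.
have zs' i : cabs (z ord0 i) < s ord0 i by have := zs i; rewrite mxE.
have sk i : 0 < s ord0 i by apply: le_lt_trans (zs' i); exact: cabs_ge0.
have s0 : vlt 0 s by move=> i; rewrite mxE.
have s20 : vlt 0 s2 by move=> i; exact: lt_trans (s0 i) (ss2 i).
have [B HB] := dB s2 s20 s2rad.
pose g (J : mindex n) := (s ord0 k)^-1 * (cabs ((J ord0 k)%:R * c J) * mpow s J).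
have sg : summ g.
  by apply: summZ; [rewrite invr_ge0 ltW|exact: summ_coef (vltW s0) ss2 HB].
pose u (h : R[i]) J := c J * mquot z k h J.
have ug h : cabs (h + z ord0 k) <= s ord0 k -> forall J, cabs (u h J) <= g J.
  move=> hs J; rewrite /u /g cabsM [cabs (_%:R * _)]cabsM cabs_nat.
  rewrite (_ : _^-1 * _ = cabs (c J) * ((J ord0 k)%:R * mpow s J / s ord0 k)); last by ring.
  apply: ler_wpM2l; first exact: cabs_ge0.
  by apply: cabs_mquot_le => // i; exact: ltW.
have near_small : \forall h \near (0 : R[i])^', cabs (h + z ord0 k) < s ord0 k.
  apply: nbhs_dnbhs; have e0 : 0 < s ord0 k - cabs (z ord0 k) by rewrite subr_gt0.
  apply: filterS (near0_cabs e0) => h hh.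
  by apply: le_lt_trans (cabsD _ _) _; lra.
pose Q h := h^-1 *: (F (h *: delta_mx ord0 k + z) - F z).
have hQ : \forall h \near (0 : R[i])^', hsum (u h) (Q h).
  near=> h.
  have h0 : h != 0 by near: h; exact: nbhs_dnbhs_neq.
  have hs : cabs (h + z ord0 k) < s ord0 k by near: h.
  have zh : polydisc rad (h *: delta_mx ord0 k + z).
    apply/polydiscP => i; apply: lt_trans (srad i); rewrite !mxE lte_fin eqxx /=.
    case: eqP => [->|_]; first by rewrite mulr1.
    by rewrite mulr0 add0r.
  have zz : polydisc rad z by apply/polydiscP.
  have H := hsumD (cF _ zh) (hsumZ (k := -1) (cF _ zz)).
  have H2 := hsumZ (k := h^-1) H.
  rewrite /Q /GRing.scale /= -[- F z]mulN1r; apply: (hsum_ext H2) => J.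
  by rewrite /u mulN1r -mulrBr mquotE mulrCA mulKf.
have [l hl] : exists l, hsum (u 0) l.
  by apply: (hsum_exists _ sg); apply: ug; rewrite add0r ltW.
have uQ : forall J, u h J @[h --> (0 : R[i])^'] --> u 0 J.
  by move=> J; apply: cvgM; [exact: cvg_cst|exact: mquot_cvg].
have near_ug : \forall h \near (0 : R[i])^', forall J, cabs (u h J) <= g J.
  by apply: filterS near_small => h /ltW /ug.
have Ql : Q @ (0 : R[i])^' --> l := tannery near_ug sg uQ hQ hl.
have -> : partial k F z = l.
  have H1 : lim (Q @ (0 : R[i])^') = l by apply: cvg_lim; [exact: norm_hausdorff|exact: Ql].
  exact: H1.
have u0 (I : mindex n) : (forall j : mindex n, I <> j + mone k) -> u 0 I = 0.
  move=> HI; rewrite /u mquot_eq0 ?mulr0 //; apply/eqP; apply/negPn/negP => Ik.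
  apply: (HI (\row_i (I ord0 i - (i == k))%N)); apply/rowP => i; rewrite add_moneE mxE.
  by case: eqP => [->|_]; rewrite ?subn0 ?addn0 // subnK // lt0n.
have := (@hsum_inj R _ _ _ (@add_mindex_inj _ (mone k)) (u 0) l u0).2 hl.
move=> H; apply: (hsum_ext H) => J /=.
by rewrite /u mquot_mone mulrCA mulrA.
Unshelve. all: by end_near.
Qed.

(** Exponential generating functions: the coefficients are the derivatives at
    the origin, and differentiation shifts them. *)
Definition egf n (rad : 'rV[\bar R]_n) (a : mindex n -> R[i]) F :=
  mseries rad (fun J => a J / (mfact J)%:R) F.

Lemma mfact_neq0 n (J : mindex n) : (mfact J)%:R != 0 :> R[i].
Proof. by rewrite pnatr_eq0 -lt0n prodn_gt0 // => k; exact: fact_gt0. Qed.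

Lemma mfact_mone n (J : mindex n) k : mfact (J + mone k) = ((J ord0 k).+1 * mfact J)%N.
Proof.
rewrite /mfact (bigD1 k) //= [in RHS](bigD1 k) //= add_moneE eqxx addn1 factS mulnA.
by congr (_ * _)%N; apply: eq_bigr => i ik; rewrite add_moneE (negbTE ik) addn0.
Qed.

Lemma mseries_ext n (rad : 'rV[\bar R]_n) c c' F : mseries rad c F -> c =1 c' -> mseries rad c' F.
Proof. by move=> H /funext <-. Qed.

Lemma egf_ext n (rad : 'rV[\bar R]_n) a a' F : egf rad a F -> a =1 a' -> egf rad a' F.
Proof. by move=> H /funext <-. Qed.

Lemma egf_partial n (rad : 'rV[\bar R]_n) a F k : egf rad a F ->
  egf rad (fun J => a (J + mone k)) (partial k F).
Proof.
move=> /(mseries_partial k) H; apply: (mseries_ext H) => J.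
rewrite mfact_mone natrM; field.
by rewrite mfact_neq0 addrC natr1 pnatr_eq0.
Qed.

Lemma egf_iter_partial n (rad : 'rV[\bar R]_n) a F k m : egf rad a F ->
  egf rad (fun J => a (J + mone k *+ m)) (iter m (partial k) F).
Proof.
move=> H; elim: m => [|m IH] /=.
  by apply: (egf_ext H) => J; rewrite mulr0n addr0.
apply: (egf_ext (egf_partial k IH)) => J.
by rewrite -addrA -mulrS.
Qed.

Lemma mone_sum n (I : mindex n) : \sum_(k <- enum 'I_n) mone k *+ I ord0 k = I.
Proof.
rewrite big_enum /=; apply/rowP => i; rewrite summxE (bigD1 i) //= big1 ?addr0.
  by rewrite mulmxnE mxE eqxx; elim: (I ord0 i) => // m IH; rewrite mulrS IH.
by move=> k ki; rewrite mulmxnE mxE eq_sym (negbTE ki); exact: mul0rn.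
Qed.

Lemma mpartial0 n (F : 'rV[R[i]]_n -> R[i]) : mpartial 0 F = F.
Proof. by rewrite /mpartial; elim: (enum 'I_n) => //= k s ->; rewrite mxE. Qed.

Lemma egf_mpartial n (rad : 'rV[\bar R]_n) a F I : egf rad a F ->
  egf rad (fun J => a (J + I)) (mpartial I F).
Proof.
move=> H; rewrite /mpartial -{1}(mone_sum I).
elim: (enum 'I_n) => [|k s IH] /=.
  by apply: (egf_ext H) => J; rewrite big_nil addr0.
apply: (egf_ext (egf_iter_partial k (I ord0 k) IH)) => J.
by rewrite big_cons addrA.
Qed.

Lemma mpow_0 n (J : mindex n) : mpow (0 : 'rV[R[i]]_n) J = (J == 0)%:R.
Proof.
case: eqP => [->|J0]; first by rewrite mpow0.
have [k Jk] : exists k, J ord0 k != 0%N.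
  apply/existsP; apply: contra_notT J0; rewrite negb_exists => /forallP H.
  by apply/rowP => k; rewrite mxE; apply/eqP; have := H k; rewrite negbK.
by rewrite (mpow_split _ k) mxE expr0n (negbTE Jk) mul0r.
Qed.

Lemma mfact0 n : mfact (0 : mindex n) = 1%N.
Proof. by rewrite /mfact big1 // => k _; rewrite mxE. Qed.

Lemma polydisc0 n (rad : 'rV[\bar R]_n) : (forall k, (0 < rad ord0 k)%E) -> polydisc rad 0.
Proof. by move=> r0; apply/polydiscP => k; rewrite mxE cabs0. Qed.

Lemma egf_at0 n (rad : 'rV[\bar R]_n) a F : (forall k, (0 < rad ord0 k)%E) -> egf rad a F -> F 0 = a 0.
Proof.
move=> r0 [_ H]; have h := H 0 (polydisc0 r0); apply: (hsum_unique h).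
have := @hsum_fset R (mindex n) [fset (0 : mindex n)]%fset (fun J => a J / (mfact J)%:R * mpow 0 J).
rewrite big_seq_fset1 mpow_0 eqxx mfact0 divr1 mulr1; apply => J.
by rewrite inE => /negbTE J0; rewrite mpow_0 J0 mulr0.
Qed.

Lemma egf_coef n (rad : 'rV[\bar R]_n) a F I : (forall k, (0 < rad ord0 k)%E) -> egf rad a F ->
  mpartial I F 0 = a I.
Proof. by move=> r0 /(egf_mpartial I) /(egf_at0 r0) ->; rewrite add0r. Qed.

(** Taylor's theorem: termwise differentiation identifies the coefficients of
    the expansion. *)
Lemma holomorphic_egf n (rad : 'rV[\bar R]_n) F : (forall k, (0 < rad ord0 k)%E) ->
  holomorphic_on (polydisc rad) F -> egf rad (fun I => mpartial I F 0) F.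
Proof.
move=> r0 /(polydisc_series r0) [c Hc].
have H : egf rad (fun J => c J * (mfact J)%:R) F.
  by apply: (mseries_ext Hc) => J; rewrite mulfK // mfact_neq0.
by apply: (egf_ext H) => J; rewrite (egf_coef J r0 H).
Qed.

End PowerSeriesDerivative.

(** * Expectations of complex random variables *)

Section ComplexExpectation.
Context {d : measure_display} {T : measurableType d} {R : realType} (P : probability T R).
Implicit Types (g : T -> R[i]) (h : T -> R).

Let mT : measurable [set: T] := measurableT.

Lemma expectationE (X : T -> R) : ('E_P[X] = \int[P]_w (X w)%:E)%E.
Proof. by rewrite unlock. Qed.

Definition cmeasurable g := measurable_fun setT (fun w => complex.Re (g w)) /\
  measurable_fun setT (fun w => complex.Im (g w)).

Lemma cintegrable_measurable g : cintegrable P g -> cmeasurable g.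
Proof.
by move=> [/measurable_int/measurable_EFinP h1 /measurable_int/measurable_EFinP h2].
Qed.

Lemma cintegrable_le g h : cmeasurable g -> P.-integrable setT (EFin \o h) ->
  (forall w, cabs (g w) <= h w) -> cintegrable P g.
Proof.
move=> [m1 m2] ih gh; split.
  apply: (le_integrable mT _ _ ih); first exact/measurable_EFinP.
  move=> w _ /=; rewrite lee_fin; apply: le_trans (Re_le_cabs _) (le_trans (gh w) (ler_norm _)).
apply: (le_integrable mT _ _ ih); first exact/measurable_EFinP.
move=> w _ /=; rewrite lee_fin; apply: le_trans (Im_le_cabs _) (le_trans (gh w) (ler_norm _)).
Qed.

Lemma cintegrableD g1 g2 : cintegrable P g1 -> cintegrable P g2 ->
  cintegrable P (fun w => g1 w + g2 w).
Proof.
move=> [a1 b1] [a2 b2]; split.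
  have := integrableD mT a1 a2; apply: eq_integrable => // w _ /=.
  by rewrite ReD EFinD.
have := integrableD mT b1 b2; apply: eq_integrable => // w _ /=.
by rewrite ImD EFinD.
Qed.

Lemma cintegrableZ k g : cintegrable P g -> cintegrable P (fun w => k * g w).
Proof.
move=> [a b]; split.
  have := integrableB mT (integrableZl mT (complex.Re k) a) (integrableZl mT (complex.Im k) b).
  by apply: eq_integrable => // w _ /=; rewrite ReM EFinB.
have := integrableD mT (integrableZl mT (complex.Re k) b) (integrableZl mT (complex.Im k) a).
by apply: eq_integrable => // w _ /=; rewrite ImM EFinD.
Qed.

Lemma cintegrable0 : cintegrable P (fun=> 0).
Proof. by split; exact: integrable0. Qed.

Lemma cexpectationRI g : cexpectation P g =
  Complex (\int[P]_w complex.Re (g w))%R (\int[P]_w complex.Im (g w))%R.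
Proof. by rewrite /cexpectation !expectationE. Qed.

Lemma cexpectationD g1 g2 : cintegrable P g1 -> cintegrable P g2 ->
  cexpectation P (fun w => g1 w + g2 w) = cexpectation P g1 + cexpectation P g2.
Proof.
move=> [a1 b1] [a2 b2]; rewrite !cexpectationRI; apply: complex_ext => /=.
  by rewrite -RintegralD //; apply: eq_Rintegral => w _; rewrite ReD.
by rewrite -RintegralD //; apply: eq_Rintegral => w _; rewrite ImD.
Qed.

Lemma cexpectationZ k g : cintegrable P g ->
  cexpectation P (fun w => k * g w) = k * cexpectation P g.
Proof.
move=> [a b]; rewrite !cexpectationRI.
have iZ (l : R) f : P.-integrable setT (fun x => (f x)%:E) ->
    P.-integrable setT (EFin \o (fun x => l * f x)) by exact: (integrableZl mT l).
apply: complex_ext => /=.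
  rewrite ReM /= -!RintegralZl // -RintegralB //; try exact: iZ.
  by apply: eq_Rintegral => w _; rewrite ReM.
rewrite ImM /= -!RintegralZl // -RintegralD //; try exact: iZ.
by apply: eq_Rintegral => w _; rewrite ImM.
Qed.

Lemma cexpectation0 : cexpectation P (fun=> 0) = 0.
Proof. by rewrite cexpectationRI; apply: complex_ext; rewrite /= /Rintegral integral0. Qed.

Lemma cexpectation_sum (J : Type) (s : seq J) (u : J -> T -> R[i]) :
  (forall j, cintegrable P (u j)) ->
  cintegrable P (fun w => \sum_(j <- s) u j w) /\
  cexpectation P (fun w => \sum_(j <- s) u j w) = \sum_(j <- s) cexpectation P (u j).
Proof.
move=> H; elim: s => [|j s [IH1 IH2]].
  rewrite big_nil (_ : (fun w => _) = fun=> 0); last by apply/funext => w; rewrite big_nil.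
  by split; [exact: cintegrable0|exact: cexpectation0].
rewrite big_cons (_ : (fun w => _) = fun w => u j w + \sum_(j <- s) u j w); last first.
  by apply/funext => w; rewrite big_cons.
split; first exact: cintegrableD.
by rewrite cexpectationD // IH2.
Qed.

Lemma cexpectation_tmean n N (s : 'rV[R]_n) (H : 'rV[R[i]]_n -> T -> R[i]) : vle 0 s ->
  (forall th, on_torus s th -> cintegrable P (H th)) ->
  cintegrable P (fun w => tmean N s (fun th => H th w)) /\
  cexpectation P (fun w => tmean N s (fun th => H th w)) =
    tmean N s (fun th => cexpectation P (H th)).
Proof.
elim: n s H => [|n IH] s H s0 iH /=; first by split => //; apply: iH => -[].
have node m := cabs_node N m (vle_ord0 s0).
have Hj (m : 'I_N.+1) : cintegrable P (fun w => tmean N (vtail s)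
     (fun z => H (vcons ((s ord0 ord0)%:C%C * rootu R N ^+ m) z) w)) /\
   cexpectation P (fun w => tmean N (vtail s)
     (fun z => H (vcons ((s ord0 ord0)%:C%C * rootu R N ^+ m) z) w)) =
   tmean N (vtail s) (fun z => cexpectation P (H (vcons ((s ord0 ord0)%:C%C * rootu R N ^+ m) z))).
  apply: (IH _ (fun z => H (vcons ((s ord0 ord0)%:C%C * rootu R N ^+ m) z))); first exact: vtail_ge0.
  by move=> z hz; apply: iH; apply: on_torus_vcons.
have [h1 h2] := cexpectation_sum (index_enum 'I_N.+1) (fun m => proj1 (Hj m)).
rewrite /cmean; split; first exact: cintegrableZ.
rewrite cexpectationZ // h2; congr (_ * _); apply: eq_bigr => m _.
exact: (proj2 (Hj m)).
Qed.

(** Real and imaginary parts are dominated by the modulus, which reduces the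
    claim to dominated convergence for real functions. *)
Lemma cexpectation_DCT (gN : nat -> T -> R[i]) g h : (forall N, cmeasurable (gN N)) ->
  (forall w, gN N w @[N --> \oo] --> g w) -> P.-integrable setT (EFin \o h) ->
  (forall N w, cabs (gN N w) <= h w) ->
  cintegrable P g /\ cexpectation P (gN N) @[N --> \oo] --> cexpectation P g.
Proof.
move=> mg cg ih gh.
have real_case (f_ : nat -> T -> R) (f : T -> R) : (forall N, measurable_fun setT (f_ N)) ->
    (forall w, f_ N w @[N --> \oo] --> f w) -> (forall N w, `|f_ N w| <= h w) ->
    P.-integrable setT (EFin \o f) /\
    (\int[P]_w f_ N w)%R @[N --> \oo] --> (\int[P]_w f w)%R.
  move=> mf cf fh.
  have mfl : measurable_fun setT f.
    by apply: (measurable_realfun.measurable_fun_cvg mf) => w _; exact: cf.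
  have h1 N : measurable_fun setT (EFin \o f_ N) by exact/measurable_EFinP.
  have h2 : measurable_fun setT (EFin \o f) by exact/measurable_EFinP.
  have h3 w : (EFin \o f_ N) w @[N --> \oo] --> (EFin \o f) w.
    by apply: cvg_EFin; [exact: nearW|exact: cf].
  have [i1 _ i2] := @dominated_convergence _ _ _ P setT mT (fun N => EFin \o f_ N) (EFin \o f) (EFin \o h)
    h1 h2 (aeW _ (fun w _ => h3 w)) ih (aeW _ (fun w N _ => fh N w)).
  split => //; rewrite /Rintegral.
  apply: fine_cvg.
  by rewrite fineK ?integrable_fin_num.
have [i1 c1] := real_case (fun N w => complex.Re (gN N w)) (fun w => complex.Re (g w))
  (fun N => proj1 (mg N)) (fun w => cvg_Re (cg w)) (fun N w => le_trans (Re_le_cabs _) (gh N w)).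
have [i2 c2] := real_case (fun N w => complex.Im (gN N w)) (fun w => complex.Im (g w))
  (fun N => proj2 (mg N)) (fun w => cvg_Im (cg w)) (fun N w => le_trans (Im_le_cabs _) (gh N w)).
split; first by split.
rewrite cexpectationRI (_ : (fun N => cexpectation P (gN N)) =
   fun N => Complex (\int[P]_w complex.Re (gN N w))%R (\int[P]_w complex.Im (gN N w))%R).
  exact: cvg_Complex.
by apply/funext => N; rewrite cexpectationRI.
Qed.

End ComplexExpectation.

(** * Superpositions of exponentials *)

Section Exponentials.
Variable R : realType.

Lemma Re_sum (J : Type) (l : seq J) (u : J -> R[i]) :
  complex.Re (\sum_(j <- l) u j) = \sum_(j <- l) complex.Re (u j).
Proof. exact: (big_morph (@complex.Re R) (@ReD R) erefl). Qed.

Lemma Im_sum (J : Type) (l : seq J) (u : J -> R[i]) :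
  complex.Im (\sum_(j <- l) u j) = \sum_(j <- l) complex.Im (u j).
Proof. exact: (big_morph (@complex.Im R) (@ImD R) erefl). Qed.

Lemma cabs_dot_le n (th z : 'rV[R[i]]_n) (s : 'rV[R]_n) :
  (forall k, cabs (th ord0 k) <= s ord0 k) -> cabs (dot th z) <= dot s (vabs z).
Proof.
move=> ths; apply: le_trans (cabs_sum _ _ _) _; apply: ler_sum => k _.
by rewrite cabsM mxE ler_wpM2r ?cabs_ge0.
Qed.

Lemma cabs_cexp_dot_le n (th z : 'rV[R[i]]_n) (s : 'rV[R]_n) :
  (forall k, cabs (th ord0 k) <= s ord0 k) ->
  cabs (cexp (dot th z)) <= expR (dot s (vabs z)).
Proof. by move=> h; apply: le_trans (cabs_cexp_le _) _; rewrite ler_expR cabs_dot_le. Qed.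

Lemma vabs_cvec n (x : 'rV[R]_n) : vabs (cvec x) = map_mx Num.norm x.
Proof. by apply/rowP => k; rewrite !mxE cabs_real. Qed.

Lemma dotD (K : comNzRingType) n (s t v : 'rV[K]_n) : dot (s + t) v = dot s v + dot t v.
Proof. by rewrite /dot -big_split; apply: eq_bigr => k _; rewrite mxE mulrDl. Qed.

Lemma dotZ (K : comNzRingType) n a (s v : 'rV[K]_n) : dot (a *: s) v = a * dot s v.
Proof. by rewrite /dot mulr_sumr; apply: eq_bigr => k _; rewrite mxE mulrA. Qed.

Lemma dot_delta (K : comNzRingType) n k (v : 'rV[K]_n) : dot (delta_mx ord0 k) v = v ord0 k.
Proof.
rewrite /dot (bigD1 k) //= !mxE !eqxx mul1r big1 ?addr0 // => i ik.
by rewrite mxE (negbTE ik) andbF mul0r.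
Qed.

Lemma differentiable_cexp_comp n (G : 'rV[R[i]]_n -> R[i]) th :
  differentiable G th -> differentiable (fun t => cexp (G t)) th.
Proof.
move=> dG; apply: (differentiable_comp dG).
by apply/derivable1_diffP; have [] := is_derive_cexp (G th).
Qed.

Lemma partial_cexp_comp n (G : 'rV[R[i]]_n -> R[i]) th k : differentiable G th ->
  partial k (fun t => cexp (G t)) th = partial k G th * cexp (G th).
Proof.
move=> dG; have [dE DE] := is_derive_cexp (G th).
have dE' : differentiable (@cexp R) (G th) by apply/derivable1_diffP.
have dEG := differentiable_cexp_comp dG.
have e1 : partial k (fun t => cexp (G t)) th = 'd (fun t => cexp (G t)) th (delta_mx ord0 k).
  exact: deriveE.
have e2 : partial k G th = 'd G th (delta_mx ord0 k) by exact: deriveE.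
have e3 : 'd (@cexp R) (G th) 1 = cexp (G th) by rewrite -DE; apply/esym/deriveE.
have e4 : 'd (fun t => cexp (G t)) th = 'd (@cexp R) (G th) \o 'd G th :> (_ -> _).
  exact: (diff_comp dG dE').
have lin (x : R[i]) : 'd (@cexp R) (G th) x = x * cexp (G th).
  have h : 'd (@cexp R) (G th) (x *: (1 : R[i])) = x *: 'd (@cexp R) (G th) 1 by exact: linearZ.
  have e5 : x *: (1 : R[i]) = x := mulr1 x.
  by rewrite e5 e3 in h.
by rewrite e1 e4 /= e2 lin.
Qed.

Lemma differentiable_dot n (z th : 'rV[R[i]]_n) : differentiable (fun t => dot t z) th.
Proof.
rewrite (_ : (fun t => dot t z) = \sum_(k < n) (fun t : 'rV[R[i]]_n => t ord0 k * z ord0 k)).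
  apply: differentiable_sum => k.
  by apply: differentiableM; [exact: differentiable_coord|exact: differentiable_cst].
by apply/funext => t; rewrite fct_sumE.
Qed.

Lemma is_derive_dot n (z th : 'rV[R[i]]_n) k :
  is_derive th (delta_mx ord0 k) (fun t => dot t z) (z ord0 k).
Proof.
have H : h^-1 *: (((fun t => dot t z) \o shift th) (h *: delta_mx ord0 k) - dot th z)
    @[h --> (0 : R[i])^'] --> z ord0 k.
  apply: cvg_near_cst; near=> h.
  have h0 : h != 0 by near: h; exact: nbhs_dnbhs_neq.
  by rewrite /= dotD dotZ dot_delta addrK /GRing.scale /= mulKf.
split; first by apply/cvg_ex; exists (z ord0 k).
by apply: cvg_lim; [exact: norm_hausdorff|exact: H].
Unshelve. all: by end_near.
Qed.

End Exponentials.

Section ExponentialSuperpositions.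
Context {d : measure_display} {T : measurableType d} {R : realType} (P : probability T R).
Variables (n : nat) (Z : T -> 'rV[R]_n).
Hypothesis mZ : forall k, measurable_fun setT (fun w => Z w ord0 k).

Lemma cmeasurable_cexp_dot th : cmeasurable (fun w => cexp (dot th (cvec (Z w)))).
Proof.
have mRe : measurable_fun setT (fun w => complex.Re (dot th (cvec (Z w)))).
  rewrite (_ : (fun w => _) = fun w => \sum_k complex.Re (th ord0 k) * Z w ord0 k).
    apply: measurable_sum => k; apply: measurable_funM => //; exact: measurable_cst.
  apply/funext => w; rewrite /dot Re_sum; apply: eq_bigr => k _.
  by rewrite ReM mxE /= mulr0 subr0.
have mIm : measurable_fun setT (fun w => complex.Im (dot th (cvec (Z w)))).
  rewrite (_ : (fun w => _) = fun w => \sum_k complex.Im (th ord0 k) * Z w ord0 k).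
    apply: measurable_sum => k; apply: measurable_funM => //; exact: measurable_cst.
  apply/funext => w; rewrite /dot Im_sum; apply: eq_bigr => k _.
  by rewrite ImM mxE /= mulr0 add0r.
have me : measurable_fun setT (fun w => expR (complex.Re (dot th (cvec (Z w))))).
  by apply: measurableT_comp mRe; exact: measurable_expR.
split; rewrite /cexp /=; apply: measurable_funM => //.
  apply: (measurableT_comp _ mIm); apply: continuous_measurable_fun; exact: continuous_cos.
apply: (measurableT_comp _ mIm); apply: continuous_measurable_fun; exact: continuous_sin.
Qed.

Variables (rad : 'rV[\bar R]_n).
Hypothesis mgfZ : mgf_defined P Z rad.

Definition expabs (s : 'rV[R]_n) (w : T) : R := expR (dot s (map_mx Num.norm (Z w))).

Lemma measurable_expabs s : measurable_fun setT (expabs s).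
Proof.
apply: measurableT_comp; first exact: measurable_expR.
apply: measurable_sum => k.
apply: measurable_funM; first exact: measurable_cst.
rewrite (_ : (fun w => _) = fun w => `|Z w ord0 k|); last by apply/funext => w; rewrite mxE.
by apply: measurableT_comp => //; exact: measurable_normr.
Qed.

Lemma integrable_expabs s : vle 0 s -> vlt (map_mx EFin s) rad ->
  P.-integrable setT (EFin \o expabs s).
Proof.
move=> s0 srad; apply/integrableP; split.
  by apply/measurable_EFinP; exact: measurable_expabs.
have := mgfZ s0 srad; rewrite expectationE; apply: le_lt_trans.
apply: ge0_le_integral => //.
- apply: measurableT_comp => //; apply/measurable_EFinP; exact: measurable_expabs.
- by apply/measurable_EFinP; exact: measurable_expabs.
- by move=> w _ /=; rewrite lee_fin ger0_norm // expR_ge0.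
Qed.

Definition mexp s : R := fine 'E_P[expabs s].

Lemma mexp_ge0 s : 0 <= mexp s.
Proof.
apply: fine_ge0; rewrite expectationE; apply: integral_ge0 => w _.
by rewrite lee_fin expR_ge0.
Qed.

Lemma mexpE s : vle 0 s -> vlt (map_mx EFin s) rad -> ('E_P[expabs s] = (mexp s)%:E)%E.
Proof.
move=> s0 srad; rewrite fineK // expectationE; apply: integrable_fin_num => //.
exact: integrable_expabs.
Qed.

(** Functions that are superpositions of the exponentials [exp (th . z)] over
    the torus [|th_k| = s_k], with density [gam], in the sense of a limit of
    means over finer and finer grids. *)
Definition superposition m (s : 'rV[R]_m) (gam h : 'rV[R[i]]_m -> R[i]) :=
  forall z, tmean N s (fun th => gam th * cexp (dot th z)) @[N --> \oo] --> h z.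

Lemma superposition_le m (s : 'rV[R]_m) gam h (B : R) : vle 0 s -> superposition s gam h ->
  (forall th, on_torus s th -> cabs (gam th) <= B) ->
  forall z, cabs (h z) <= B * expR (dot s (vabs z)).
Proof.
move=> s0 hh gB z; apply: (cvg_cabs_lim_le (hh z)); apply: nearW => N.
apply: cabs_tmean_le => // th ths; rewrite cabsM; apply: ler_pM; rewrite ?cabs_ge0 ?gB //.
by apply: cabs_cexp_dot_le => k; rewrite ths.
Qed.

Lemma cintegrable_cexp_dot s th : vle 0 s -> vlt (map_mx EFin s) rad -> on_torus s th ->
  cintegrable P (fun w => cexp (dot th (cvec (Z w)))).
Proof.
move=> s0 srad ths; apply: (cintegrable_le _ (integrable_expabs s0 srad)).
  exact: cmeasurable_cexp_dot.
by move=> w; rewrite /expabs -vabs_cvec; apply: cabs_cexp_dot_le => k; rewrite ths.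
Qed.

(** The expectation commutes with the finite means, and [B exp(s . |Z|)]
    dominates them all. *)
Lemma superposition_expectation s gam h (B : R) : vle 0 s -> vlt (map_mx EFin s) rad ->
  superposition s gam h -> (forall th, on_torus s th -> cabs (gam th) <= B) ->
  cintegrable P (fun w => h (cvec (Z w))) /\
  tmean N s (fun th => gam th * mgf P Z th) @[N --> \oo] --> cexpectation P (fun w => h (cvec (Z w))).
Proof.
move=> s0 srad hh gB.
pose gN N w := tmean N s (fun th => gam th * cexp (dot th (cvec (Z w)))).
have H N := cexpectation_tmean (P := P) N (H := fun th w => gam th * cexp (dot th (cvec (Z w)))) s0
  (fun th ths => cintegrableZ (gam th) (cintegrable_cexp_dot s0 srad ths)).
have mg N : cmeasurable (gN N) by apply: cintegrable_measurable; exact: (proj1 (H N)).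
have ih : P.-integrable setT (EFin \o (fun w => B * expabs s w)).
  exact: (integrableZl measurableT B (integrable_expabs s0 srad)).
have gh N w : cabs (gN N w) <= B * expabs s w.
  apply: cabs_tmean_le => // th ths; rewrite cabsM; apply: ler_pM; rewrite ?cabs_ge0 ?gB //.
  by rewrite /expabs -vabs_cvec; apply: cabs_cexp_dot_le => k; rewrite ths.
have [i1 c1] := cexpectation_DCT mg (fun w => hh (cvec (Z w))) ih gh.
split => //; move: c1; rewrite (_ : (fun N => cexpectation P (gN N)) = fun N => tmean N s (fun th => gam th * mgf P Z th)) //.
apply/funext => N; rewrite (proj2 (H N)); apply: tmean_ext => // th ths.
by rewrite cexpectationZ //; exact: cintegrable_cexp_dot ths.
Qed.

(** The factor [2] comes from estimating the real and imaginary parts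
    separately. *)
Lemma cabs_mgf_le s th : vle 0 s -> vlt (map_mx EFin s) rad -> on_torus s th ->
  cabs (mgf P Z th) <= 2 * mexp s.
Proof.
move=> s0 srad ths.
have [iR iI] := cintegrable_cexp_dot s0 srad ths.
have ie := integrable_expabs s0 srad.
have mE : mexp s = (\int[P]_w expabs s w)%R by rewrite /mexp expectationE.
have bnd w : cabs (cexp (dot th (cvec (Z w)))) <= expabs s w.
  by rewrite /expabs -vabs_cvec; apply: cabs_cexp_dot_le => k; rewrite ths.
rewrite /mgf cexpectationRI mE mulr_natl mulr2n; apply: le_trans (cabs_le_ReIm _) _ => /=.
apply: lerD.
  apply: le_trans (le_normr_Rintegral _ iR) _ => //.
  apply: le_Rintegral => //.
    exact: (integrable_norm iR).
  by move=> w _; apply: le_trans (Re_le_cabs _) (bnd w).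
apply: le_trans (le_normr_Rintegral _ iI) _ => //.
apply: le_Rintegral => //.
  exact: (integrable_norm iI).
by move=> w _; apply: le_trans (Im_le_cabs _) (bnd w).
Qed.

Lemma L1norm_le s (h : 'rV[R[i]]_n -> R[i]) (B : R) : vle 0 s -> vlt (map_mx EFin s) rad ->
  cmeasurable (fun w => h (cvec (Z w))) -> 0 <= B ->
  (forall z, cabs (h z) <= B * expR (dot s (vabs z))) ->
  (L1norm P Z h <= (B * mexp s)%:E)%E.
Proof.
move=> s0 srad [mR mI] B0 hB; rewrite /L1norm EFinM -mexpE // !expectationE.
rewrite -ge0_integralZl_EFin //; last 2 first.
- by move=> w _; rewrite lee_fin expR_ge0.
- by apply/measurable_EFinP; exact: measurable_expabs.
apply: ge0_le_integral => //.
- by move=> w _; rewrite lee_fin cabs_ge0.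
- apply/measurable_EFinP.
  rewrite (_ : (fun w => _) = fun w => Num.sqrt (complex.Re (h (cvec (Z w))) ^+ 2 + complex.Im (h (cvec (Z w))) ^+ 2)).
    apply: measurableT_comp; first by apply: continuous_measurable_fun; exact: sqrt_continuous.
    by apply: measurable_funD; exact: measurable_funX.
  by apply/funext => w; case: (h _).
- apply: measurable_funeM; apply/measurable_EFinP; exact: measurable_expabs.
- by move=> w _; rewrite -EFinM lee_fin; apply: le_trans (hB _) _; rewrite vabs_cvec.
Qed.

End ExponentialSuperpositions.

(** * Entire functions of exponential type *)

Section EntireExponentialType.
Variable R : realType.

(** A form of Stirling's upper bound, by induction from
    [(1 + 1 / m) ^ m.+1 >= e]. *)
Lemma fact_expR_le m : (m.+1)`!%:R * expR m.+1%:R <= expR 1 * m.+1%:R * m.+1%:R ^+ m.+1 :> R.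
Proof.
elim: m => [|m IH]; first by rewrite expr1n !mulr1 mul1r.
have m1 : 0 < m.+1%:R :> R by rewrite ltr0n.
have m2 : 0 < m.+2%:R :> R by rewrite ltr0n.
have key : expR 1 * m.+1%:R ^+ m.+2 <= m.+2%:R ^+ m.+2 :> R.
  have h : m.+1%:R / m.+2%:R <= expR (- m.+2%:R^-1) :> R.
    apply: le_trans (expR_ge1Dx _).
    rewrite -[m.+2%:R]natr1 in m2 *; rewrite ler_pdivrMr // mulrDl mul1r mulNr mulVf ?gt_eqF //.
    by rewrite -addrA subrr addr0.
  have h2 : (m.+1%:R / m.+2%:R) ^+ m.+2 <= expR (- 1) :> R.
    have -> : - 1 = - m.+2%:R^-1 * m.+2%:R :> R by rewrite mulNr mulVf // gt_eqF.
    by rewrite expRM_natr lerXn2r // ?nnegrE ?expR_ge0 // divr_ge0 // ltW.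
  move: h2; rewrite expr_div_n ler_pdivrMr ?exprn_gt0 // expRN mulrC ler_pdivlMr ?expR_gt0 //.
  by rewrite mulrC.
rewrite factS natrM -[X in expR X%:R](addn1 m.+1) natrD expRD.
rewrite (_ : _ * _ = m.+2%:R * expR 1 * ((m.+1)`!%:R * expR m.+1%:R)); last by rewrite -[m.+1.+1]addn1 //; ring.
apply: (@le_trans _ _ (m.+2%:R * expR 1 * (expR 1 * m.+1%:R * m.+1%:R ^+ m.+1))).
  by rewrite ler_wpM2l // mulr_ge0 ?expR_ge0 // ltW.
rewrite [leLHS](_ : _ = expR 1 * m.+2%:R * (expR 1 * m.+1%:R ^+ m.+2)); last first.
  by rewrite [m.+1%:R ^+ m.+2]exprS; ring.
by rewrite ler_wpM2l // mulr_ge0 ?expR_ge0 // ltW.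
Qed.

(** The minimum over [t] of [m! exp(r' t) / t^m] is at most [e m r'^m] by
    Stirling's bound; the factor [m] is absorbed by the gap between [r'] and
    [rho]. *)
Lemma fact_expR_div_le (r r' rho : R) m : 0 <= r -> r <= r' -> 0 < r' -> r' < rho ->
  exists2 t : R, 0 < t &
    m`!%:R * (expR (r * t) / t ^+ m) <= expR 1 / (1 - r' / rho) * rho ^+ m.
Proof.
move=> r0 rr' r'0 r'rho.
have rho0 : 0 < rho by apply: lt_trans r'rho.
have q1 : r' / rho < 1 by rewrite ltr_pdivrMr // mul1r.
have q0 : 0 <= r' / rho by rewrite divr_ge0 // ltW.
have h1 : 0 < 1 - r' / rho by rewrite subr_gt0.
have r't (t : R) : 0 <= t -> expR (r * t) <= expR (r' * t) by move=> t0; rewrite ler_expR ler_wpM2r.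
case: m => [|m].
  exists r'^-1; first by rewrite invr_gt0.
  rewrite !expr0 divr1 mul1r mulr1; apply: le_trans (r't _ _) _; first by rewrite invr_ge0 ltW.
  rewrite divff ?gt_eqF // ler_pdivlMr // ler_piMr ?expR_ge0 //.
  by rewrite lerBlDr lerDl.
have m1 : 0 < m.+1%:R :> R by rewrite ltr0n.
(* the minimum of t |-> exp (r' t) / t^m is attained at t = m / r' *)
exists (m.+1%:R / r'); first by rewrite divr_gt0.
have t0 : 0 <= m.+1%:R / r' by rewrite divr_ge0 // ltW.
apply: (@le_trans _ _ ((m.+1)`!%:R * (expR (r' * (m.+1%:R / r')) / (m.+1%:R / r') ^+ m.+1))).
  by rewrite ler_wpM2l // ler_wpM2r ?r't // invr_ge0 exprn_ge0.
have -> : r' * (m.+1%:R / r') = m.+1%:R by rewrite mulrC divfK // gt_eqF.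
rewrite expr_div_n invf_div 2!mulrA ler_pdivrMr ?exprn_gt0 //.
apply: (@le_trans _ _ (expR 1 * m.+1%:R * m.+1%:R ^+ m.+1 * r' ^+ m.+1)).
  by rewrite ler_wpM2r ?fact_expR_le // exprn_ge0 // ltW.
have h2 : m.+1%:R * r' ^+ m.+1 <= (1 - r' / rho)^-1 * rho ^+ m.+1.
  rewrite -ler_pdivrMr ?exprn_gt0 // -mulrA -expr_div_n.
  exact: natr_geom_le.
rewrite [leLHS](_ : _ = (m.+1%:R * r' ^+ m.+1) * (expR 1 * m.+1%:R ^+ m.+1)); last by ring.
rewrite [leRHS](_ : _ = ((1 - r' / rho)^-1 * rho ^+ m.+1) * (expR 1 * m.+1%:R ^+ m.+1)); last by ring.
by rewrite ler_wpM2r // mulr_ge0 ?expR_ge0 // exprn_ge0 // ltW.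
Qed.

Definition unbounded_rad n : 'rV[\bar R]_n := const_mx +oo%E.

Lemma unbounded_rad_gt n (s : 'rV[R]_n) : vlt (map_mx EFin s) (unbounded_rad n).
Proof. by move=> k; rewrite !mxE ltry. Qed.

Lemma unbounded_rad_polydisc n (z : 'rV[R[i]]_n) : polydisc (unbounded_rad n) z.
Proof. by apply/polydiscP => k; rewrite mxE ltry. Qed.

Lemma expR_dot n (s t : 'rV[R]_n) : expR (dot s t) = \prod_k expR (s ord0 k * t ord0 k).
Proof. by rewrite /dot (big_morph (@expR R) (@expRD R) (expR0 R)). Qed.

Lemma natr_mfact n (J : mindex n) : (mfact J)%:R = \prod_k (J ord0 k)`!%:R :> R.
Proof. by rewrite /mfact natr_prod. Qed.

Lemma summ_pseries n (rad : 'rV[\bar R]_n) c F s : mseries rad c F -> vle 0 s ->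
  vlt (map_mx EFin s) rad -> summ (fun I => cabs (c I) * mpow s I).
Proof.
move=> [cB _] s0 srad; have [s2 ss2 s2rad] := vradius_between srad.
have s20 : vlt 0 s2 by move=> k; apply: le_lt_trans (ss2 k).
have [B HB] := cB s2 s20 s2rad.
exact: summ_coef s0 ss2 HB.
Qed.

Lemma on_torus_polydisc n (rad : 'rV[\bar R]_n) (s : 'rV[R]_n) z :
  vlt (map_mx EFin s) rad -> on_torus s z -> polydisc rad z.
Proof. by move=> srad zs; apply/polydiscP => k; rewrite zs; have := srad k; rewrite mxE. Qed.

Lemma mseries_tmean n (rad : 'rV[\bar R]_n) c F s I : mseries rad c F -> vlt 0 s ->
  vlt (map_mx EFin s) rad -> tmean N s (fun z => F z / mpow z I) @[N --> \oo] --> c I.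
Proof.
move=> H s0 srad; apply: (coef_tmean s0 (summ_pseries H (vltW s0) srad)).
by move=> z zs; apply: (proj2 H); exact: on_torus_polydisc zs.
Qed.

Lemma mseries_cauchy n (rad : 'rV[\bar R]_n) c F s (I : mindex n) (B : R) : mseries rad c F -> vlt 0 s ->
  vlt (map_mx EFin s) rad -> (forall z, on_torus s z -> cabs (F z) <= B) ->
  cabs (c I) <= B / mpow s I.
Proof.
move=> H s0 srad HB; apply: (coef_cauchy I s0 (summ_pseries H (vltW s0) srad) _ HB).
by move=> z zs; apply: (proj2 H); exact: on_torus_polydisc zs.
Qed.

(** Cauchy's inequalities on tori whose radii depend on [I] as in
    [fact_expR_div_le]. *)
Lemma entire_coef_bound n (a : mindex n -> R[i]) f (C : R) (r rho : 'rV[R]_n) :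
  egf (unbounded_rad n) a f -> (forall z, cabs (f z) <= C * expR (dot r (vabs z))) ->
  vle 0 r -> vlt r rho -> exists C', forall I, cabs (a I) <= C' * mpow rho I.
Proof.
move=> Ha fC r0 rrho.
have C0 : 0 <= C.
  have := fC 0; move/(le_trans (cabs_ge0 _)); rewrite pmulr_lge0 //; exact: expR_gt0.
pose r' k := (r ord0 k + rho ord0 k) / 2.
have rk k : 0 <= r ord0 k by have := r0 k; rewrite mxE.
have rho0 k : 0 < rho ord0 k by apply: le_lt_trans (rrho k).
have rr' k : r ord0 k <= r' k by have := rrho k; rewrite /r'; lra.
have r'rho k : r' k < rho ord0 k by have := rrho k; rewrite /r'; lra.
have r'0 k : 0 < r' k by rewrite /r'; have := rk k; have := rho0 k; lra.
exists (C * \prod_k (expR 1 / (1 - r' k / rho ord0 k))) => I.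
have Hex k : exists t : R, 0 < t /\
    (I ord0 k)`!%:R * (expR (r ord0 k * t) / t ^+ I ord0 k) <=
      expR 1 / (1 - r' k / rho ord0 k) * rho ord0 k ^+ I ord0 k.
  have [t t0 Ht] := fact_expR_div_le (I ord0 k) (rk k) (rr' k) (r'0 k) (r'rho k).
  by exists t.
have [t Ht] := choice Hex.
pose tv : 'rV[R]_n := \row_k t k.
have t0 : vlt 0 tv by move=> k; rewrite !mxE; have [] := Ht k.
have h1 : cabs (a I / (mfact I)%:R) <= C * expR (dot r tv) / mpow tv I.
  apply: (mseries_cauchy _ Ha t0 (unbounded_rad_gt tv)) => z zt.
  by apply: le_trans (fC z) _; rewrite (_ : vabs z = tv) //; apply/rowP => k; rewrite mxE zt.
move: h1; rewrite cabsM cabsV cabs_nat ler_pdivrMr; last first.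
  by rewrite ltr0n prodn_gt0 // => k; exact: fact_gt0.
move=> /le_trans; apply; rewrite -!mulrA ler_wpM2l //.
rewrite expR_dot natr_mfact /mpow -prodfV -!big_split /=; apply: ler_prod => k _.
have [tk0 tk] := Ht k; rewrite !mxE.
rewrite [X in 0 <= X <= _](_ : _ = (I ord0 k)`!%:R * (expR (r ord0 k * t k) / t k ^+ I ord0 k)); last by ring.
apply/andP; split; last exact: tk.
by rewrite !mulr_ge0 ?expR_ge0 ?invr_ge0 ?exprn_ge0 // ltW.
Qed.

Lemma mseries_shift n (rad : 'rV[\bar R]_n) c F (I : mindex n) : mseries rad c F ->
  exists2 c', mseries rad c' (fun z => mpow z I * F z) &
    (forall J, c' (J + I) = c J) /\ (forall K, (forall J, K <> J + I) -> c' K = 0).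
Proof.
move=> [cB cF].
pose c' (K : mindex n) := if [forall k, (I ord0 k <= K ord0 k)%N] then
  c (\row_k (K ord0 k - I ord0 k)%N) else 0.
have c'E (J : mindex n) : c' (J + I) = c J.
  rewrite /c'; case: ifPn => [_|/forallP []]; last by move=> k; rewrite mxE leq_addl.
  by congr c; apply/rowP => k; rewrite !mxE; exact: addnK.
have c'0 (K : mindex n) : (forall J, K <> J + I) -> c' K = 0.
  move=> H; rewrite /c'; case: ifPn => // /forallP h.
  by case: (H (\row_k (K ord0 k - I ord0 k)%N)); apply/rowP => k; rewrite !mxE; apply/esym/subnK.
exists c'; last by [].
split => [s s0 srad|z zrad].
  have [B HB] := cB s s0 srad.
  have B0 : 0 <= B by have := HB 0; rewrite mpow0 divr1; apply: le_trans; exact: cabs_ge0.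
  exists (B * mpow s I) => K.
  have [[J ->]|nK] := pselect (exists J : mindex n, K = J + I).
    rewrite c'E mpowD; apply: le_trans (HB J) _.
    by rewrite invfM mulrACA divff ?mulr1 // gt_eqF // mpow_gt0.
  rewrite c'0 ?cabs0; last by move=> J KJ; apply: nK; exists J.
  by rewrite divr_ge0 ?mulr_ge0 // ltW // mpow_gt0.
apply: (@hsum_inj R _ _ _ (@add_mindex_inj _ I) (fun K => c' K * mpow z K) _ _).1 => [K HK|].
  by rewrite c'0 ?mul0r.
have h := hsumZ (k := mpow z I) (cF z zrad).
by apply: (hsum_ext h) => J /=; rewrite c'E mpowD; ring.
Qed.

(** Expanding [exp(th . z)] in powers of [th] turns torus means against
    [th^-J] into [z^J / J!]: this is how polynomials in [z], and power series
    in [z], become superpositions of exponentials. *)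
Lemma egf_cexp_dot n (rad : 'rV[\bar R]_n) (z : 'rV[R[i]]_n) : (forall k, (0 < rad ord0 k)%E) ->
  egf rad (fun J => mpow z J) (fun th => cexp (dot th z)).
Proof.
move=> r0.
have hol : holomorphic_on (polydisc rad) (fun th => cexp (dot th z)).
  by move=> th _; apply: differentiable_cexp_comp; exact: differentiable_dot.
apply: (egf_ext (holomorphic_egf r0 hol)) => J.
have part (c : R[i]) k : partial k (fun th => c * cexp (dot th z)) = fun th => (c * z ord0 k) * cexp (dot th z).
  apply/funext => th.
  have dE : differentiable (fun th => cexp (dot th z)) th.
    by apply: differentiable_cexp_comp; exact: differentiable_dot.
  have -> : partial k (fun th => c * cexp (dot th z)) th = c * partial k (fun th => cexp (dot th z)) th.
    exact: (deriveZ c (diff_derivable (v := delta_mx ord0 k) dE)).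
  rewrite partial_cexp_comp; last exact: differentiable_dot.
  have [_ h] := is_derive_dot z th k.
  by rewrite /partial h mulrA.
have it (c : R[i]) k m : iter m (partial k) (fun th => c * cexp (dot th z)) = fun th => (c * z ord0 k ^+ m) * cexp (dot th z).
  elim: m => [|m IH] /=; first by rewrite mulr1.
  by rewrite IH part exprSr mulrA.
have fold (l : seq 'I_n) : foldr (fun k g => iter (J ord0 k) (partial k) g) (fun th => cexp (dot th z)) l =
    fun th => (\prod_(k <- l) z ord0 k ^+ J ord0 k) * cexp (dot th z).
  elim: l => [|k l IH] /=; first by apply/funext => th; rewrite big_nil mul1r.
  by rewrite IH it; apply/funext => th; rewrite big_cons; congr (_ * _); rewrite mulrC.
rewrite /mpartial fold /mpow big_enum /=.
by rewrite (_ : dot 0 z = 0) ?cexp0 ?mulr1 // /dot big1 // => k _; rewrite mxE mul0r.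
Qed.

End EntireExponentialType.

Section BorelDensity.
Variables (R : realType) (n : nat).
Variables (a : mindex n -> R[i]) (f : 'rV[R[i]]_n -> R[i]) (C : R) (rho s : 'rV[R]_n).
Hypothesis Ha : egf (unbounded_rad R n) a f.
Hypothesis aC : forall I, cabs (a I) <= C * mpow rho I.
Hypothesis rho0 : vle 0 rho.
Hypothesis rhos : vlt rho s.

(** The Borel transform of [f], up to a factor: the density that represents
    [f] as a superposition of exponentials. *)
Definition borel_density (xi : 'rV[R[i]]_n) : R[i] :=
  summability.sum (fun K : mindex n => a K / mpow xi K).

Let s0 : vlt 0 s.
Proof. by move=> k; apply: le_lt_trans (rhos k). Qed.

Let q : 'rV[R]_n := \row_k (rho ord0 k / s ord0 k).

Let q0 : vle 0 q.
Proof.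
move=> k; rewrite !mxE divr_ge0 //; first by have := rho0 k; rewrite mxE.
by have := s0 k; rewrite mxE => /ltW.
Qed.

Let q1 k : q ord0 k < 1.
Proof.
rewrite mxE ltr_pdivrMr ?mul1r; first exact: rhos.
by have := s0 k; rewrite mxE.
Qed.

Let C0 : 0 <= C.
Proof. by have := aC 0; rewrite mpow0 mulr1; apply: le_trans; exact: cabs_ge0. Qed.

Let term_le xi K : on_torus s xi -> cabs (a K / mpow xi K) <= C * mpow q K.
Proof.
move=> h; rewrite cabsM cabsV (cabs_mpow_torus _ h) mpow_quot mulrA.
by rewrite ler_wpM2r // invr_ge0 ltW // mpow_gt0.
Qed.

Let hsum_borel xi : on_torus s xi -> hsum (fun K => a K / mpow xi K) (borel_density xi).
Proof.
move=> h.
have [l hl] := hsum_exists (fun K => term_le K h) (summZ C0 (summ_mpowW q0 q1)).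
by rewrite /borel_density (hsum_sum hl).
Qed.

Definition borel_bound : R := C * \prod_k (1 - rho ord0 k / s ord0 k)^-1.

Lemma borel_density_le xi : on_torus s xi -> cabs (borel_density xi) <= borel_bound.
Proof.
move=> h; apply: (hsum_le (hsum_borel h) (fun K => term_le K h)) => A.
rewrite -mulr_sumr ler_wpM2l //; apply: le_trans (summ_mpow q0 q1 A) _.
rewrite le_eqVlt; apply/orP; left; apply/eqP; apply: eq_bigr => k _; by rewrite mxE.
Qed.

(** Term by term: the mean of [xi^I exp(xi . z) / xi^K] is the coefficient
    [z^(K - I) / (K - I)!], or [0] if [K - I] has a negative entry. *)
Lemma superposition_mpartial I :
  superposition s (fun xi => mpow xi I * borel_density xi) (mpartial I f).
Proof.
move=> z.
have r0 k : (0 < unbounded_rad R n ord0 k)%E by rewrite mxE ltry.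
have srad := unbounded_rad_gt s.
have [c' Hc' [c'E c'0]] := mseries_shift I (egf_cexp_dot z r0).
pose u N K := tmean N s (fun xi => a K * ((mpow xi I * cexp (dot xi z)) / mpow xi K)).
pose B := mpow s I * expR (dot s (vabs z)).
have B0 : 0 <= B by rewrite mulr_ge0 ?expR_ge0 // ltW // mpow_gt0.
have k1 : \forall N \near \oo, forall K, cabs (u N K) <= B * (C * mpow q K).
  apply: nearW => N K; apply: cabs_tmean_le => [|xi hxi]; first exact: vltW.
  rewrite mulrCA cabsM; apply: ler_pM; rewrite ?cabs_ge0 //; last exact: term_le.
  rewrite cabsM (cabs_mpow_torus _ hxi) ler_wpM2l ?(ltW (mpow_gt0 I s0)) //.
  by apply: cabs_cexp_dot_le => k; rewrite hxi.
have k2 : summ (fun K => B * (C * mpow q K)).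
  by apply: summZ => //; apply: summZ => //; exact: summ_mpowW.
have k3 K : u N K @[N --> \oo] --> a K * c' K.
  have -> : (fun N => u N K) = fun N => a K * tmean N s (fun xi => (mpow xi I * cexp (dot xi z)) / mpow xi K).
    by apply/funext => N; rewrite /u tmeanZ.
  by apply: cvgM; [exact: cvg_cst|exact: mseries_tmean Hc' s0 srad].
have k4 : \forall N \near \oo, hsum (u N) (tmean N s (fun xi => mpow xi I * borel_density xi * cexp (dot xi z))).
  apply: nearW => N.
  apply: (hsum_tmean (u := fun xi K => a K * ((mpow xi I * cexp (dot xi z)) / mpow xi K)) (vltW s0)) => xi hxi.
  have h := hsumZ (k := mpow xi I * cexp (dot xi z)) (hsum_borel hxi).
  rewrite mulrAC; apply: (hsum_ext h) => K; exact: mulrCA.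
have k5 : hsum (fun K => a K * c' K) (mpartial I f z).
  have v0 (K : mindex n) : (forall J, K <> J + I) -> a K * c' K = 0.
    by move=> HK; rewrite c'0 ?mulr0.
  apply: (@hsum_inj R _ _ _ (@add_mindex_inj _ I) (fun K => a K * c' K) _ v0).1.
  have h := proj2 (egf_mpartial I Ha) z (unbounded_rad_polydisc z).
  by apply: (hsum_ext h) => J /=; rewrite c'E mulrAC mulrA.
exact: (tannery k1 k2 k3 k4 k5).
Qed.

End BorelDensity.

(** * Power series and the last variable *)

Section LastVariable.
Variable R : realType.

Definition vsnoc (K : Type) n (x : 'rV[K]_n) (y : K) : 'rV[K]_(n + 1) := row_mx x (const_mx y).

Lemma vsnocL (K : Type) n (x : 'rV[K]_n) y k : vsnoc x y ord0 (lshift 1 k) = x ord0 k.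
Proof. by rewrite /vsnoc row_mxEl. Qed.

Lemma vsnocR (K : Type) n (x : 'rV[K]_n) y j : vsnoc x y ord0 (rshift n j) = y.
Proof. by rewrite /vsnoc row_mxEr mxE. Qed.

Lemma vsnocP (K : Type) n (Q : 'I_(n + 1) -> K -> Prop) (x : 'rV[K]_n) y :
  (forall k, Q (lshift 1 k) (x ord0 k)) -> Q (rshift n ord0) y ->
  forall k, Q k (vsnoc x y ord0 k).
Proof.
move=> Qx Qy k; case: (splitP k) => j kj.
  have -> : k = lshift 1 j by exact: val_inj.
  by rewrite vsnocL.
have -> : k = rshift n j by exact: val_inj.
by rewrite vsnocR (ord1 j).
Qed.

Lemma vsnoc_eta (K : Type) n (z : 'rV[K]_(n + 1)) : vsnoc (lsubmx z) (z ord0 (rshift n ord0)) = z.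
Proof.
rewrite -[RHS]hsubmxK /vsnoc; congr row_mx; apply/rowP => k.
by rewrite !mxE (ord1 k).
Qed.

Lemma lsubmx_vsnoc (K : Type) n (x : 'rV[K]_n) y : lsubmx (vsnoc x y) = x.
Proof. exact: row_mxKl. Qed.

Lemma vsnoc_inj (K : Type) n (x x' : 'rV[K]_n) y y' : vsnoc x y = vsnoc x' y' -> x = x' /\ y = y'.
Proof.
move=> h; split; first by rewrite -(lsubmx_vsnoc x y) h lsubmx_vsnoc.
by rewrite -(vsnocR x y ord0) h vsnocR.
Qed.

Lemma mpow_vsnoc (K : comNzRingType) n (x : 'rV[K]_n) y (I : mindex n) j :
  mpow (vsnoc x y) (vsnoc I j) = mpow x I * y ^+ j.
Proof.
rewrite /mpow big_split_ord /= big_ord1 !vsnocR; congr (_ * _).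
by apply: eq_bigr => k _; rewrite !vsnocL.
Qed.

Lemma mfact_vsnoc n (I : mindex n) j : mfact (vsnoc I j) = (mfact I * j`!)%N.
Proof.
rewrite /mfact big_split_ord /= big_ord1 !vsnocR; congr (_ * _)%N.
by apply: eq_bigr => k _; rewrite !vsnocL.
Qed.

Lemma dot_vsnoc (K : comNzRingType) n (x u : 'rV[K]_n) y v :
  dot (vsnoc x y) (vsnoc u v) = dot x u + y * v.
Proof.
rewrite /dot big_split_ord /= big_ord1 !vsnocR; congr (_ + _).
by apply: eq_bigr => k _; rewrite !vsnocL.
Qed.

Lemma vsnocD n (I I' : mindex n) j j' : vsnoc I j + vsnoc I' j' = vsnoc (I + I') (j + j')%N.
Proof. by rewrite /vsnoc add_row_mx; congr row_mx; apply/rowP => k; rewrite !mxE. Qed.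

Lemma mone_last n : mone (rshift n ord0) = vsnoc (0 : mindex n) 1%N.
Proof.
apply/rowP => k; rewrite mxE; apply: (@vsnocP nat n (fun k x => ((k == rshift n ord0) : nat) = x) 0 1%N).
  by move=> i; rewrite mxE eq_lrshift.
by rewrite eqxx.
Qed.

Lemma vsnoc00 (V : nmodType) n : vsnoc (0 : 'rV[V]_n) 0 = 0.
Proof.
apply/rowP => k; rewrite [RHS]mxE.
by apply: (@vsnocP V n (fun _ x => x = 0) 0 0) => // i; rewrite mxE.
Qed.

Lemma cvec_vsnoc n (x : 'rV[R]_n) y : cvec (vsnoc x y) = vsnoc (cvec x) y%:C%C.
Proof. by rewrite /cvec /vsnoc map_row_mx; congr row_mx; apply/rowP => k; rewrite !mxE. Qed.

Lemma polydisc_vsnoc n (rad : 'rV[\bar R]_n) t xi eta : polydisc rad xi -> ((cabs eta)%:E < t)%E ->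
  polydisc (vsnoc rad t) (vsnoc xi eta).
Proof.
move=> /polydiscP h1 h2; apply/polydiscP.
apply: (@vsnocP _ n (fun k e => ((cabs (vsnoc xi eta ord0 k))%:E < e)%E)) => [k|].
  by rewrite vsnocL.
by rewrite vsnocR.
Qed.

Lemma vlt_vsnoc (disp : Order.disp_t) (S : porderType disp) n (u v : 'rV[S]_n) x y :
  vlt u v -> (x < y)%O -> vlt (vsnoc u x) (vsnoc v y).
Proof.
move=> h1 h2; apply: (@vsnocP _ n (fun k e => (vsnoc u x ord0 k < e)%O)) => [k|].
  by rewrite vsnocL.
by rewrite vsnocR.
Qed.

Lemma vsnoc_EFin n (s : 'rV[R]_n) t : map_mx EFin (vsnoc s t) = vsnoc (map_mx EFin s) t%:E.
Proof. by rewrite /vsnoc map_row_mx; congr row_mx; apply/rowP => k; rewrite !mxE. Qed.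

Lemma vlt0_vsnoc n (s : 'rV[R]_n) t : vlt 0 s -> 0 < t -> vlt 0 (vsnoc s t).
Proof.
move=> s0 t0 k; rewrite [X in (X < _)%O]mxE.
apply: (@vsnocP R n (fun _ x => 0 < x) s t) => // i; by have := s0 i; rewrite mxE.
Qed.

Lemma hsum_snoc0 n (u : mindex (n + 1) -> R[i]) l :
  (forall I j, u (vsnoc I j.+1) = 0) ->
  hsum (fun I : mindex n => u (vsnoc I 0%N)) l <-> hsum u l.
Proof.
move=> u0; apply: (@hsum_inj R _ _ (fun I : mindex n => vsnoc I 0%N)).
  by move=> I J h; exact: (proj1 (vsnoc_inj h)).
move=> L HL; rewrite -(vsnoc_eta L); case E : (L ord0 (rshift n ord0)) => [|j].
  by case: (HL (lsubmx L)); rewrite -{1}(vsnoc_eta L) E.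
exact: u0.
Qed.

(** At [0] in the last variable only the monomials free of it survive. *)
Lemma egf_slice n (rad : 'rV[\bar R]_n) t a F : (0 < t)%E -> egf (vsnoc rad t) a F ->
  egf rad (fun I => a (vsnoc I 0%N)) (fun xi => F (vsnoc xi 0)).
Proof.
move=> t0 [aB aF].
have [x x0 xt] := radius_between t0.
split => [s s0 srad|xi hxi].
  have sx : vlt (map_mx EFin (vsnoc s x)) (vsnoc rad t).
    by rewrite vsnoc_EFin; exact: vlt_vsnoc.
  have [B HB] := aB _ (vlt0_vsnoc s0 x0) sx.
  exists B => I; have := HB (vsnoc I 0%N).
  by rewrite mpow_vsnoc mfact_vsnoc expr0 mulr1 fact0 muln1.
have h := aF (vsnoc xi 0) (polydisc_vsnoc hxi (eq_ind_r (fun y => (y%:E < t)%E) t0 (cabs0 R))).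
have u0 I j : a (vsnoc I j.+1) / (mfact (vsnoc I j.+1))%:R * mpow (vsnoc xi 0) (vsnoc I j.+1) = 0.
  by rewrite mpow_vsnoc expr0n /= !mulr0.
have := (hsum_snoc0 (u := fun L => a L / (mfact L)%:R * mpow (vsnoc xi 0) L) (F (vsnoc xi 0)) u0).2 h.
move=> h'; apply: (hsum_ext h') => I.
by rewrite mpow_vsnoc mfact_vsnoc expr0 mulr1 fact0 muln1.
Qed.

(** The coefficients of a function that does not depend on the last variable. *)
Definition lift_coef n (a : mindex n -> R[i]) (L : mindex (n + 1)) : R[i] :=
  if L ord0 (rshift n ord0) == 0%N then a (lsubmx L) else 0.

Lemma lift_coef0 n (a : mindex n -> R[i]) I : lift_coef a (vsnoc I 0%N) = a I.
Proof. by rewrite /lift_coef vsnocR eqxx lsubmx_vsnoc. Qed.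

Lemma lift_coefS n (a : mindex n -> R[i]) I j : lift_coef a (vsnoc I j.+1) = 0.
Proof. by rewrite /lift_coef vsnocR. Qed.

Lemma egf_lift n (a : mindex n -> R[i]) f : egf (unbounded_rad R n) a f ->
  egf (unbounded_rad R (n + 1)) (lift_coef a) (lift_fun f).
Proof.
move=> [aB aF]; split => [s s0 _|z _].
  pose s' : 'rV[R]_n := lsubmx s.
  have s'0 : vlt 0 s' by move=> k; have := s0 (lshift 1 k); rewrite !mxE.
  have [B HB] := aB s' s'0 (unbounded_rad_gt s').
  have B0 : 0 <= B by have := HB 0; rewrite mpow0 divr1; apply: le_trans; exact: cabs_ge0.
  exists B => L; rewrite -(vsnoc_eta L); case: (L ord0 (rshift n ord0)) => [|j].
    rewrite lift_coef0 mfact_vsnoc fact0 muln1 -(vsnoc_eta s) mpow_vsnoc expr0 mulr1.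
    exact: HB.
  by rewrite lift_coefS mul0r cabs0 divr_ge0 // ltW // mpow_gt0.
have h := aF (lsubmx z) (unbounded_rad_polydisc _).
apply: (hsum_snoc0 (u := fun L => lift_coef a L / (mfact L)%:R * mpow z L) _ _).1.
  by move=> I j; rewrite lift_coefS !mul0r.
apply: (hsum_ext h) => I; rewrite lift_coef0 -{2}(vsnoc_eta z) mpow_vsnoc mfact_vsnoc.
by rewrite expr0 mulr1 fact0 muln1.
Qed.

Lemma mpartial_lift n (a : mindex n -> R[i]) f L z : egf (unbounded_rad R n) a f ->
  mpartial L (lift_fun f) z = lift_coef (fun I => mpartial I f (lsubmx z)) L.
Proof.
move=> Ha.
have h := proj2 (egf_mpartial L (egf_lift Ha)) z (unbounded_rad_polydisc z).
rewrite -(vsnoc_eta L) in h *; case: (L ord0 (rshift n ord0)) h => [|j] h.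
  rewrite lift_coef0.
  have u0 I j : lift_coef a (vsnoc I j.+1 + vsnoc (lsubmx L) 0%N) / (mfact (vsnoc I j.+1))%:R * mpow z (vsnoc I j.+1) = 0.
    by rewrite vsnocD lift_coefS !mul0r.
  have h1 := (hsum_snoc0 (u := fun J => lift_coef a (J + vsnoc (lsubmx L) 0%N) / (mfact J)%:R * mpow z J) _ u0).2 h.
  have h2 := proj2 (egf_mpartial (lsubmx L) Ha) (lsubmx z) (unbounded_rad_polydisc _).
  apply: (hsum_unique h1); apply: (hsum_ext h2) => I.
  rewrite vsnocD lift_coef0 -{2}(vsnoc_eta z) mpow_vsnoc mfact_vsnoc.
  by rewrite expr0 mulr1 fact0 muln1.
rewrite lift_coefS; apply: (hsum_unique h); apply: (hsum_ext (@hsum0 R _)) => J.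
by rewrite -(vsnoc_eta J) vsnocD addnS lift_coefS !mul0r.
Qed.

Lemma egf_last_coord n : egf (unbounded_rad R (n + 1))
  (fun L => (L == mone (rshift n ord0))%:R) (@last_coord R n).
Proof.
split => [s s0 _|z _].
  exists (s ord0 (rshift n ord0)) => L; case: eqP => [->|_].
    rewrite mpow_mone divff; last by rewrite gt_eqF //; have := s0 (rshift n ord0); rewrite mxE.
    by rewrite mone_last mfact_vsnoc mfact0 (_ : 1`! = 1)%N // muln1 divr1 cabs_nat.
  rewrite mul0r cabs0 divr_ge0 //; last by rewrite ltW // mpow_gt0.
  by have := s0 (rshift n ord0); rewrite mxE => /ltW.
have := @hsum_fset R (mindex (n + 1)) [fset mone (rshift n ord0)]%fset
  (fun L => (L == mone (rshift n ord0))%:R / (mfact L)%:R * mpow z L).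
rewrite big_seq_fset1 eqxx mpow_mone mone_last mfact_vsnoc mfact0 (_ : 1`! = 1)%N // muln1 divr1 mul1r; apply.
by move=> L; rewrite inE => /negbTE ->; rewrite !mul0r.
Qed.

Lemma mpartial_last_coord n L z : mpartial L (@last_coord R n) z =
  if L == 0 then last_coord z else (L == mone (rshift n ord0))%:R.
Proof.
case: eqP => [->|/eqP L0]; first by rewrite mpartial0.
have h := proj2 (egf_mpartial L (egf_last_coord n)) z (unbounded_rad_polydisc z).
apply: (hsum_unique h).
case: eqP => [->|/eqP Lm].
  have := @hsum_fset R (mindex (n + 1)) [fset (0 : mindex (n + 1))]%fset
    (fun J => (J + mone (rshift n ord0) == mone (rshift n ord0))%:R / (mfact J)%:R * mpow z J).
  rewrite big_seq_fset1 add0r eqxx mpow0 mfact0 divr1 mulr1; apply.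
  move=> J; rewrite inE => J0; rewrite (_ : (_ == _) = false) ?mul0r //.
  apply: contraNF J0 => /eqP /rowP H; apply/eqP/rowP => k; have := H k.
  rewrite add_moneE !mxE => /eqP; rewrite -[X in _ == X]add0n eqn_add2r => /eqP //.
apply: (hsum_ext (@hsum0 R _)) => J; rewrite (_ : (_ == _) = false) ?mul0r //.
apply/negP => /eqP /rowP H.
have Hk k : (J ord0 k + L ord0 k)%N = (k == rshift n ord0) :> nat.
  by have := H k; rewrite !mxE.
have Lk k : k != rshift n ord0 -> L ord0 k = 0%N.
  by move=> kn; have := Hk k; rewrite (negbTE kn) => /eqP; rewrite addn_eq0 => /andP[_ /eqP].
have := Hk (rshift n ord0); rewrite eqxx.
case E : (L ord0 (rshift n ord0)) => [|[|m]].
- move=> _; move/eqP: L0; apply; apply/rowP => k; rewrite mxE.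
  by have [->|/Lk ->] := eqVneq k (rshift n ord0).
- move=> _; move/eqP: Lm; apply; apply/rowP => k; rewrite mxE.
  by have [->|/Lk ->] := eqVneq k (rshift n ord0).
- by rewrite !addnS.
Qed.

End LastVariable.

Section Uniqueness.
Variable R : realType.

Lemma near0_box n (U : 'rV[R[i]]_n -> Prop) : (\forall th \near (0 : 'rV[R[i]]_n), U th) ->
  exists2 e : R, 0 < e & forall th : 'rV[R[i]]_n, (forall k, cabs (th ord0 k) < e) -> U th.
Proof.
move=> /nbhs_ballP[[e e'] /=]; rewrite ltcE /= => /andP[/eqP -> e0] H.
exists e => // th hth; apply: H; split; first by rewrite ltcR.
move=> i j; rewrite (ord1 i) mxE /ball /= sub0r normrN normCE.
by change ((cabs (th ord0 j))%:C%C < e%:C%C); rewrite ltcR.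
Qed.

Lemma near0_polydisc n (rad : 'rV[\bar R]_n) : (forall k, (0 < rad ord0 k)%E) ->
  \forall th \near (0 : 'rV[R[i]]_n), polydisc rad th.
Proof.
move=> r0.
have [s s0 srad] := exists_radius r0.
pose e : R := \big[Num.min/1]_k s ord0 k.
have e0 : 0 < e by rewrite /e; apply: lt_bigmin => // k _; have := s0 k; rewrite mxE.
have e0' : 0 < e%:C%C by rewrite ltcR.
apply/nbhs_ballP; exists e%:C%C => //= th [_ hth]; apply/polydiscP => k.
have := hth ord0 k; rewrite mxE /ball /= sub0r normrN normCE ltcR => h.
apply: lt_trans (srad k); rewrite mxE lte_fin; apply: lt_le_trans h _.
exact: bigmin_le_cond.
Qed.

Lemma hsum_bounded (I : choiceType) (u : I -> R[i]) l : hsum u l -> exists B, forall i, cabs (u i) <= B.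
Proof.
move=> /cvg_cabsP/(_ 1 ltr01)/nearTE [A HA].
exists (2 + \sum_(i <- A) cabs (u i)) => i.
have S0 : 0 <= \sum_(i <- A) cabs (u i) by apply: sumr_ge0 => j _; exact: cabs_ge0.
have [iA|iA] := boolP (i \in A).
  apply: (@le_trans _ _ (\sum_(i <- A) cabs (u i))); last by rewrite lerDr.
  rewrite (big_rem i) //= lerDl; apply: sumr_ge0 => j _; exact: cabs_ge0.
have h1 := HA A (fsubset_refl _); have h2 := HA (i |` A)%fset (fsubsetU1 _ _).
rewrite !partial_sumE in h1 h2; rewrite big_fsetU1 //= in h2.
apply: (@le_trans _ _ 2); last by rewrite lerDl.
have -> : u i = (u i + \sum_(j <- A) u j - l) - (\sum_(j <- A) u j - l) by ring.
by apply: le_trans (cabsB _ _) _; apply: ltW; have -> : (2 : R) = 1 + 1 by []; exact: ltrD.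
Qed.

(** Unconditional convergence at one point with nonzero entries bounds the terms
    of the first series, which thus converges absolutely on smaller tori;
    there the coefficients of both series are means of the common sum. *)
Lemma mseries_unique_near0 n (rad : 'rV[\bar R]_n) (p c : mindex n -> R[i]) F :
  (forall k, (0 < rad ord0 k)%E) -> mseries rad c F ->
  (\forall th \near (0 : 'rV[R[i]]_n), hsum (fun K => p K * mpow th K) (F th)) -> p =1 c.
Proof.
move=> r0 cF /near0_box [e e0 He] I.
have [s s0 srad] := exists_radius r0.
pose t2 : 'rV[R]_n := const_mx (e / 2).
have t20 : vlt 0 t2 by move=> k; rewrite !mxE divr_gt0.
have [B HB] : exists B, forall K, cabs (p K) <= B / mpow t2 K.
  have [|B HB] := hsum_bounded (He (cvec t2) _).
    by move=> k; rewrite !mxE cabs_real gtr0_norm ?divr_gt0 //; lra.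
  exists B => K; rewrite ler_pdivlMr ?mpow_gt0 //.
  apply: le_trans (HB K); rewrite cabsM (cabs_mpow_torus (s := t2)) // => k.
  by rewrite !mxE cabs_real gtr0_norm // divr_gt0.
pose t : 'rV[R]_n := \row_k (Num.min (s ord0 k) (e / 4)).
have t0 : vlt 0 t.
  by move=> k; rewrite !mxE lt_min divr_gt0 // andbT; have := s0 k; rewrite mxE.
have tt2 : vlt t t2.
  move=> k; rewrite !mxE; have : Num.min (s ord0 k) (e / 4) <= e / 4 by rewrite ge_min lexx orbT.
  lra.
have trad : vlt (map_mx EFin t) rad.
  move=> k; apply: le_lt_trans (srad k); rewrite !mxE lee_fin.
  by rewrite ge_min lexx.
have h1 := mseries_tmean (I := I) cF t0 trad.
have h2 : tmean N t (fun z => F z / mpow z I) @[N --> \oo] --> p I.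
  apply: (coef_tmean t0 (summ_coef (vltW t0) tt2 HB)) => z zt; apply: He => k.
  by rewrite zt; have := tt2 k; rewrite !mxE; lra.
exact: (cvg_uniqueC h2 h1).
Qed.

End Uniqueness.

(** * Cumulant-generating functions and Appell polynomials *)

Section CumulantGeneratingFunction.
Context {d : measure_display} {T : measurableType d} {R : realType} (P : probability T R).
Variables (n : nat) (Z : T -> 'rV[R]_n) (rad : 'rV[\bar R]_n) (K : 'rV[R[i]]_n -> R[i]).
Hypothesis mZ : forall k, measurable_fun setT (fun w => Z w ord0 k).
Hypothesis rad0 : forall k, (0 < rad ord0 k)%E.
Hypothesis mgfZ : mgf_defined P Z rad.
Hypothesis HK : is_cgf P Z rad K.

Lemma cgf_closed_bound s : vlt 0 s -> vlt (map_mx EFin s) rad ->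
  exists2 B : R, 0 <= B & forall th, on_torus s th -> cabs (cexp (- K th)) <= B.
Proof.
move=> s0 srad.
have [|B B0 HB] := @bounded_on_closed_polydisc R n s (fun th => cexp (- K th)).
  move=> th hth; apply: differentiable_cexp_comp; apply: differentiableN.
  have [hol _ _] := HK; apply: hol; apply/polydiscP => k.
  by apply: le_lt_trans (srad k); rewrite mxE lee_fin.
by exists B => // th hth; apply: HB => k; rewrite hth.
Qed.

(** Defined on the whole polydisc without division, by means of the logarithm
    [K] of the moment-generating function. *)
Definition appell_gen (z th : 'rV[R[i]]_n) : R[i] := cexp (dot th z - K th).

Lemma appell_gen_mgf z th : polydisc rad th -> appell_gen z th = cexp (dot th z) / mgf P Z th.
Proof. by have [_ _ HM] := HK; move=> /HM <-; rewrite /appell_gen cexpD cexpN. Qed.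

Lemma holomorphic_appell_gen z : holomorphic_on (polydisc rad) (appell_gen z).
Proof.
move=> th hth; apply: differentiable_cexp_comp; apply: differentiableB.
  exact: differentiable_dot.
by have [hol _ _] := HK; exact: hol.
Qed.

(** The expansion of [appell_gen] satisfies the defining property of Appell
    polynomials, so these exist, and uniqueness of power series identifies
    them. *)
Lemma egf_appell z : egf rad (fun J => appell P Z J z) (appell_gen z).
Proof.
pose c z J := mpartial J (appell_gen z) 0.
have cE z' : egf rad (c z') (appell_gen z') := holomorphic_egf rad0 (holomorphic_appell_gen z').
have ex : is_appell P Z (appell P Z).
  apply: getPex; exists (fun J z => c z J) => z'.
  apply: filterS (near0_polydisc rad0) => th hth.
  rewrite -appell_gen_mgf //; apply: (hsum_ext (proj2 (cE z') th hth)) => J.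
  by rewrite mulrAC.
have near1 : \forall th \near (0 : 'rV[R[i]]_n),
    hsum (fun J => appell P Z J z / (mfact J)%:R * mpow th J) (appell_gen z th).
  near=> th; have hth : polydisc rad th by near: th; exact: near0_polydisc.
  have h : hsum (fun J => appell P Z J z * mpow th J / (mfact J)%:R) (cexp (dot th z) / mgf P Z th).
    by near: th; exact: ex.
  rewrite appell_gen_mgf //; apply: (hsum_ext h) => J; exact: mulrAC.
have e := mseries_unique_near0 rad0 (cE z) near1.
by apply: (mseries_ext (cE z)) => J; rewrite -e.
Unshelve. all: by end_near.
Qed.

(** Cauchy's formula for the coefficients of the generating function writes
    each Appell polynomial as a superposition of exponentials. *)
Lemma appell_superposition s : vlt 0 s -> vlt (map_mx EFin s) rad ->
  exists2 B : R, 0 <= B & forall J, exists2 gam,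
    superposition s gam (fun z => appell P Z J z / (mfact J)%:R) &
    forall th, on_torus s th -> cabs (gam th) <= B / mpow s J.
Proof.
move=> s0 srad; have [B B0 HB] := cgf_closed_bound s0 srad.
exists B => // J; exists (fun th => cexp (- K th) / mpow th J).
  move=> z; apply: (tmean_cvg_ext (vltW s0) _ (mseries_tmean (I := J) (egf_appell z) s0 srad)) => th _.
  by rewrite /appell_gen cexpD mulrAC [cexp (- _) * _]mulrC.
move=> th hth; rewrite cabsM cabsV (cabs_mpow_torus _ hth).
by rewrite ler_wpM2r ?HB // invr_ge0 ltW // mpow_gt0.
Qed.

Lemma coord_superposition (k : 'I_n) (s : 'rV[R]_n) : vlt 0 s ->
  superposition s (fun th => (mpow th (mone k))^-1) (fun z => z ord0 k).
Proof.
move=> s0 z.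
have r0 j : (0 < unbounded_rad R n ord0 j)%E by rewrite mxE ltry.
have h := mseries_tmean (I := mone k) (egf_cexp_dot z r0) s0 (unbounded_rad_gt s).
rewrite mpow_mone -{2}[mone k]add0r mfact_mone mxE mfact0 divr1 in h.
apply: (tmean_cvg_ext (vltW s0) _ h) => th _; exact: mulrC.
Qed.

(** A coordinate is the superposition of exponentials with density [1 / th_k],
    so its expectation is the first-order coefficient of [M = exp K], and
    [K 0 = 0]. *)
Lemma expectation_coord k :
  cintegrable P (fun w => cvec (Z w) ord0 k) /\
  cexpectation P (fun w => cvec (Z w) ord0 k) = partial k K 0.
Proof.
have [s s0 srad] := exists_radius rad0.
have gB th : on_torus s th -> cabs ((mpow th (mone k))^-1) <= (mpow s (mone k))^-1.
  by move=> hth; rewrite cabsV (cabs_mpow_torus _ hth).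
have [ci c1] := superposition_expectation mZ mgfZ (vltW s0) srad (coord_superposition (k := k) s0) gB.
split => //.
have [hol K0 HM] := HK.
have holE : holomorphic_on (polydisc rad) (fun th => cexp (K th)).
  by move=> th /hol h; exact: differentiable_cexp_comp.
have e := holomorphic_egf rad0 holE.
have h := mseries_tmean (I := mone k) e s0 srad.
have e1 : mpartial (mone k) (fun th => cexp (K th)) 0 = partial k K 0.
  have := egf_at0 rad0 (egf_partial k e); rewrite add0r => <-.
  by rewrite (partial_cexp_comp _ (hol _ (polydisc0 rad0))) K0 cexp0 mulr1.
move: h; rewrite e1 -{2}[mone k]add0r mfact_mone mxE mfact0 divr1 => h.
apply: (cvg_uniqueC c1); apply: (tmean_cvg_ext (vltW s0) _ h) => th hth.
by rewrite -(HM _ (on_torus_polydisc srad hth)); exact: mulrC.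
Qed.

End CumulantGeneratingFunction.

Section NormalConvergence.
Context {d : measure_display} {T : measurableType d} {R : realType} (P : probability T R).
Variables (n : nat) (I : choiceType) (u : I -> 'rV[R[i]]_n -> R[i]) (g : I -> R) (s : 'rV[R]_n).
Hypothesis s0 : vle 0 s.
Hypothesis g0 : forall i, 0 <= g i.
Hypothesis sg : summ g.
Hypothesis ug : forall i z, cabs (u i z) <= g i * expR (dot s (vabs z)).

(** Near a point the exponential factor is bounded. *)
Lemma normal_abs_cvg_locally_uniformly : abs_cvg_locally_uniformly u.
Proof.
move=> z0; pose v : 'rV[R]_n := \row_k (cabs (z0 ord0 k) + 1).
exists (ball z0 (1 : R[i])).
  exact: nbhsx_ballx.
pose E := expR (dot s v).
have E0 : 0 <= E by exact: expR_ge0.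
apply: (@le_lt_trans _ _ (\esum_(i in setT) (E * g i)%:E)%E); last first.
  by apply: esum_fin; [move=> i; exact: mulr_ge0|exact: summZ].
apply: le_esum => i _; apply: ge_ereal_sup => _ [z [_ hz] <-]; rewrite lee_fin.
apply: le_trans (ug i z) _; rewrite mulrC ler_wpM2r // ler_expR.
apply: ler_sum => k _; apply: ler_wpM2l; first by have := s0 k; rewrite mxE.
rewrite !mxE -lerBlDl.
have := hz ord0 k; rewrite /ball /= normCE -[1]/(1%:C%C) ltcR cabsC => /ltW; apply: le_trans.
by rewrite lerBlDr; apply: le_trans (cabsD _ _); rewrite subrK.
Qed.

Variables (Z : T -> 'rV[R]_n) (rad : 'rV[\bar R]_n).
Hypothesis mZ : forall k, measurable_fun setT (fun w => Z w ord0 k).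
Hypothesis mgfZ : mgf_defined P Z rad.
Hypothesis srad : vlt (map_mx EFin s) rad.
Hypothesis ui : forall i, cintegrable P (fun w => u i (cvec (Z w))).

Lemma normal_abs_cvg_L1 : abs_cvg_L1 P Z u.
Proof.
split=> //; apply: (@le_lt_trans _ _ (\esum_(i in setT) (mexp P Z s * g i)%:E)%E); last first.
  apply: esum_fin => [i|]; first by rewrite mulr_ge0 // mexp_ge0.
  by apply: summZ => //; exact: mexp_ge0.
apply: le_esum => i _; rewrite mulrC.
by apply: (L1norm_le mZ mgfZ s0 srad) => //; exact: cintegrable_measurable.
Qed.

End NormalConvergence.

Section Pairing.
Variable R : realType.

(** The terms are bounded by [M |b_I / I!| s^I] on every grid, so the sum and
    the limit of the means may be exchanged. *)
Lemma torus_pairing n (s : 'rV[R]_n) (rad : 'rV[\bar R]_n) (b A : mindex n -> R[i]) phi om (M : R) :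
  vlt 0 s -> vlt (map_mx EFin s) rad -> egf rad b phi ->
  (forall xi, on_torus s xi -> cabs (om xi) <= M) ->
  (forall I, tmean N s (fun xi => mpow xi I * om xi) @[N --> \oo] --> A I) ->
  exists2 l, hsum (fun I => A I * b I / (mfact I)%:R) l &
             tmean N s (fun xi => om xi * phi xi) @[N --> \oo] --> l.
Proof.
move=> s0 srad Hb HM HA.
pose g (I : mindex n) := cabs (b I / (mfact I)%:R) * mpow s I.
have sg : summ g by exact: (summ_pseries Hb (vltW s0) srad).
have [M0 M00 HM0] : exists2 M0 : R, 0 <= M0 & forall xi, on_torus s xi -> cabs (om xi) <= M0.
  exists (Num.max M 0); first by rewrite le_max lexx orbT.
  by move=> xi /HM h; rewrite le_max h.
have tI N I : cabs (tmean N s (fun xi => mpow xi I * om xi)) <= mpow s I * M0.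
  apply: (cabs_tmean_le _ (vltW s0)) => xi hxi; rewrite cabsM (cabs_mpow_torus _ hxi).
  by rewrite ler_wpM2l ?HM0 // mpow_ge0 //; exact: vltW.
have [l Hl] : exists l, hsum (fun I => A I * b I / (mfact I)%:R) l.
  apply: (@hsum_exists _ _ _ (fun I => M0 * g I)); last exact: summZ.
  move=> I; rewrite -mulrA cabsM [_ * cabs (b I / _)]mulrC /g mulrCA ler_wpM2l ?cabs_ge0 //.
  by apply: (cvg_cabs_lim_le (HA I)); apply: nearW => N; rewrite mulrC; exact: tI.
exists l => //.
pose u N I := tmean N s (fun xi => om xi * (b I / (mfact I)%:R * mpow xi I)).
have uE N I : u N I = b I / (mfact I)%:R * tmean N s (fun xi => mpow xi I * om xi).
  rewrite -tmeanZ; apply: (tmean_ext _ (vltW s0)) => xi _; ring.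
have k1 : \forall N \near \oo, forall I, cabs (u N I) <= M0 * g I.
  apply: nearW => N I; rewrite uE cabsM /g mulrCA ler_wpM2l ?cabs_ge0 //.
  by rewrite mulrC; exact: tI.
have k2 : summ (fun I => M0 * g I) by exact: summZ.
have k3 I : u N I @[N --> \oo] --> A I * b I / (mfact I)%:R.
  rewrite (_ : (fun N => _) = fun N => b I / (mfact I)%:R * tmean N s (fun xi => mpow xi I * om xi)).
    rewrite -mulrA [X in _ --> X]mulrC; exact: cvg_scale (HA I).
  by apply/funext => N; exact: uE.
have k4 : \forall N \near \oo, hsum (u N) (tmean N s (fun xi => om xi * phi xi)).
  apply: nearW => N; apply: (hsum_tmean (u := fun xi I => om xi * (b I / (mfact I)%:R * mpow xi I)) (vltW s0)) => xi hxi.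
  by apply: hsumZ; apply: (proj2 Hb); exact: on_torus_polydisc hxi.
exact: (tannery k1 k2 k3 k4 Hl).
Qed.

End Pairing.

(** * The Wick product with the last coordinate *)

Section JointVectors.
Context {d0 : measure_display} {T : measurableType d0} {R : realType} (P : probability T R).
Variables (n : nat) (X : 'I_n -> {RV P >-> R}) (Y : {RV P >-> R}).

Lemma adjoin_rvE w : adjoin_rv X Y w = vsnoc (random_vector X w) (Y w).
Proof. by []. Qed.

Lemma measurable_random_vector k : measurable_fun setT (fun w => random_vector X w ord0 k).
Proof.
rewrite (_ : (fun w => _) = X k); last by apply/funext => w; rewrite mxE.
exact: measurable_funPT.
Qed.

Lemma measurable_adjoin_rv k : measurable_fun setT (fun w => adjoin_rv X Y w ord0 k).
Proof.
case: (splitP k) => j kj.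
  have -> : k = lshift 1 j by exact: val_inj.
  rewrite (_ : (fun w => _) = X j); first exact: measurable_funPT.
  by apply/funext => w; rewrite adjoin_rvE vsnocL mxE.
have -> : k = rshift n j by exact: val_inj.
rewrite (_ : (fun w => _) = Y); first exact: measurable_funPT.
by apply/funext => w; rewrite adjoin_rvE vsnocR.
Qed.

Variables (RX : 'rV[\bar R]_n) (RY : \bar R).
Hypothesis RY0 : (0 < RY)%E.
Hypothesis mgfZ : mgf_defined P (adjoin_rv X Y) (vsnoc RX RY).

Lemma mgf_defined_marginal : mgf_defined P (random_vector X) RX.
Proof.
move=> q q0 qRX.
have h0 : vle 0 (vsnoc q 0).
  move=> k; rewrite [X in (X <= _)%O]mxE.
  by apply: (@vsnocP R n (fun _ x => 0 <= x) q 0) => // i; have := q0 i; rewrite mxE.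
have h1 : vlt (map_mx EFin (vsnoc q 0)) (vsnoc RX RY).
  by rewrite vsnoc_EFin; exact: vlt_vsnoc.
have := mgfZ h0 h1; rewrite (_ : (fun w => _) = fun w => expR (dot q (map_mx Num.norm (random_vector X w)))) //.
apply/funext => w; rewrite adjoin_rvE; congr expR.
rewrite /vsnoc map_row_mx -/(vsnoc q 0) (_ : map_mx _ (const_mx _) = const_mx `|Y w|); last first.
  by apply/rowP => k; rewrite !mxE.
by rewrite dot_vsnoc mul0r addr0.
Qed.

Lemma mgf_marginal xi : mgf P (adjoin_rv X Y) (vsnoc xi 0) = mgf P (random_vector X) xi.
Proof.
rewrite /mgf; congr cexpectation; apply/funext => w.
by rewrite adjoin_rvE cvec_vsnoc dot_vsnoc mul0r addr0.
Qed.

End JointVectors.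

Lemma cexpectation1 {d0 : measure_display} {T : measurableType d0} {R : realType}
    (P : probability T R) : cintegrable P (fun=> 1) /\ cexpectation P (fun=> 1) = 1.
Proof.
have h1 : P.-integrable setT (fun _ : T => (1 : R)%:E).
  by apply: finite_measure_integrable_cst.
split; first by split => //; exact: integrable0.
by rewrite /cexpectation /= !expectation_cst.
Qed.

Section WickProduct.
Context {d0 : measure_display} {T : measurableType d0} {R : realType} (P : probability T R).
Variables (n : nat) (X : 'I_n -> {RV P >-> R}) (Y : {RV P >-> R}).
Variables (RX : 'rV[\bar R]_n) (RY : \bar R) (K : 'rV[R[i]]_(n + 1) -> R[i]).
Hypothesis RX0 : forall k, (0 < RX ord0 k)%E.
Hypothesis RY0 : (0 < RY)%E.
Local Notation Z := (adjoin_rv X Y).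
Local Notation Xv := (random_vector X).
Local Notation RZ := (vsnoc RX RY).
Hypothesis mgfZ : mgf_defined P Z RZ.
Hypothesis HK : is_cgf P Z RZ K.

Variables (a : mindex n -> R[i]) (f : 'rV[R[i]]_n -> R[i]) (C : R) (r rho : 'rV[R]_n).
Hypothesis Ha : egf (unbounded_rad R n) a f.
Hypothesis aC : forall I, cabs (a I) <= C * mpow r I.
Hypothesis r0 : vle 0 r.
Hypothesis rrho : vlt r rho.
Hypothesis rhoRX : vlt (map_mx EFin rho) RX.

Let mX := measurable_random_vector X.
Let mgfX : mgf_defined P Xv RX := mgf_defined_marginal RY0 mgfZ.

Let rho0 : vlt 0 rho.
Proof. by move=> k; apply: le_lt_trans (rrho k). Qed.

Let RZ0 k : (0 < RZ ord0 k)%E.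
Proof. exact: (@vsnocP _ n (fun _ x => (0 < x)%E) RX RY). Qed.

Let last : 'I_(n + 1) := rshift n ord0.

(** The first-order dependence of the cumulant-generating function on the last
    variable; its Taylor coefficients are the cumulants with a single [Y]. *)
Definition cross_cgf (xi : 'rV[R[i]]_n) : R[i] := partial last K (vsnoc xi 0).

Definition cross_cumulant (I : mindex n) : R[i] := joint_cumulant K (vsnoc I 1%N).

Let vsnoc0D (I : mindex n) j : vsnoc I j + mone last = vsnoc I j.+1.
Proof. by rewrite mone_last vsnocD addr0 (addn1 j). Qed.

Let polydisc_slice xi : polydisc RX xi -> polydisc RZ (vsnoc xi 0).
Proof. by move=> h; apply: polydisc_vsnoc; rewrite ?cabs0. Qed.

Lemma egf_cross : egf RX cross_cumulant cross_cgf.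
Proof.
have [hol _ _] := HK.
have h := egf_slice RY0 (egf_partial last (holomorphic_egf RZ0 hol)).
by apply: (egf_ext h) => I; rewrite vsnoc0D.
Qed.

Lemma egf_appell0 z : egf RX (fun I => appell P Z (vsnoc I 0%N) z)
  (fun xi => appell_gen K z (vsnoc xi 0)).
Proof. exact: egf_slice RY0 (egf_appell RZ0 HK z). Qed.

Lemma egf_appell1 z : egf RX (fun I => appell P Z (vsnoc I 1%N) z)
  (fun xi => partial last (appell_gen K z) (vsnoc xi 0)).
Proof.
apply: (egf_ext (egf_slice RY0 (egf_partial last (egf_appell RZ0 HK z)))) => I.
by rewrite vsnoc0D.
Qed.

Lemma partial_appell_gen z xi : polydisc RX xi ->
  partial last (appell_gen K z) (vsnoc xi 0) =
  (z ord0 last - cross_cgf xi) * appell_gen K z (vsnoc xi 0).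
Proof.
move=> /polydisc_slice h; have [hol _ _] := HK.
have dK := hol _ h.
have [dd DD] := is_derive_dot z (vsnoc xi 0) last.
have dG := differentiableB (differentiable_dot z (vsnoc xi 0)) dK.
have e : partial last (fun th => dot th z - K th) (vsnoc xi 0) = z ord0 last - cross_cgf xi.
  by rewrite /cross_cgf /partial -DD; exact: (deriveB dd (diff_derivable dK)).
exact: (etrans (partial_cexp_comp last dG) (congr1 (fun c => c * _) e)).
Qed.

Local Notation beta := (borel_density a).
Local Notation bound := (borel_bound C r rho).
Local Notation coef I := (cexpectation P (fun w => mpartial I f (cvec (Xv w)))).

Let beta_le xi : on_torus rho xi -> cabs (beta xi) <= bound.
Proof. exact: borel_density_le. Qed.

Let gam_le I xi : on_torus rho xi -> cabs (mpow xi I * beta xi) <= mpow rho I * bound.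
Proof.
move=> h; rewrite cabsM (cabs_mpow_torus _ h) ler_wpM2l ?beta_le //.
by apply: mpow_ge0; exact: vltW.
Qed.

Lemma cabs_mpartial_le I z : cabs (mpartial I f z) <= mpow rho I * bound * expR (dot rho (vabs z)).
Proof.
exact: (superposition_le (vltW rho0) (superposition_mpartial Ha aC r0 rrho (I := I)) (gam_le I)).
Qed.

Lemma coef_superposition I :
  cintegrable P (fun w => mpartial I f (cvec (Xv w))) /\
  tmean N rho (fun xi => mpow xi I * beta xi * mgf P Xv xi) @[N --> \oo] --> coef I.
Proof.
exact: (superposition_expectation mX mgfX (vltW rho0) rhoRX
  (superposition_mpartial Ha aC r0 rrho (I := I)) (gam_le I)).
Qed.

Lemma bound_ge0 : 0 <= bound.
Proof.
have h : on_torus rho (cvec rho).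
  by move=> k; rewrite !mxE cabs_real gtr0_norm //; have := rho0 k; rewrite mxE.
by apply: le_trans (beta_le h); exact: cabs_ge0.
Qed.

Lemma cabs_coef_le I : cabs (coef I) <= bound * (2 * mexp P Xv rho) * mpow rho I.
Proof.
apply: (cvg_cabs_lim_le (proj2 (coef_superposition I))); apply: nearW => N.
apply: (cabs_tmean_le _ (vltW rho0)) => xi h; rewrite cabsM.
apply: (@le_trans _ _ (mpow rho I * bound * (2 * mexp P Xv rho))).
  by apply: ler_pM; rewrite ?cabs_ge0 ?gam_le ?(cabs_mgf_le mX mgfX (vltW rho0) rhoRX h).
by rewrite -mulrA mulrC.
Qed.

Let mgf_slice xi : polydisc RX xi -> mgf P Xv xi != 0.
Proof.
by move=> /polydisc_slice h; have [_ _ HM] := HK; rewrite -(mgf_marginal X Y) -HM // cexp_neq0.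
Qed.

(** The moment-generating function that expectations contribute cancels the
    one in the generating function of the Appell polynomials. *)
Let cancel_mgf x y xi : polydisc RX xi ->
  mgf P Xv xi * appell_gen K (vsnoc x y) (vsnoc xi 0) = cexp (dot xi x).
Proof.
move=> h; rewrite (appell_gen_mgf HK _ (polydisc_slice h)) dot_vsnoc mul0r addr0 mgf_marginal.
by rewrite mulrC divfK // mgf_slice.
Qed.

Let om xi := beta xi * mgf P Xv xi.

Let om_le xi : on_torus rho xi -> cabs (om xi) <= bound * (2 * mexp P Xv rho).
Proof.
move=> h; rewrite cabsM; apply: ler_pM; rewrite ?cabs_ge0 ?beta_le //.
exact: (cabs_mgf_le mX mgfX (vltW rho0) rhoRX h).
Qed.

Let om_coef I : tmean N rho (fun xi => mpow xi I * om xi) @[N --> \oo] --> coef I.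
Proof.
apply: (tmean_cvg_ext (vltW rho0) _ (proj2 (coef_superposition I))) => xi _; exact: mulrA.
Qed.

Let f_superposition x : tmean N rho (fun xi => beta xi * cexp (dot xi x)) @[N --> \oo] --> f x.
Proof.
have h := superposition_mpartial Ha aC r0 rrho (I := 0) (z := x).
rewrite mpartial0 in h.
by apply: (tmean_cvg_ext (vltW rho0) _ h) => xi _; rewrite mpow0 mul1r.
Qed.

(** The Appell expansion of [f], seen as a function of [(x, y)]: only indices
    [(I, 0)] occur. *)
Lemma hsum_appell_expansion x y :
  hsum (fun I => coef I * appell P Z (vsnoc I 0%N) (vsnoc x y) / (mfact I)%:R) (f x).
Proof.
have [l Hl cl] := torus_pairing rho0 rhoRX (egf_appell0 (vsnoc x y)) om_le om_coef.
have -> // : f x = l.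
apply: (cvg_uniqueC (f_superposition (x := x))).
apply: (tmean_cvg_ext (vltW rho0) _ cl) => xi h.
by rewrite -mulrA cancel_mgf //; exact: on_torus_polydisc h.
Qed.

(** The factor [y - k(xi)] that differentiation in the last variable produces
    splits the sum into [f(x) y] and the series of the corrections. *)
Lemma hsum_appell_correction x : exists2 Sk,
  hsum (fun I => wick_correction f K I x) Sk &
  forall y, hsum (fun I => coef I * appell P Z (vsnoc I 1%N) (vsnoc x y) / (mfact I)%:R) (f x * y - Sk).
Proof.
pose omx xi := beta xi * cexp (dot xi x).
have omx_le xi : on_torus rho xi -> cabs (omx xi) <= bound * expR (dot rho (vabs x)).
  move=> h; rewrite cabsM; apply: ler_pM; rewrite ?cabs_ge0 ?beta_le //.
  by apply: cabs_cexp_dot_le => k; rewrite h.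
have omx_coef I : tmean N rho (fun xi => mpow xi I * omx xi) @[N --> \oo] --> mpartial I f x.
  have h := superposition_mpartial Ha aC r0 rrho (I := I) (z := x).
  apply: (tmean_cvg_ext (vltW rho0) _ h) => xi _; exact: mulrA.
have [Sk HSk cSk] := torus_pairing rho0 rhoRX egf_cross omx_le omx_coef.
exists Sk => [|y]; first by apply: (hsum_ext HSk) => I; rewrite mulrAC.
have [l Hl cl] := torus_pairing rho0 rhoRX (egf_appell1 (vsnoc x y)) om_le om_coef.
have -> // : f x * y - Sk = l.
have c2 : tmean N rho (fun xi => om xi * partial last (appell_gen K (vsnoc x y)) (vsnoc xi 0))
    @[N --> \oo] --> y * f x - Sk.
  have h := cvg_scaleB (c := y) (f_superposition (x := x)) cSk.
  rewrite (_ : (fun N => _) = fun N => y * tmean N rho (fun xi => beta xi * cexp (dot xi x)) -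
    tmean N rho (fun xi => omx xi * cross_cgf xi)); first exact: h.
  apply/funext => N; apply/esym.
  rewrite -tmeanZ -tmeanB; apply: (tmean_ext _ (vltW rho0)) => xi hxi.
  have hp := on_torus_polydisc rhoRX hxi.
  rewrite (partial_appell_gen _ hp) vsnocR /om /omx -(cancel_mgf x y hp); ring.
by rewrite [f x * y]mulrC; exact: (cvg_uniqueC c2 cl).
Qed.

Let EY := expectation_coord (measurable_adjoin_rv X Y) RZ0 mgfZ HK last.

Lemma mean_last : cexpectation P (fun w => last_coord (cvec (Z w))) = cross_cumulant 0.
Proof.
rewrite -(egf_at0 RX0 egf_cross) /cross_cgf vsnoc00; exact: (proj2 EY).
Qed.

Let lsubmx_Z w : lsubmx (cvec (Z w)) = cvec (Xv w).
Proof. by rewrite adjoin_rvE cvec_vsnoc lsubmx_vsnoc. Qed.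

Lemma expectation_lift L :
  cintegrable P (fun w => mpartial L (lift_fun f) (cvec (Z w))) /\
  appell_coef P Z (lift_fun f) L = lift_coef (fun I => coef I) L.
Proof.
rewrite /appell_coef.
have -> : (fun w => mpartial L (lift_fun f) (cvec (Z w))) =
    fun w => lift_coef (fun I => mpartial I f (cvec (Xv w))) L.
  by apply/funext => w; rewrite (mpartial_lift _ _ Ha) lsubmx_Z.
rewrite /lift_coef; case: eqP => _; first by split=> //; exact: (proj1 (coef_superposition _)).
by split; [exact: cintegrable0|exact: cexpectation0].
Qed.

Lemma expectation_last J :
  cintegrable P (fun w => mpartial J (@last_coord R n) (cvec (Z w))) /\
  appell_coef P Z (@last_coord R n) J = if J == 0 then cross_cumulant 0 else (J == mone last)%:R.
Proof.
rewrite /appell_coef.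
have -> : (fun w => mpartial J (@last_coord R n) (cvec (Z w))) =
    fun w => if J == 0 then last_coord (cvec (Z w)) else (J == mone last)%:R.
  by apply/funext => w; exact: mpartial_last_coord.
case: eqP => _; first by split; [exact: (proj1 EY)|exact: mean_last].
case: eqP => _; first exact: cexpectation1.
by split; [exact: cintegrable0|exact: cexpectation0].
Qed.

Local Notation wterm := (wick_term P Z (lift_fun f) (@last_coord R n)).

(** The pairs of multiindices that contribute: the derivatives of the last
    coordinate vanish except for orders [0] and [1], those of [f] when they
    involve the last variable. *)
Let phi (b : bool) (I : mindex n) : mindex (n + 1) * mindex (n + 1) :=
  (vsnoc I 0%N, vsnoc 0 (b : nat)).

Let vsnoc0b (b : bool) : (vsnoc 0 (b : nat) == 0 :> mindex (n + 1)) = ~~ b.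
Proof.
case: b; rewrite ?vsnoc00 ?eqxx //; apply/negbTE/eqP => /rowP /(_ last).
by rewrite vsnocR mxE.
Qed.

Lemma wick_term_phi (b : bool) I z : wterm (phi b I) z =
  coef I * (if b then 1 else cross_cumulant 0) *
    (appell P Z (vsnoc I (b : nat)) z / (mfact (vsnoc I (b : nat)))%:R).
Proof.
rewrite /wick_term /= (proj2 (expectation_lift _)) lift_coef0 (proj2 (expectation_last _)).
rewrite vsnoc0b vsnocD addr0 !mfact_vsnoc mfact0.
have -> : (b : nat)`! = 1%N by case: b.
by case: b; rewrite /= ?mone_last ?eqxx -natrM !muln1.
Qed.

Lemma wick_term_eq0 p z : (forall b I, p <> phi b I) -> wterm p z = 0.
Proof.
case: p => L J H; rewrite /wick_term /= (proj2 (expectation_lift _)) (proj2 (expectation_last _)).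
case E : (L ord0 last) => [|m]; last by rewrite -(vsnoc_eta L) E lift_coefS !mul0r.
have EL : L = vsnoc (lsubmx L) 0%N by rewrite -{1}(vsnoc_eta L) E.
case: eqP => [J0|_]; first by case: (H false (lsubmx L)); rewrite /phi -EL J0 vsnoc00.
case: eqP => [Jm|_]; first by case: (H true (lsubmx L)); rewrite /phi -EL Jm mone_last.
by rewrite mulr0 mul0r.
Qed.

Let phi_inj b : injective (phi b).
Proof. by move=> I I' /(congr1 (fun p => lsubmx p.1)) /=; rewrite !lsubmx_vsnoc. Qed.

(** The contributing pairs split into two families, each summed by one of the
    two previous expansions. *)
Lemma hsum_wick x : exists2 Sk,
  hsum (fun I => wick_correction f K I x) Sk &
  forall y, hsum (fun p => wterm p (vsnoc x y)) (cross_cumulant 0 * f x + (f x * y - Sk)).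
Proof.
have [Sk HSk H1] := hsum_appell_correction x.
exists Sk; [exact: HSk|move=> y].
pose u (b : bool) (p : mindex (n + 1) * mindex (n + 1)) : R[i] := if p.2 == vsnoc 0 (b : nat) then wterm p (vsnoc x y) else 0.
have uE p : wterm p (vsnoc x y) = u false p + u true p.
  rewrite /u; case: eqP => [->|h0].
    by rewrite vsnoc00 eq_sym (vsnoc0b true) addr0.
  case: eqP => [//|h1]; rewrite ?add0r //.
  apply: wick_term_eq0 => -[] I pI; [apply: h1|apply: h0]; by rewrite pI.
have u0 b p : (forall I, p <> phi b I) -> u b p = 0.
  rewrite /u; case: eqP => // p2 H; apply: wick_term_eq0 => b' I pI.
  apply: (H I); move: p2; rewrite pI /= => /(congr1 (fun v : mindex (n + 1) => v ord0 last)).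
  by rewrite !vsnocR; case: b b' {H pI} => -[].
have hu b l : hsum (fun I => coef I * (if b then 1 else cross_cumulant 0) *
    (appell P Z (vsnoc I (b : nat)) (vsnoc x y) / (mfact (vsnoc I (b : nat)))%:R)) l -> hsum (u b) l.
  move=> h; apply: (@hsum_inj R _ _ _ (phi_inj (b := b)) (u b) l (u0 b)).1; apply: (hsum_ext h) => I.
  by rewrite /u /= eqxx wick_term_phi.
have h0 : hsum (u false) (cross_cumulant 0 * f x).
  apply: (@hu false); have h := hsumZ (k := cross_cumulant 0) (hsum_appell_expansion (x := x) y).
  apply: (hsum_ext h) => I.
  rewrite mfact_vsnoc (_ : (false : nat)`! = 1%N) // muln1; ring.
have h1 : hsum (u true) (f x * y - Sk).
  apply: (@hu true); apply: (hsum_ext (H1 y)) => I.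
  rewrite mfact_vsnoc (_ : (true : nat)`! = 1%N) // muln1; ring.
by apply: (hsum_ext (hsumD h0 h1)) => p; rewrite uE.
Qed.

(** A geometric majorant in both multiindices; the ratio [1/2] for the second
    one makes the majorant summable over all pairs and costs a factor [2],
    as only orders [0] and [1] contribute. *)
Lemma wick_term_dominated : exists (s : 'rV[R]_(n + 1)) (g : mindex (n + 1) * mindex (n + 1) -> R),
  [/\ vle 0 s, vlt (map_mx EFin s) RZ, forall p, 0 <= g p, summ g &
      forall p z, cabs (wterm p z) <= g p * expR (dot s (vabs z))] /\
  forall p, cintegrable P (fun w => wterm p (cvec (Z w))).
Proof.
have [sg rhosg sgRX] := vradius_between rhoRX.
have [t t0 tRY] := radius_between RY0.
have sg0 : vlt 0 sg by move=> k; apply: lt_trans (rhosg k).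
pose s := vsnoc sg t.
have s0 : vlt 0 s by exact: vlt0_vsnoc.
have sRZ : vlt (map_mx EFin s) RZ by rewrite /s vsnoc_EFin; exact: vlt_vsnoc.
have [B B0 HB] := appell_superposition RZ0 HK s0 sRZ.
have appell_le J z : cabs (appell P Z J z / (mfact J)%:R) <= B / mpow s J * expR (dot s (vabs z)).
  by have [gam h1 h2] := HB J; exact: (superposition_le (vltW s0) h1 h2).
have appell_int J : cintegrable P (fun w => appell P Z J (cvec (Z w)) / (mfact J)%:R).
  have [gam h1 h2] := HB J.
  exact: (proj1 (superposition_expectation (measurable_adjoin_rv X Y) mgfZ (vltW s0) sRZ h1 h2)).
pose M0 := bound * (2 * mexp P Xv rho).
have M00 : 0 <= M0 by apply: mulr_ge0; [exact: bound_ge0|apply: mulr_ge0 => //; exact: mexp_ge0].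
(* [kk] and [1 + t^-1] cover the orders [0] and [1] at once. *)
pose kk := 1 + cabs (cross_cumulant 0).
have kk0 : 0 <= kk by rewrite addr_ge0 ?cabs_ge0.
pose h : R := 2^-1.
pose q : 'rV[R]_(n + 1) := vsnoc (\row_k (rho ord0 k / sg ord0 k)) h.
pose q' : 'rV[R]_(n + 1) := const_mx h.
have h0 : 0 <= h by rewrite invr_ge0.
have h1 : h < 1 by rewrite /h; lra.
have qP (Q : R -> Prop) : Q h -> (forall k, Q (rho ord0 k / sg ord0 k)) -> forall k, Q (q ord0 k).
  by move=> Qh Qk; apply: (@vsnocP R n (fun _ x => Q x)) => // k; rewrite mxE.
have sgk k : 0 < sg ord0 k by have := sg0 k; rewrite mxE.
have q0 : vle 0 q.
  move=> k; rewrite [X in (X <= _)%O]mxE; apply: (qP (fun x => 0 <= x)) => // i.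
  by rewrite divr_ge0 ?(ltW (sgk i)) //; have := rho0 i; rewrite mxE => /ltW.
have q1 k : q ord0 k < 1.
  by apply: (qP (fun x => x < 1)) => // i; rewrite ltr_pdivrMr ?mul1r //; exact: rhosg.
have q'0 : vle 0 q' by move=> k; rewrite !mxE.
have q'1 k : q' ord0 k < 1 by rewrite mxE.
pose M := M0 * kk * B * (1 + t^-1) * 2.
have t10 : 0 <= 1 + t^-1 by apply: addr_ge0 => //; rewrite invr_ge0; exact: ltW.
have M_ge0 : 0 <= M by rewrite /M; do 4! apply: mulr_ge0 => //.
pose g (p : mindex (n + 1) * mindex (n + 1)) := M * (mpow q p.1 * mpow q' p.2).
have g0 p : 0 <= g p by apply: mulr_ge0 => //; apply: mulr_ge0; exact: mpow_ge0.
exists s, g; split; last first.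
  move=> p; have [[b [I ->]]|H] := pselect (exists b I, p = phi b I).
    rewrite (_ : (fun w => _) = fun w => coef I * (if b then 1 else cross_cumulant 0) *
      (appell P Z (vsnoc I (b : nat)) (cvec (Z w)) / (mfact (vsnoc I (b : nat)))%:R)).
      by apply: cintegrableZ; exact: appell_int.
    by apply/funext => w; exact: wick_term_phi.
  rewrite (_ : (fun w => _) = fun=> 0); first exact: cintegrable0.
  by apply/funext => w; apply: wick_term_eq0 => b I pI; apply: H; exists b, I.
split => //; first exact: vltW.
  pose psi (p : mindex (n + 1) * mindex (n + 1)) : mindex ((n + 1) + (n + 1)) := row_mx p.1 p.2.
  have psi_inj : injective psi by move=> [L J] [L' J'] /eq_row_mx /= [-> ->].
  have Q0 : vle 0 (row_mx q q').
    move=> k; rewrite [X in (X <= _)%O]mxE [X in (_ <= X)%O]mxE.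
    by case: (fintype.split k) => j; [have := q0 j|have := q'0 j]; rewrite [X in (X <= _)%O]mxE.
  have Q1 k : row_mx q q' ord0 k < 1 by rewrite mxE; case: (fintype.split k).
  have mE p : mpow (row_mx q q') (psi p) = mpow q p.1 * mpow q' p.2.
    by rewrite /mpow big_split_ord /=; congr (_ * _); apply: eq_bigr => k _; rewrite ?row_mxEl ?row_mxEr.
  apply: summZ => //; have := summ_inj psi_inj (fun L => mpow_ge0 L Q0) (summ_mpowW Q0 Q1).
  by apply: summ_le => p /=; rewrite mE.
move=> p z; have [[b [I ->]]|H] := pselect (exists b I, p = phi b I); last first.
  rewrite wick_term_eq0; first by rewrite cabs0; apply: mulr_ge0; [exact: g0|exact: expR_ge0].
  by move=> b I pI; apply: H; exists b, I.
rewrite wick_term_phi cabsM; set E := expR _.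
have E0 : 0 <= E by exact: expR_ge0.
have e1 : cabs (coef I * (if b then 1 else cross_cumulant 0)) <= M0 * mpow rho I * kk.
  rewrite cabsM; apply: ler_pM; rewrite ?cabs_ge0 ?cabs_coef_le //.
  by rewrite /kk; case: b; rewrite ?cabs1 ?lerDl ?lerDr ?cabs_ge0.
have e2 := appell_le (vsnoc I (b : nat)) z.
apply: le_trans (ler_pM (cabs_ge0 _) (cabs_ge0 _) e1 e2) _.
rewrite mulrA ler_wpM2r // /g /= /s /q !mpow_vsnoc expr0 mulr1 mpow_quot.
have -> : mpow q' (vsnoc 0 (b : nat)) = h ^+ b.
  have -> : q' = vsnoc (const_mx h) h by rewrite /vsnoc row_mx_const.
  by rewrite mpow_vsnoc mpow0 mul1r.
have rI := mpow_ge0 I (vltW rho0); have sI := mpow_gt0 I sg0.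
have -> : M0 * mpow rho I * kk * (B / (mpow sg I * t ^+ b)) =
    (M0 * kk * B * (mpow rho I / mpow sg I)) * (t ^+ b)^-1.
  by rewrite invfM; ring.
have -> : M * (mpow rho I / mpow sg I * h ^+ b) =
    (M0 * kk * B * (mpow rho I / mpow sg I)) * ((1 + t^-1) * (2 * h ^+ b)).
  rewrite /M; ring.
rewrite ler_wpM2l //.
  apply: mulr_ge0; first by do 2! apply: mulr_ge0 => //.
  by apply: divr_ge0 => //; exact: ltW.
have t1 : 0 < t^-1 by rewrite invr_gt0.
have h2 : 1 <= 2 * h ^+ b.
  by case: (b); rewrite ?expr0 ?expr1 /h ?mulr1 ?divff ?ler1n // pnatr_eq0.
apply: (@le_trans _ _ ((1 + t^-1) * 1)); last by rewrite ler_wpM2l.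
by case: (b); rewrite ?expr0 ?expr1 ?invr1 mulr1 ?lerDl ?lerDr // ltW.
Qed.

Section Correction.
Variables (sg : 'rV[R]_n) (A : R).
Hypothesis rhosg : vlt rho sg.
Hypothesis sgRX : vlt (map_mx EFin sg) RX.
Hypothesis A0 : 0 <= A.
Hypothesis crossA : forall xi, on_torus sg xi -> cabs (cross_cgf xi) <= A.

Local Notation rate := (\row_k (rho ord0 k / sg ord0 k)).

Let rate_ge0 : vle 0 rate.
Proof.
move=> k; have rk := rho0 k; rewrite !mxE in rk *; apply: divr_ge0; apply: ltW => //.
exact: lt_trans (rhosg k).
Qed.

Let rate_lt1 k : rate ord0 k < 1.
Proof.
have rk := rho0 k; rewrite !mxE in rk *; rewrite ltr_pdivrMr ?mul1r; first exact: rhosg.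
exact: lt_trans (rhosg k).
Qed.

Let decay_ge0 I : 0 <= bound * A * mpow rate I.
Proof.
by apply: mulr_ge0; [apply: mulr_ge0 => //; exact: bound_ge0|exact: mpow_ge0].
Qed.

(** The derivatives of [f] grow like [rho^I], and Cauchy's inequality for
    [cross_cgf] makes the cumulants decay like [sg^-I]. *)
Lemma wick_correction_le I z : cabs (wick_correction f K I z) <=
  bound * A * mpow rate I * expR (dot rho (vabs z)).
Proof.
have sg0 : vlt 0 sg by move=> k; apply: lt_trans (rhosg k).
have h := mseries_cauchy I egf_cross sg0 sgRX crossA.
rewrite /wick_correction mulrAC -mulrA cabsM mpow_quot.
apply: le_trans (ler_pM (cabs_ge0 _) (cabs_ge0 _) (cabs_mpartial_le I z) h) _.
by rewrite le_eqVlt; apply/orP; left; apply/eqP; ring.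
Qed.

Lemma cintegrable_wick_correction I : cintegrable P (fun w => wick_correction f K I (cvec (Xv w))).
Proof.
rewrite (_ : (fun w => _) = fun w => ((mfact I)%:R^-1 * joint_cumulant K (vsnoc I 1%N)) * mpartial I f (cvec (Xv w))).
  by apply: cintegrableZ; exact: (proj1 (coef_superposition I)).
by apply/funext => w; rewrite /wick_correction -/(vsnoc I 1%N); ring.
Qed.

Lemma L1norm_wick_correction_le I : (L1norm P Xv (wick_correction f K I) <=
  (bound * A * mpow rate I * mexp P Xv rho)%:E)%E.
Proof.
apply: (L1norm_le mX mgfX (vltW rho0) rhoRX) => //; last exact: wick_correction_le.
exact: cintegrable_measurable (cintegrable_wick_correction I).
Qed.

Let summ_decay : summ (fun I : {I : mindex n | I != 0} => bound * A * mpow rate (val I)).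
Proof.
exact: (@summ_inj R _ _ _ val_inj _ decay_ge0 (summZ (mulr_ge0 bound_ge0 A0) (summ_mpowW rate_ge0 rate_lt1))).
Qed.

Lemma wick_correction_abs_cvg :
  abs_cvg_locally_uniformly (fun I : {I : mindex n | I != 0} => wick_correction f K (val I)) /\
  abs_cvg_L1 P Xv (fun I : {I : mindex n | I != 0} => wick_correction f K (val I)).
Proof.
split.
  exact: (normal_abs_cvg_locally_uniformly (vltW rho0) (fun I => decay_ge0 (val I)) summ_decay
    (fun I z => wick_correction_le (val I) z)).
exact: (normal_abs_cvg_L1 (vltW rho0) (fun I => decay_ge0 (val I)) summ_decay
    (fun I z => wick_correction_le (val I) z) mX mgfX rhoRX
    (fun I => cintegrable_wick_correction (val I))).
Qed.

End Correction.

Lemma wick_defined_last : wick_defined P Z (lift_fun f) (@last_coord R n).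
Proof.
have [s [g [[s0 sRZ g0 sg hg] ci]]] := wick_term_dominated.
split; [by move=> I; exact: (proj1 (expectation_lift I))|by move=> J; exact: (proj1 (expectation_last J))| |].
  exact: (normal_abs_cvg_locally_uniformly s0 g0 sg hg).
exact: (normal_abs_cvg_L1 s0 g0 sg hg (measurable_adjoin_rv X Y) mgfZ sRZ ci).
Qed.

(** The mean of [Y] multiplies [f], but it is also the cumulant for [I = 0]:
    the two contributions cancel and leave the sum over [I != 0]. *)
Lemma wick_last x y : wick P Z (lift_fun f) (@last_coord R n) (vsnoc x y) =
  f x * y - summability.sum (fun I : {I : mindex n | I != 0} => wick_correction f K (val I) x).
Proof.
have [Sk HSk Hw] := hsum_wick x.
rewrite /wick (hsum_sum (Hw y)).
pose u (I : mindex n) := if I == 0 then 0 else wick_correction f K I x.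
have hu : hsum u (Sk - cross_cumulant 0 * f x).
  have h0 := @hsum_fset R (mindex n) [fset (0 : mindex n)]%fset
    (fun I => if I == 0 then - (cross_cumulant 0 * f x) else 0).
  rewrite big_seq_fset1 eqxx in h0.
  have h1 := hsumD HSk (h0 _); apply: (hsum_ext (h1 _)) => [I|I]; last first.
    rewrite /u; case: eqP => [->|_]; last by rewrite addr0.
    rewrite /wick_correction mfact0 divr1 mpartial0 mulrC -/(vsnoc 0 1%N).
    exact: subrr.
  by rewrite inE => /negbTE ->.
have uv : forall I : mindex n, (forall J : {I : mindex n | I != 0}, I <> val J) -> u I = 0.
  move=> I HI; rewrite /u; case: eqP => // /eqP I0.
  by have := HI (Sub I I0); rewrite SubK.
have h := (@hsum_inj R _ _ _ val_inj u _ uv).2 hu.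
rewrite (@hsum_sum _ _ _ (Sk - cross_cumulant 0 * f x)); first by ring.
apply: (hsum_ext h) => -[I I0] /=; by rewrite /u (negbTE I0).
Qed.

End WickProduct.

Theorem proposition2p4 (R : realType) (d : nat)
    (disp : measure_display) (T : measurableType disp) (P : probability T R)
    (X : 'I_d -> {RV P >-> R}) (RX : 'rV[\bar R]_d)
    (A : 'rV[R]_d -> R)
    (f : 'rV[R[i]]_d -> R[i]) (C : R) (r : 'rV[R]_d) :
  (forall k, (0 < RX ord0 k)%E) ->
  entire f ->
  0 < C ->
  vle 0 r -> vlt (map_mx EFin r) RX ->
  (forall z, cabs (f z) <= C * expR (dot r (vabs z))) ->
  exists Crs : 'rV[R]_d -> 'rV[R]_d -> R,
  forall (Y : {RV P >-> R}) (RY : \bar R)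
    (K : 'rV[R[i]]_(d + 1) -> R[i]) (eps : R),
  let Z := adjoin_rv X Y in
  let RZ := row_mx RX (const_mx RY) in
  (0 < RY)%E ->
  mgf_defined P Z RZ ->
  (forall theta, polydisc RZ theta -> mgf P Z theta != 0) ->
  is_cgf P Z RZ K ->
  0 < eps ->
  (forall sigma : 'rV[R]_d, vlt 0 sigma -> vlt (map_mx EFin sigma) RX ->
     forall xi : 'rV[R[i]]_d, polydisc (map_mx EFin sigma) xi ->
       cabs (partial (rshift d ord0) K (row_mx xi 0)) <= A sigma * eps) ->
  [/\ wick_defined P Z (lift_fun f) (@last_coord R d),
      forall (x : 'rV[R[i]]_d) (y : R[i]),
        wick P Z (lift_fun f) (@last_coord R d) (row_mx x (const_mx y)) =
        f x * y -
        summability.sum (fun I : {I : mindex d | I != 0} =>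
                           wick_correction f K (val I) x),
      abs_cvg_locally_uniformly (fun I : {I : mindex d | I != 0} =>
                                   wick_correction f K (val I)),
      abs_cvg_L1 P (random_vector X) (fun I : {I : mindex d | I != 0} =>
                                        wick_correction f K (val I)) &
      forall rho sigma : 'rV[R]_d,
        vlt r rho -> vlt rho sigma -> vlt (map_mx EFin sigma) RX ->
        forall I : mindex d, I != 0 ->
          (L1norm P (random_vector X) (wick_correction f K I) <=
           (Crs rho sigma * mpow (\row_k (rho ord0 k / sigma ord0 k)) I
            * eps)%:E)%E].
Proof.
move=> RX0 entf C0 r0 rRX fC.
have f0 k : (0 < unbounded_rad R d ord0 k)%E by rewrite mxE ltry.
have Ha : egf (unbounded_rad R d) (fun I => mpartial I f 0) f.
  by apply: holomorphic_egf => // z _; exact: entf.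
(* For each rho > r the derivatives of f at 0 are controlled by powers of the
   midpoint of r and rho, which leaves room for the density on the torus rho. *)
pose mid (rho : 'rV[R]_d) : 'rV[R]_d := \row_k ((r ord0 k + rho ord0 k) / 2).
have rk k : 0 <= r ord0 k by have := r0 k; rewrite mxE.
have midP rho : vlt r rho -> [/\ vlt r (mid rho), vle 0 (mid rho) & vlt (mid rho) rho].
  by move=> h; split => k; rewrite !mxE; have := h k; have := rk k; lra.
have [Cf HCf] : exists Cf : 'rV[R]_d -> R, forall rho, vlt r rho ->
    forall I, cabs (mpartial I f 0) <= Cf rho * mpow (mid rho) I.
  have Hex rho : exists c : R, vlt r rho -> forall I, cabs (mpartial I f 0) <= c * mpow (mid rho) I.
    have [h|h] := pselect (vlt r rho); last by exists 0.
    have [h1 _ _] := midP rho h.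
    by have [c Hc] := entire_coef_bound Ha fC r0 h1; exists c.
  by have [c Hc] := choice Hex; exists c.
(* The hypothesis on the cumulant-generating function is an estimate on open
   polydiscs; a larger radius provides it on the closed torus. *)
have [sg' Hsg'] : exists sg' : 'rV[R]_d -> 'rV[R]_d, forall sg, vlt (map_mx EFin sg) RX ->
    vlt sg (sg' sg) /\ vlt (map_mx EFin (sg' sg)) RX.
  have Hex sg : exists s : 'rV[R]_d, vlt (map_mx EFin sg) RX ->
      vlt sg s /\ vlt (map_mx EFin s) RX.
    have [h|h] := pselect (vlt (map_mx EFin sg) RX); last by exists 0.
    by have [s h1 h2] := vradius_between h; exists s.
  by have [s Hs] := choice Hex; exists s.
exists (fun rho sg => borel_bound (Cf rho) (mid rho) rho * A (sg' sg) * mexp P (random_vector X) rho).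
move=> Y RY K eps Z RZ RY0 mgfZ _ HK eps0 HA.
have crossA rho sg : vlt r rho -> vlt rho sg -> vlt (map_mx EFin sg) RX ->
    0 <= A (sg' sg) * eps /\ forall xi, on_torus sg xi -> cabs (cross_cgf K xi) <= A (sg' sg) * eps.
  move=> rrho rhosg sgRX; have [ss' s'RX] := Hsg' sg sgRX.
  have s'0 : vlt 0 (sg' sg).
    move=> k; apply: le_lt_trans (ss' k); apply: le_trans (ltW (rhosg k)).
    by apply: le_trans (ltW (rrho k)); exact: r0.
  have h xi : polydisc (map_mx EFin (sg' sg)) xi -> cabs (cross_cgf K xi) <= A (sg' sg) * eps.
    exact: HA.
  split => [|xi hxi].
    apply: le_trans (cabs_ge0 (cross_cgf K 0)) (h 0 (polydisc0 _)) => k.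
    by rewrite mxE lte_fin; have := s'0 k; rewrite mxE.
  apply: h; apply/polydiscP => k; rewrite hxi mxE lte_fin; exact: ss'.
have [rho rrho rhoRX] := vradius_between rRX.
have [sg rhosg sgRX] := vradius_between rhoRX.
have [_ m0 mrho] := midP rho rrho.
have [A0 HA'] := crossA rho sg rrho rhosg sgRX.
have [cvu cv1] := wick_correction_abs_cvg RX0 RY0 mgfZ HK Ha (HCf rho rrho) m0 mrho rhoRX rhosg sgRX A0 HA'.
split => //.
- exact: (wick_defined_last RX0 RY0 mgfZ HK Ha (HCf rho rrho) m0 mrho rhoRX).
- exact: (wick_last RX0 RY0 mgfZ HK Ha (HCf rho rrho) m0 mrho rhoRX).
move=> {}rho {}sg {}rrho {}rhosg {}sgRX I _ {m0 mrho rhoRX A0 HA' cvu cv1}.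
have rhoRX : vlt (map_mx EFin rho) RX.
  by move=> k; apply: lt_trans (sgRX k); rewrite !mxE lte_fin; exact: rhosg.
have [_ m0 mrho] := midP rho rrho.
have [A0 HA'] := crossA rho sg rrho rhosg sgRX.
apply: le_trans (L1norm_wick_correction_le RX0 RY0 mgfZ HK Ha (HCf rho rrho) m0 mrho rhoRX rhosg sgRX A0 HA' I) _.
rewrite lee_fin le_eqVlt; apply/orP; left; apply/eqP; ring.
Qed.
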